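(* Let $d\ge 1$ and let $\mathbb{A}:=\{\mathbf{a}_1,\dots,\mathbf{a}_d\}$ be a linearly independent set of vectors in $\mathbb{R}^d$. Let $A$ be the $d\times d$ real matrix whose rows are $\mathbf{a}_1^{\top},\dots,\mathbf{a}_d^{\top}$. Let $M\in(\mathbb{C}[\xi_1,\dots,\xi_d,\tau])^{m\times n}$ and let $$ \mathfrak{B}_{\mathcal{D}'_{\mathbb{A}}(\mathbb{R}^{d+1})}(M):=\left\{w\in(\mathcal{D}'_{\mathbb{A}}(\mathbb{R}^{d+1}))^{n}: M\left(\frac{\partial}{\partial x_1},\cdots,\frac{\partial}{\partial x_d},\frac{\partial}{\partial t}\right)w=0\right\}. $$ Then the following two statements are equivalent: (1) $\mathfrak{B}_{\mathcal{D}'_{\mathbb{A}}(\mathbb{R}^{d+1})}(M)$ is autonomous. (2) For all $\mathbf{v}\in A^{-1}\mathbb{Z}^d$, $\displaystyle\max_{t\in\mathbb{C}}\big(\operatorname{rank}(M(2\pi i\mathbf{v},t))\big)=n$.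
   Context: Notation. $\mathcal{D}(\mathbb{R}^k)$ is the space of complex-valued compactly supported smooth test functions on $\mathbb{R}^k$ and $\mathcal{D}'(\mathbb{R}^k)$ is the space of distributions. Points of $\mathbb{R}^{d+1}$ are written $(x_1,\dots,x_d,t)$, with $x$ the spatial variables and $t$ time. $A^{-1}\mathbb{Z}^d=\{A^{-1}\mathbf{n}:\mathbf{n}\in\mathbb{Z}^d\}\subset\mathbb{R}^d$. For $\mathbf{v}=(v_1,\dots,v_d)$ and $t\in\mathbb{C}$, $M(2\pi i\mathbf{v},t)\in\mathbb{C}^{m\times n}$ is the matrix obtained by substituting $\xi_k=2\pi i v_k$ ($k=1,\dots,d$) and $\tau=t$ in $M$. Differential operator. For $M=[p_{ij}]$, $M(\partial/\partial x_1,\dots,\partial/\partial x_d,\partial/\partial t)$ is obtained by replacing $\xi_k$ by $\partial/\partial x_k$ and $\tau$ by $\partial/\partial t$. It acts on $w=(w_1,\dots,w_n)$ (distributional derivatives), giving the $m$-tuple with $i$-th component $\sum_{j=1}^n p_{ij}(\partial/\partial x_1,\dots,\partial/\partial x_d,\partial/\partial t)w_j$. Spatially periodic distributions. For $\mathbf{a}\in\mathbb{R}^d$ and $T\in\mathcal{D}'(\mathbb{R}^d)$, the translation $\mathbf{S}_{\mathbf{a}}(T)$ is defined by $\langle\mathbf{S}_{\mathbf{a}}(T),\varphi\rangle=\langle T,\varphi(\cdot+\mathbf{a})\rangle$ for all $\varphi\in\mathcal{D}(\mathbb{R}^d)$. $\mathcal{D}'_{\mathbb{A}}(\mathbb{R}^d)$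 is the set of $T\in\mathcal{D}'(\mathbb{R}^d)$ with $\mathbf{S}_{\mathbf{a}_k}(T)=T$ for $k=1,\dots,d$. For $w\in\mathcal{D}'(\mathbb{R}^{d+1})$ and $\varphi\in\mathcal{D}(\mathbb{R})$, $\vec{w}(\varphi)\in\mathcal{D}'(\mathbb{R}^d)$ is defined by $\langle\vec{w}(\varphi),\psi\rangle=\langle w,\psi\otimes\varphi\rangle$ for $\psi\in\mathcal{D}(\mathbb{R}^d)$, where $(\psi\otimes\varphi)(x,t)=\psi(x)\varphi(t)$. Then $$\mathcal{D}'_{\mathbb{A}}(\mathbb{R}^{d+1})=\{w\in\mathcal{D}'(\mathbb{R}^{d+1}):\text{for all }\varphi\in\mathcal{D}(\mathbb{R}),\ \vec{w}(\varphi)\in\mathcal{D}'_{\mathbb{A}}(\mathbb{R}^d)\}.$$ Autonomy. The behaviour $\mathfrak{B}_{\mathcal{D}'_{\mathbb{A}}(\mathbb{R}^{d+1})}(M)$ is called autonomous if the only $w\in\mathfrak{B}_{\mathcal{D}'_{\mathbb{A}}(\mathbb{R}^{d+1})}(M)$ satisfying $w|_{t<0}=0$ is $w=0$; here $w|_{t<0}$ is the restriction of the distribution $w$ to the open half-space $\mathbb{R}^d\times(-\infty,0)$. *)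

(* Defs.v *)
From HB Require Import structures.
From mathcomp Require Import all_boot all_order all_algebra.
From mathcomp Require Import all_classical all_reals all_analysis.
From mathcomp Require Import complex.
From mathcomp Require Import -(notations) mpoly.

Set Implicit Arguments.
Unset Strict Implicit.
Unset Printing Implicit Defensive.

Import Order.TTheory GRing.Theory Num.Theory.
Import numFieldNormedType.Exports.

Local Open Scope classical_set_scope.
Local Open Scope complex_scope.
Local Open Scope ring_scope.

Section RealPartials.
Context {R : realType}.

Definition pderiv k (i : 'I_k) (f : 'rV[R]_k -> R) : 'rV[R]_k -> R :=
  fun x => 'D_(delta_mx 0 i) f x.

(* Higher partial derivatives are indexed by words of coordinate indices rather
   than by multi-indices: [pderivs [:: i1; ...; ir] f] is
   d/dx_i1 (... (d/dx_ir f)). *)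
Definition pderivs k (s : seq 'I_k) (f : 'rV[R]_k -> R) : 'rV[R]_k -> R :=
  foldr (@pderiv k) f s.

Definition smooth k (f : 'rV[R]_k -> R) : Prop :=
  forall s : seq 'I_k,
    (forall i x, derivable (pderivs s f) x (delta_mx 0 i)) /\
    continuous (pderivs s f).

Lemma pderivsD k (s : seq 'I_k) f g : smooth f -> smooth g ->
  pderivs s (f + g) = pderivs s f + pderivs s g.
Proof.
move=> sf sg; elim: s => //= i s ->; apply/funext => x.
by rewrite /pderiv deriveD//; [exact: (sf s).1|exact: (sg s).1].
Qed.

Lemma pderivsZ k (s : seq 'I_k) (c : R) f : smooth f ->
  pderivs s (c \*: f) = c \*: pderivs s f.
Proof.
move=> sf; elim: s => //= i s ->; apply/funext => x.
by rewrite /pderiv deriveZ//; exact: (sf s).1.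
Qed.

Lemma smoothD k (f g : 'rV[R]_k -> R) : smooth f -> smooth g -> smooth (f + g).
Proof.
move=> sf sg s; rewrite pderivsD//; split => [i x|x].
  by apply: derivableD; [exact: (sf s).1|exact: (sg s).1].
exact: (cvgD ((sf s).2 x) ((sg s).2 x)).
Qed.

Lemma smoothZ k (c : R) (f : 'rV[R]_k -> R) : smooth f -> smooth (c \*: f).
Proof.
move=> sf s; rewrite pderivsZ//; split => [i x|x].
  by apply: derivableZ; exact: (sf s).1.
exact: (cvgZr ((sf s).2 x)).
Qed.

Lemma pderivs0 k (s : seq 'I_k) : pderivs s (cst 0) = cst 0.
Proof.
by elim: s => //= i s ->; apply/funext => x; rewrite /pderiv derive_cst.
Qed.

Lemma smooth0 k : smooth (cst 0 : 'rV[R]_k -> R).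
Proof.
move=> s; rewrite pderivs0; split=> [i x|x]; first exact: derivable_cst.
exact: cst_continuous.
Qed.

Lemma pderivs_rcons k (s : seq 'I_k) i f :
  pderivs (rcons s i) f = pderivs s (pderiv i f).
Proof. by rewrite /pderivs foldr_rcons. Qed.

Lemma smooth_pderiv k (i : 'I_k) f : smooth f -> smooth (pderiv i f).
Proof. by move=> sf s; rewrite -pderivs_rcons; exact: sf. Qed.

Lemma pderivs_shift k (s : seq 'I_k) f (a : 'rV[R]_k) :
  pderivs s (f \o shift a) = pderivs s f \o shift a.
Proof.
elim: s => //= i s ->; apply/funext => x; rewrite /pderiv /= /derive.
set F := (X in lim (X @ _)); set G := (X in _ = lim (X @ _)).
by suff -> : F = G by []; apply/funext => h; rewrite /F /G /= addrA.
Qed.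

Lemma smooth_shift k f (a : 'rV[R]_k) : smooth f -> smooth (f \o shift a).
Proof.
move=> sf s; rewrite pderivs_shift; split=> [i x|x].
  have := (sf s).1 i (x + a); rewrite /derivable.
  set F := (X in cvg (X @ _) -> _); set G := (X in _ -> cvg (X @ _)).
  suff -> : F = G by [].
  by apply/funext => h; rewrite /F /G /= addrA.
by rewrite /continuous_at cvg_comp_shift; exact: (sf s).2.
Qed.

Definition rtensor p q (f : 'rV[R]_p -> R) (g : 'rV[R]_q -> R)
  : 'rV[R]_(p + q) -> R := fun z => f (lsubmx z) * g (rsubmx z).

Definition lindices p q (s : seq 'I_(p + q)) : seq 'I_p :=
  pmap (fun i : 'I_(p + q) =>
    if fintype.split i is inl j then Some j else None) s.

Definition rindices p q (s : seq 'I_(p + q)) : seq 'I_q :=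
  pmap (fun i : 'I_(p + q) =>
    if fintype.split i is inr j then Some j else None) s.

Lemma lsub_delta_l p q (j : 'I_p) :
  lsubmx (delta_mx 0 (lshift q j) : 'rV[R]_(p + q)) = delta_mx 0 j.
Proof. by apply/rowP => l; rewrite !mxE eq_lshift. Qed.

Lemma rsub_delta_l p q (j : 'I_p) :
  rsubmx (delta_mx 0 (lshift q j) : 'rV[R]_(p + q)) = 0.
Proof. by apply/rowP => l; rewrite !mxE eq_rlshift. Qed.

Lemma lsub_delta_r p q (j : 'I_q) :
  lsubmx (delta_mx 0 (rshift p j) : 'rV[R]_(p + q)) = 0.
Proof. by apply/rowP => l; rewrite !mxE eq_lrshift. Qed.

Lemma rsub_delta_r p q (j : 'I_q) :
  rsubmx (delta_mx 0 (rshift p j) : 'rV[R]_(p + q)) = delta_mx 0 j.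
Proof. by apply/rowP => l; rewrite !mxE eq_rshift. Qed.

Lemma lsubZD p q (h : R) (u z : 'rV[R]_(p + q)) :
  lsubmx (h *: u + z) = h *: lsubmx u + lsubmx z.
Proof. by apply/rowP => l; rewrite !mxE. Qed.

Lemma rsubZD p q (h : R) (u z : 'rV[R]_(p + q)) :
  rsubmx (h *: u + z) = h *: rsubmx u + rsubmx z.
Proof. by apply/rowP => l; rewrite !mxE. Qed.

Lemma rtensor_growth_l p q (j : 'I_p) (f : 'rV[R]_p -> R) (g : 'rV[R]_q -> R)
    (z : 'rV[R]_(p + q)) :
  (fun h : R => h^-1 *: ((rtensor f g \o shift z) (h *: delta_mx 0 (lshift q j))
     - rtensor f g z)) =
  (fun h : R => h^-1 *: (((g (rsubmx z) \*: f) \o shift (lsubmx z))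
     (h *: delta_mx 0 j) - (g (rsubmx z) \*: f) (lsubmx z))).
Proof.
apply/funext => h; rewrite /rtensor /=.
rewrite lsubZD rsubZD lsub_delta_l rsub_delta_l scaler0 add0r.
by congr (_ *: (_ - _)); exact: mulrC.
Qed.

Lemma rtensor_growth_r p q (j : 'I_q) (f : 'rV[R]_p -> R) (g : 'rV[R]_q -> R)
    (z : 'rV[R]_(p + q)) :
  (fun h : R => h^-1 *: ((rtensor f g \o shift z) (h *: delta_mx 0 (rshift p j))
     - rtensor f g z)) =
  (fun h : R => h^-1 *: (((f (lsubmx z) \*: g) \o shift (rsubmx z))
     (h *: delta_mx 0 j) - (f (lsubmx z) \*: g) (rsubmx z))).
Proof.
apply/funext => h; rewrite /rtensor /=.
by rewrite lsubZD rsubZD lsub_delta_r rsub_delta_r scaler0 add0r.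
Qed.

Lemma derive_rtensor_l p q (j : 'I_p) (f : 'rV[R]_p -> R) (g : 'rV[R]_q -> R)
    (z : 'rV[R]_(p + q)) :
  'D_(delta_mx 0 (lshift q j)) (rtensor f g) z =
  'D_(delta_mx 0 j) (g (rsubmx z) \*: f) (lsubmx z).
Proof. by rewrite /derive rtensor_growth_l. Qed.

Lemma derive_rtensor_r p q (j : 'I_q) (f : 'rV[R]_p -> R) (g : 'rV[R]_q -> R)
    (z : 'rV[R]_(p + q)) :
  'D_(delta_mx 0 (rshift p j)) (rtensor f g) z =
  'D_(delta_mx 0 j) (f (lsubmx z) \*: g) (rsubmx z).
Proof. by rewrite /derive rtensor_growth_r. Qed.

Lemma pderivs_rtensor p q (s : seq 'I_(p + q)) (f : 'rV[R]_p -> R)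
    (g : 'rV[R]_q -> R) : smooth f -> smooth g ->
  pderivs s (rtensor f g) =
  rtensor (pderivs (lindices s) f) (pderivs (rindices s) g).
Proof.
move=> sf sg; elim: s => //= i s ->; apply/funext => z.
rewrite /pderiv; case: (fintype.splitP i) => j ij /=.
  have -> : i = lshift q j by apply: val_inj.
  rewrite derive_rtensor_l deriveZ; first exact: mulrC.
  exact: (sf _).1.
have -> : i = rshift p j by apply: val_inj.
rewrite derive_rtensor_r deriveZ; first by [].
exact: (sg _).1.
Qed.

Lemma smooth_rtensor p q (f : 'rV[R]_p -> R) (g : 'rV[R]_q -> R) :
  smooth f -> smooth g -> smooth (rtensor f g).
Proof.
move=> sf sg s; rewrite pderivs_rtensor//.
have [dl cl] := sf (lindices s); have [dr cr] := sg (rindices s).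
split=> [i z|z].
  rewrite /derivable; case: (fintype.splitP i) => j ij.
    have -> : i = lshift q j by apply: val_inj.
    by rewrite rtensor_growth_l; exact: derivableZ.
  have -> : i = rshift p j by apply: val_inj.
  by rewrite rtensor_growth_r; exact: derivableZ.
have cL : {for z, continuous (pderivs (lindices s) f \o lsubmx)}.
  by apply: continuous_comp; [exact: continuous_lsubmx|exact: cl].
have cR : {for z, continuous (pderivs (rindices s) g \o rsubmx)}.
  by apply: continuous_comp; [exact: continuous_rsubmx|exact: cr].
exact: (cvgM cL cR).
Qed.

End RealPartials.

Section TestFunctions.
Context {R : realType}.
(* [R[i]] as a module over itself, which also gives it its usual topology. *)
Local Notation C := (R[i]^o).

Definition csmooth k (f : 'rV[R]_k -> C) : Prop :=
  smooth (@complex.Re R \o f) /\ smooth (@complex.Im R \o f).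

Definition cpderivs k (s : seq 'I_k) (f : 'rV[R]_k -> C) : 'rV[R]_k -> C :=
  fun x =>
    pderivs s (@complex.Re R \o f) x +i* pderivs s (@complex.Im R \o f) x.

Definition supp k (f : 'rV[R]_k -> C) : set 'rV[R]_k :=
  closure [set x | f x != 0].

Definition is_test k : set ('rV[R]_k -> C) :=
  [set f | csmooth f /\ compact (supp f)].

Definition test_pred k : {pred 'rV[R]_k -> C} := mem (@is_test k).

Lemma compact_supp k (K : set 'rV[R]_k) (f : 'rV[R]_k -> C) :
  compact K -> (forall x, f x != 0 -> K x) -> compact (supp f).
Proof.
move=> cK fK; apply: (subclosed_compact _ cK); first exact: closed_closure.
have : closed K by apply: compact_closed => //; exact: norm_hausdorff.
by move/closure_id ->; apply: closureS.
Qed.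

Lemma supp_sub k (f : 'rV[R]_k -> C) x : f x != 0 -> supp f x.
Proof. by move=> fx; apply: (@subset_closure _ [set y | f y != 0]). Qed.

Lemma ReZD k (a : R[i]) (f g : 'rV[R]_k -> C) :
  @complex.Re R \o (a *: f + g) =
  (complex.Re a \*: (@complex.Re R \o f)) +
  ((- complex.Im a) \*: (@complex.Im R \o f)) + (@complex.Re R \o g).
Proof.
apply/funext => x /=; case: a => a b; rewrite /GRing.add /GRing.scale /=.
rewrite /GRing.scale /=.
by case: (f x) (g x) => [u v] [u' v'] /=; rewrite mulNr.
Qed.

Lemma ImZD k (a : R[i]) (f g : 'rV[R]_k -> C) :
  @complex.Im R \o (a *: f + g) =
  (complex.Re a \*: (@complex.Im R \o f)) +
  (complex.Im a \*: (@complex.Re R \o f)) + (@complex.Im R \o g).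
Proof.
apply/funext => x /=; case: a => a b; rewrite /GRing.add /GRing.scale /=.
rewrite /GRing.scale /=.
by case: (f x) (g x) => [u v] [u' v'] /=.
Qed.

Lemma csmoothZD k (a : R[i]) (f g : 'rV[R]_k -> C) :
  csmooth f -> csmooth g -> csmooth (a *: f + g).
Proof.
move=> [rf jf] [rg jg]; split; rewrite ?ReZD ?ImZD;
  by apply: smoothD => //; apply: smoothD; exact: smoothZ.
Qed.

Lemma cpderivsZD k (s : seq 'I_k) (a : R[i]) (f g : 'rV[R]_k -> C) :
  csmooth f -> csmooth g ->
  cpderivs s (a *: f + g) = a *: cpderivs s f + cpderivs s g.
Proof.
move=> [rf jf] [rg jg]; apply/funext => x.
rewrite /cpderivs (ReZD a f g) (ImZD a f g).
set rF := (_ \o f) in rf *; set jF := (_ \o f) in jf *.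
rewrite (pderivsD s (smoothD (smoothZ _ rf) (smoothZ _ jf)) rg).
rewrite (pderivsD s (smoothD (smoothZ _ jf) (smoothZ _ rf)) jg).
rewrite (pderivsD s (smoothZ _ rf) (smoothZ _ jf)).
rewrite (pderivsD s (smoothZ _ jf) (smoothZ _ rf)).
rewrite !(pderivsZ s _ rf) !(pderivsZ s _ jf).
case: a => a b; rewrite /GRing.add /GRing.scale /= /GRing.scale /=.
by rewrite mulNr.
Qed.

Lemma test_submod_closed k : submod_closed (@test_pred k).
Proof.
split.
  apply: mem_set; split.
    split; [rewrite (_ : _ \o _ = cst 0)|rewrite (_ : _ \o _ = cst 0)] => //;
    exact: smooth0.
  apply: (@compact_supp _ set0); first exact: compact0.
  by move=> x; rewrite eqxx.
move=> a f g /set_mem[sf cf] /set_mem[sg cg]; apply: mem_set; split.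
  exact: csmoothZD.
apply: (@compact_supp _ (supp f `|` supp g)); first exact: compactU.
move=> x; have [fx0|fx0 _] := eqVneq (f x) 0; last by left; exact: supp_sub.
have [gx0|gx0 _] := eqVneq (g x) 0; last by right; exact: supp_sub.
by rewrite /GRing.add /GRing.scale /= fx0 gx0 scaler0 addr0 eqxx.
Qed.

HB.instance Definition _ k := GRing.isSubmodClosed.Build R[i] _ (@test_pred k)
  (@test_submod_closed k).

Record test k := Test {
  test_fun :> 'rV[R]_k -> C ;
  _ : test_fun \in @test_pred k }.

HB.instance Definition _ k := [isSub for @test_fun k].
HB.instance Definition _ k := [Choice of test k by <:].
HB.instance Definition _ k := [SubChoice_isSubLmodule of test k by <:].

End TestFunctions.
Arguments test R k : clear implicits.

Section TestOperations.
Context {R : realType}.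
Local Notation C := (R[i]^o).

Lemma csmooth_test k (phi : test R k) : csmooth phi.
Proof. by case: phi => f fT; have [] := set_mem fT. Qed.

Lemma compact_supp_test k (phi : test R k) : compact (supp phi).
Proof. by case: phi => f fT; have [] := set_mem fT. Qed.

Definition mk_test k (f : 'rV[R]_k -> C) (sf : csmooth f)
  (cf : compact (supp f)) : test R k := Test (mem_set (conj sf cf)).

Lemma testE k (a : R[i]) (phi psi : test R k) :
  a *: phi + psi = a *: (phi : _ -> C) + (psi : _ -> C) :> ('rV[R]_k -> C).
Proof. by []. Qed.

Lemma test_ext k (phi psi : test R k) : phi =1 psi -> phi = psi.
Proof. by move=> /funext e; exact: val_inj. Qed.

Lemma pderivs_supp k (s : seq 'I_k) (f : 'rV[R]_k -> R) (A : set 'rV[R]_k) :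
  closed A -> (forall x, ~ A x -> f x = 0) ->
  forall x, ~ A x -> pderivs s f x = 0.
Proof.
move=> cA fA; elim: s => //= i s IH x Ax; rewrite /pderiv.
rewrite (near_eq_derive (g := cst 0)) ?derive_cst//.
have : nbhs x (~` A) by apply: open_nbhs_nbhs; split => //; exact: closed_openC.
by apply: filterS => y; exact: IH.
Qed.

Lemma cpderivs_supp k (s : seq 'I_k) (f : 'rV[R]_k -> C) x :
  cpderivs s f x != 0 -> supp f x.
Proof.
apply: contraPP => fx /eqP; apply.
have f0 y : ~ supp f y -> f y = 0.
  by move=> fy; apply/eqP; apply: contra_notT fy => /supp_sub.
have cl : closed (supp f) by exact: closed_closure.
by rewrite /cpderivs !(pderivs_supp s cl)// => y /f0 /= ->.
Qed.

Lemma csmooth_cpderiv k (i : 'I_k) (f : 'rV[R]_k -> C) :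
  csmooth f -> csmooth (cpderivs [:: i] f).
Proof. by case=> rf jf; split; exact: smooth_pderiv. Qed.

Definition test_deriv k (i : 'I_k) (phi : test R k) : test R k :=
  mk_test (csmooth_cpderiv i (csmooth_test phi))
    (compact_supp (@compact_supp_test k phi) (@cpderivs_supp k [:: i] phi)).

Lemma csmooth_shift k (a : 'rV[R]_k) (f : 'rV[R]_k -> C) :
  csmooth f -> csmooth (f \o shift a).
Proof.
by case=> rf jf; split; [exact: (smooth_shift a rf)|exact: (smooth_shift a jf)].
Qed.

Lemma compact_supp_shift k (a : 'rV[R]_k) (f : 'rV[R]_k -> C) :
  compact (supp f) -> compact (supp (f \o shift a)).
Proof.
move=> cf; apply: (@compact_supp _ _ (shift (- a) @` supp f)); last first.
  by move=> x fx; exists (x + a); [exact: (@supp_sub _ k f)|exact: addrK].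
apply: continuous_compact => //; apply: continuous_subspaceT => x.
by rewrite /continuous_at -[shift _]/(id \o shift (- a)) cvg_comp_shift.
Qed.

(* phi(. + a) *)
Definition test_shift k (a : 'rV[R]_k) (phi : test R k) : test R k :=
  mk_test (csmooth_shift a (csmooth_test phi))
    (compact_supp_shift (a := a) (@compact_supp_test k phi)).

Definition ctensor p q (f : 'rV[R]_p -> C) (g : 'rV[R]_q -> C)
  : 'rV[R]_(p + q) -> C := fun z => f (lsubmx z) * g (rsubmx z).

Lemma Re_ctensor p q (f : 'rV[R]_p -> C) (g : 'rV[R]_q -> C) :
  @complex.Re R \o ctensor f g =
  rtensor (@complex.Re R \o f) (@complex.Re R \o g) +
  (- 1) \*: rtensor (@complex.Im R \o f) (@complex.Im R \o g).
Proof.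
apply/funext => z; rewrite /ctensor /rtensor /GRing.add /GRing.scale /=.
by case: (f _) (g _) => [a b] [c d] /=; rewrite scaleN1r.
Qed.

Lemma Im_ctensor p q (f : 'rV[R]_p -> C) (g : 'rV[R]_q -> C) :
  @complex.Im R \o ctensor f g =
  rtensor (@complex.Re R \o f) (@complex.Im R \o g) +
  rtensor (@complex.Im R \o f) (@complex.Re R \o g).
Proof.
apply/funext => z; rewrite /ctensor /rtensor /GRing.add /=.
by case: (f _) (g _) => [a b] [c d] /=.
Qed.

Lemma csmooth_tensor p q (f : 'rV[R]_p -> C) (g : 'rV[R]_q -> C) :
  csmooth f -> csmooth g -> csmooth (ctensor f g).
Proof.
move=> [rf jf] [rg jg]; split.
  rewrite Re_ctensor; apply: smoothD; first exact: smooth_rtensor.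
  by apply: smoothZ; exact: smooth_rtensor.
by rewrite Im_ctensor; apply: smoothD; exact: smooth_rtensor.
Qed.

Lemma cpderivs_tensor p q (s : seq 'I_(p + q)) (f : 'rV[R]_p -> C)
    (g : 'rV[R]_q -> C) : csmooth f -> csmooth g ->
  cpderivs s (ctensor f g) =
  ctensor (cpderivs (lindices s) f) (cpderivs (rindices s) g).
Proof.
move=> [rf jf] [rg jg]; apply/funext => z.
rewrite /cpderivs (Re_ctensor f g) (Im_ctensor f g).
set rF := _ \o f in rf *; set jF := _ \o f in jf *.
set rG := _ \o g in rg *; set jG := _ \o g in jg *.
rewrite (pderivsD s (smooth_rtensor rf rg) (smoothZ _ (smooth_rtensor jf jg))).
rewrite (pderivsD s (smooth_rtensor rf jg) (smooth_rtensor jf rg)).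
rewrite (pderivsZ s _ (smooth_rtensor jf jg)).
rewrite (pderivs_rtensor s rf rg) (pderivs_rtensor s jf jg).
rewrite (pderivs_rtensor s rf jg) (pderivs_rtensor s jf rg).
have mulE (x y u v : R) : Complex (x * u + (- 1) *: (y * v)) (x * v + y * u) =
    (Complex x y : C) * (Complex u v : C) by rewrite scaleN1r.
exact: mulE.
Qed.

Lemma compact_box p q (A : set 'rV[R]_p) (B : set 'rV[R]_q) :
  compact A -> compact B ->
  compact [set z : 'rV[R]_(p + q) | A (lsubmx z) /\ B (rsubmx z)].
Proof.
move=> cA cB; apply: bounded_closed_compact; last first.
  have clA : closed A by apply: compact_closed => //; exact: norm_hausdorff.
  have clB : closed B by apply: compact_closed => //; exact: norm_hausdorff.
  apply: (@closedI _ (lsubmx @^-1` A) (rsubmx @^-1` B)).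
    by apply: closed_comp => // z _; exact: continuous_lsubmx.
  by apply: closed_comp => // z _; exact: continuous_rsubmx.
have [a [_ aA]] := compact_bounded cA; have [b [_ bB]] := compact_bounded cB.
exists (Num.max 0 (Num.max a b)); split; first exact: num_real.
move=> M; rewrite !gt_max => /and3P[M0 aM bM] z [Az Bz].
have lz := aA _ aM _ Az; have rz := bB _ bM _ Bz.
rewrite /= [`|z|]mx_normrE; apply/bigmax_leP; split=> [|[i j] _].
  exact: ltW.
rewrite -(hsubmxK z) (ord1 i) mxE; case: (fintype.split j) => l.
  apply: le_trans lz; rewrite [leRHS]mx_normrE.
  by apply: (@le_bigmax _ _ _ _ (fun ij => `|lsubmx z ij.1 ij.2|) (0, l)).
apply: le_trans rz; rewrite [leRHS]mx_normrE.
by apply: (@le_bigmax _ _ _ _ (fun ij => `|rsubmx z ij.1 ij.2|) (0, l)).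
Qed.

Lemma ctensor_supp p q (f : 'rV[R]_p -> C) (g : 'rV[R]_q -> C) z :
  ctensor f g z != 0 -> supp f (lsubmx z) /\ supp g (rsubmx z).
Proof.
rewrite /ctensor => fg; split; apply: supp_sub.
  by apply: contraNneq fg => ->; rewrite mul0r.
by apply: contraNneq fg => ->; rewrite mulr0.
Qed.

Definition test_tensor p q (phi : test R p) (psi : test R q) : test R (p + q) :=
  mk_test (csmooth_tensor (csmooth_test phi) (csmooth_test psi))
    (compact_supp
      (compact_box (@compact_supp_test p phi) (@compact_supp_test q psi))
      (@ctensor_supp p q phi psi)).

End TestOperations.

Section Distributions.
Context {R : realType}.
Local Notation C := (R[i]^o).

(* Convergence in the space of test functions: supports in a common compact set
   and uniform convergence of every partial derivative. *)
Definition test_cvg k (u : nat -> test R k) (phi : test R k) : Prop :=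
  (exists2 K : set 'rV[R]_k, compact K & forall j, supp (u j) `<=` K) /\
  forall (s : seq 'I_k) (e : R), 0 < e -> \forall j \near \oo,
    forall x, `|cpderivs s (u j) x - cpderivs s phi x : C| < e%:C.

Definition is_distribution k : set (test R k -> C) :=
  [set T : test R k -> C | linear T /\
    forall u phi, test_cvg u phi -> (fun j => T (u j)) @ \oo --> T phi].

Definition distribution_pred k : {pred test R k -> C} :=
  mem (@is_distribution k).

Lemma distribution_submod_closed k : submod_closed (@distribution_pred k).
Proof.
split.
  apply: mem_set; split=> [a phi psi|u phi _]; last exact: cvg_cst.
  by rewrite /GRing.zero /= scaler0 addr0.
move=> a S T /set_mem[lS cS] /set_mem[lT cT]; apply: mem_set; split.
  move=> b phi psi.
  have E chi : (a *: S + T) chi = a *: S chi + T chi by [].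
  by rewrite !E lS lT !scalerDr !scalerA [a * b]mulrC addrACA.
move=> u phi uphi.
exact: (cvgD (cvgZr (k := a) (cS _ _ uphi)) (cT _ _ uphi)).
Qed.

HB.instance Definition _ k := GRing.isSubmodClosed.Build R[i] _
  (@distribution_pred k) (@distribution_submod_closed k).

Record distribution k := Distribution {
  distribution_fun :> test R k -> C ;
  _ : distribution_fun \in @distribution_pred k }.

HB.instance Definition _ k := [isSub for @distribution_fun k].
HB.instance Definition _ k := [Choice of distribution k by <:].
HB.instance Definition _ k := [SubChoice_isSubLmodule of distribution k by <:].

Lemma distribution_linear k (T : distribution k) : linear T.
Proof. by case: T => f fT; have [] := set_mem fT. Qed.

Lemma distribution_cvg k (T : distribution k) u phi :
  test_cvg u phi -> (fun j => T (u j)) @ \oo --> T phi.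
Proof. by case: T => f fT; have [_] := set_mem fT; exact. Qed.

Definition test_op p q (F : test R p -> test R q) : Prop :=
  linear F /\ forall u phi, test_cvg u phi -> test_cvg (F \o u) (F phi).

Lemma distribution_comp p q (F : test R p -> test R q) (T : distribution q) :
  test_op F -> (T \o F) \in @distribution_pred p.
Proof.
move=> [lF cF]; apply: mem_set; split=> [a phi psi|u phi uphi].
  by rewrite /= lF distribution_linear.
exact: (distribution_cvg (cF _ _ uphi)).
Qed.

Definition pullback p q (F : test R p -> test R q) (opF : test_op F)
  (T : distribution q) : distribution p :=
  Distribution (distribution_comp T opF).

Lemma supp_subset k (K : set 'rV[R]_k) (f : 'rV[R]_k -> C) :
  compact K -> (forall x, f x != 0 -> K x) -> supp f `<=` K.
Proof.
move=> cK fK; have : closed K.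
  by apply: compact_closed => //; exact: norm_hausdorff.
by move/closure_id ->; apply: closureS.
Qed.

Lemma test_op_deriv k (i : 'I_k) : test_op (test_deriv i).
Proof.
split=> [a phi psi|u phi [[K cK uK] uphi]].
  apply: test_ext => x.
  have := cpderivsZD [:: i] a (csmooth_test phi) (csmooth_test psi).
  by move/(congr1 (fun f => f x)).
split.
  exists K => // j; apply: supp_subset => // x fx; apply: (uK j).
  exact: (@cpderivs_supp _ k [:: i]).
move=> s e e0; have := uphi (rcons s i) e e0; apply: filterS => j H x.
by have := H x; rewrite /cpderivs !pderivs_rcons.
Qed.

Lemma compact_shift k (a : 'rV[R]_k) (K : set 'rV[R]_k) :
  compact K -> compact (shift a @` K).
Proof.
move=> cK; apply: continuous_compact => //; apply: continuous_subspaceT => x.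
by rewrite /continuous_at -[shift _]/(id \o shift a) cvg_comp_shift.
Qed.

Lemma cpderivs_shift k (s : seq 'I_k) (a : 'rV[R]_k) (f : 'rV[R]_k -> C) :
  cpderivs s (f \o shift a) = cpderivs s f \o shift a.
Proof.
apply/funext => x; rewrite /cpderivs /=.
have := pderivs_shift s (@complex.Re R \o f) a.
have := pderivs_shift s (@complex.Im R \o f) a.
by move=> /(congr1 (fun g => g x)) + /(congr1 (fun g => g x)) => /= -> ->.
Qed.

Lemma test_op_shift k (a : 'rV[R]_k) : test_op (test_shift a).
Proof.
split=> [b phi psi|u phi [[K cK uK] uphi]]; first exact: test_ext.
split.
  exists (shift (- a) @` K); first exact: compact_shift.
  move=> j; apply: supp_subset; first exact: compact_shift.
  move=> x fx; exists (x + a); last exact: addrK.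
  by apply: (uK j); exact: supp_sub.
move=> s e e0; have := uphi s e e0; apply: filterS => j H x.
by have := H (x + a); rewrite /= !cpderivs_shift.
Qed.

Lemma pderivs_bounded k (s : seq 'I_k) (f : 'rV[R]_k -> R) (K : set 'rV[R]_k) :
  smooth f -> compact K -> (forall x, ~ K x -> f x = 0) ->
  exists2 B : R, 0 < B & forall x, `|pderivs s f x| <= B.
Proof.
move=> sf cK fK.
have clK : closed K by apply: compact_closed => //; exact: norm_hausdorff.
have cI : compact (pderivs s f @` K).
  apply: continuous_compact => //; apply: continuous_subspaceT.
  exact: (sf s).2.
have [B [_ BI]] := compact_bounded cI.
exists (Num.max B 0 + 1); first by rewrite ltr_pwDr// le_max lexx orbT.
move=> x; have [Kx|Kx] := pselect (K x).
  apply: BI; last by exists x.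
  by apply: ltr_pwDr => //; rewrite le_max lexx.
rewrite (pderivs_supp s clK fK Kx) normr0 ltW//.
by rewrite ltr_pwDr// le_max lexx orbT.
Qed.

Lemma cpderivs_bounded k (s : seq 'I_k) (phi : test R k) :
  exists2 B : R, 0 < B & forall x, `|cpderivs s phi x : C| <= B%:C.
Proof.
have [rf jf] := csmooth_test phi; have cK := @compact_supp_test _ _ phi.
have f0 y : ~ supp phi y -> phi y = 0.
  by move=> fy; apply/eqP; apply: contra_notT fy => /supp_sub.
have rf0 y : ~ supp phi y -> (@complex.Re R \o phi) y = 0.
  by move=> /f0 /= ->.
have jf0 y : ~ supp phi y -> (@complex.Im R \o phi) y = 0.
  by move=> /f0 /= ->.
have [A A0 rA] := pderivs_bounded s rf cK rf0.
have [B B0 jB] := pderivs_bounded s jf cK jf0.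
exists (A + B); first exact: addr_gt0.
move=> x; have := rA x; have := jB x; rewrite /cpderivs.
move: (pderivs _ _ x) (pderivs _ _ x) => u v vB uA.
rewrite normc_def lecR /=.
apply: (@le_trans _ _ (`|u| + `|v|)); last exact: (lerD uA vB).
rewrite -[leRHS]ger0_norm ?addr_ge0// -sqrtr_sqr ler_wsqrtr//.
rewrite -[u ^+ 2]real_normK ?num_real// -[v ^+ 2]real_normK ?num_real//.
by rewrite sqrrD lerD2r lerDl mulrn_wge0// mulr_ge0.
Qed.

Lemma test_op_tensor p q (psi : test R q) :
  test_op (fun phi : test R p => test_tensor phi psi).
Proof.
split=> [a phi chi|u phi [[K cK uK] uphi]].
  have E (x y w : C) : (a *: x + y) * w = a *: (x * w) + y * w.
    by rewrite mulrDl -scalerAl.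
  by apply: test_ext => z; exact: E.
have cB := compact_box cK (@compact_supp_test _ _ psi).
split.
  exists [set z | K (lsubmx z) /\ supp psi (rsubmx z)] => // j.
  apply: supp_subset => // z /ctensor_supp[uz pz]; split => //.
  exact: uK uz.
move=> s e e0; have [B B0 pB] := cpderivs_bounded (rindices s) psi.
have eB0 : 0 < e / B by exact: divr_gt0.
have := uphi (lindices s) _ eB0; apply: filterS => j H z.
rewrite /= !cpderivs_tensor; do ?exact: csmooth_test.
rewrite /ctensor -mulrBl normrM.
apply: (@le_lt_trans _ _ (`|cpderivs (lindices s) (u j) (lsubmx z) -
    cpderivs (lindices s) phi (lsubmx z) : C| * B%:C)).
  by rewrite ler_wpM2l.
rewrite -[e](divfK (lt0r_neq0 B0)) rmorphM /=.
by rewrite ltr_pM2r; [exact: H|rewrite ltcR].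
Qed.

Definition dderiv k (i : 'I_k) (T : distribution k) : distribution k :=
  - pullback (test_op_deriv i) T.

Lemma dderivE k (i : 'I_k) (T : distribution k) (phi : test R k) :
  dderiv i T phi = - T (test_deriv i phi).
Proof. by []. Qed.

(* <S_a T, phi> = <T, phi(. + a)> *)
Definition dshift k (a : 'rV[R]_k) (T : distribution k) : distribution k :=
  pullback (test_op_shift a) T.

(* the distribution psi |-> <w, psi (x) phi> *)
Definition dslice p q (w : distribution (p + q)) (phi : test R q)
  : distribution p := pullback (test_op_tensor p phi) w.

(* [vanishes_on U T] says that the restriction of T to the open set U is 0. *)
Definition vanishes_on k (U : set 'rV[R]_k) (T : distribution k) : Prop :=
  forall phi : test R k, supp phi `<=` U -> T phi = 0.

End Distributions.

Section Behaviours.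
Context {R : realType}.

(* 'X_i acts as d/dx_i *)
Definition monomial_deriv k (mu : multinom k) (T : distribution k)
  : distribution k :=
  foldr (fun i => iter (mu i) (@dderiv R k i)) T (enum 'I_k).

Definition poly_deriv k (p : mpoly k R[i]) (T : distribution k)
  : distribution k :=
  \sum_(mu <- msupp p) mcoeff mu p *: monomial_deriv mu T.

Definition matrix_deriv k m n (M : 'M[mpoly k R[i]]_(m, n))
    (w : 'I_n -> distribution k) : 'I_m -> distribution k :=
  fun i => \sum_(j < n) poly_deriv (M i j) (w j).

Definition periodic d (a : 'I_d -> 'rV[R]_d) : set (distribution d) :=
  [set T | forall k, dshift (a k) T = T].

(* The first d coordinates of 'rV_(d + 1) are the spatial variables, the last
   one is time. *)
Definition spatially_periodic d (a : 'I_d -> 'rV[R]_d)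
  : set (distribution (d + 1)) :=
  [set w | forall phi : test R 1, periodic a (dslice w phi)].

Definition behaviour d m n (a : 'I_d -> 'rV[R]_d)
    (M : 'M[mpoly (d + 1) R[i]]_(m, n))
  : set ('I_n -> distribution (d + 1)) :=
  [set w | (forall j, spatially_periodic a (w j)) /\
           (forall i, matrix_deriv M w i = 0)].

Definition past d : set 'rV[R]_(d + 1) :=
  [set z | rsubmx z 0 0 < 0].

Definition autonomous d n (B : set ('I_n -> distribution (d + 1))) : Prop :=
  forall w, B w -> (forall j, vanishes_on (@past d) (w j)) ->
  forall j, w j = 0.

(* M(2 pi i v, t) *)
Definition eval_at d m n (M : 'M[mpoly (d + 1) R[i]]_(m, n)) (v : 'cV[R]_d)
    (t : R[i]) : 'M[R[i]]_(m, n) :=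
  map_mx (meval (fun l : 'I_(d + 1) =>
    match fintype.split l with
    | inl k => (2 * pi)%:C * 'i%C * (v k 0)%:C
    | inr _ => t
    end)) M.

(* A^-1 Z^d *)
Definition inverse_lattice d (A : 'M[R]_d) : set 'cV[R]_d :=
  [set invmx A *m map_mx intr z | z in [set: 'cV[int]_d]].

Definition is_max (S : set nat) (r : nat) : Prop := S r /\ ubound S r.

End Behaviours.

(* Main.v *)
From mathcomp Require Import all_boot all_order all_algebra.
From mathcomp Require Import generic_quotient fraction.
From mathcomp Require Import all_classical all_reals all_analysis.
From mathcomp Require Import complex.
From mathcomp Require Import -(notations) mpoly.
From mathcomp Require Import ring lra zify.
Require Import Defs.

Set Implicit Arguments.
Unset Strict Implicit.
Unset Printing Implicit Defensive.

Import Order.TTheory GRing.Theory Num.Theory.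
Import numFieldNormedType.Exports.

Local Open Scope classical_set_scope.
Local Open Scope complex_scope.
Local Open Scope ring_scope.

(**
   Fix a frequency v in A^-1 Z^d. On a distribution that transforms under spatial
   translations like exp(2 i pi v.x), the operator d/dx_k is multiplication by
   2 i pi v_k, so the partial differential system M becomes the system of ordinary
   differential equations in time with the polynomial matrix
   Q(tau) = M(2 i pi v, tau). Two facts decide what happens at this frequency.

   - If Q has rank n at one point, then U Q = p I for a polynomial matrix U and a
     nonzero polynomial p ([poly_left_inverse]), so each component satisfies
     p(d/dt) w_j = 0. Factoring p over the complex numbers reduces uniqueness to
     first-order equations: a solution without past is 0 ([first_order_unique],
     [poly_op_unique]).

   - If Q has rank less than n everywhere, then Q r = 0 for a nonzero polynomial
     vector r ([poly_kernel]), and w = r(d/dt) (exp(2 i pi v.x) (x) delta_0(t)) is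
     a solution without past. It is not 0, again by [poly_op_unique].

   The second fact gives (1) => (2) at once, given the plane wave. It is the limit
   of Riemann sums over finer and finer cubic meshes ([plane_wave]); taking the
   limit along an ultrafilter avoids any discussion of convergence, and only
   linearity, bounds and translation invariance are used.

   For (2) => (1), a periodic trajectory without past has to be decomposed into
   its frequencies. For a period a and an integer z, the Fourier part of w is the
   mean over s in [0, 1] of exp(2 i pi z s) w(phi(. + s a)) ([fourier_part]). It is
   a distribution on which translation by s a acts as exp(- 2 i pi z s), it
   satisfies the same equations, and it has no past if w has none. By the Fejer
   kernel a continuous periodic function whose Fourier coefficients are 0 vanishes
   ([fourier_unique]); applied to s |-> w(phi(. + s a)) this shows that w is 0 as
   soon as all its Fourier parts are ([fourier_part_complete]). Splitting off the
   directions a_1, ..., a_d successively leaves trajectories of a single frequency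
   v, to which the first fact applies ([behaviour_past_eq0]). No convergence of
   Fourier series of distributions is needed.

   Spatial periodicity is defined through slices, that is on tensor products of
   test functions only. It extends to all test functions because tensor products
   are total ([tensors_total]): the convolution in time of phi with a bump is
   approximated, with all derivatives, both by sums of tensor products and by
   combinations of translates of phi.
*)

(** * Complex numbers with a real modulus *)

Section ComplexModulus.
Context {R : realType}.
Implicit Types x y : R[i].

(** Real-valued, so that estimates take place in a totally ordered field. *)
Definition cabs x : R := complex.Re `|x|.

Lemma normr_cabs x : `|x| = (cabs x)%:C.
Proof. by rewrite /cabs normc_def. Qed.

Lemma cabs_ge0 x : 0 <= cabs x.
Proof. by rewrite /cabs normc_def /= sqrtr_ge0. Qed.

Lemma cabs0 : cabs 0 = 0.
Proof. by rewrite /cabs normr0. Qed.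

Lemma cabs1 : cabs 1 = 1.
Proof. by rewrite /cabs normr1. Qed.

Lemma cabs_eq0 x : (cabs x == 0) = (x == 0).
Proof. by rewrite -(inj_eq (@complexI _)) -normr_cabs normr_eq0. Qed.

Lemma cabsN x : cabs (- x) = cabs x.
Proof. by rewrite /cabs normrN. Qed.

Lemma cabsC x y : cabs (x - y) = cabs (y - x).
Proof. by rewrite /cabs distrC. Qed.

Lemma cabsM x y : cabs (x * y) = cabs x * cabs y.
Proof. by apply: complexI; rewrite rmorphM /= -!normr_cabs normrM. Qed.

Lemma cabsD x y : cabs (x + y) <= cabs x + cabs y.
Proof. by rewrite -lecR rmorphD /= -!normr_cabs ler_normD. Qed.

Lemma cabsB x y : cabs (x - y) <= cabs x + cabs y.
Proof. by rewrite -(cabsN y) cabsD. Qed.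

Lemma cabsr (a : R) : cabs a%:C = `|a|.
Proof. by rewrite /cabs normc_def /= expr0n addr0 sqrtr_sqr. Qed.

Lemma cabs_sum I (r : seq I) (P : pred I) (F : I -> R[i]) :
  cabs (\sum_(i <- r | P i) F i) <= \sum_(i <- r | P i) cabs (F i).
Proof.
elim/big_ind2 : _ => [|a b c d ab cd|//]; first by rewrite cabs0.
by rewrite (le_trans (cabsD _ _))// lerD.
Qed.

Lemma cabs_sqr x : cabs x ^+ 2 = complex.Re x ^+ 2 + complex.Im x ^+ 2.
Proof. by apply: complexI; rewrite rmorphXn /= -normr_cabs -add_Re2_Im2. Qed.

Lemma Re_le_cabs x : `|complex.Re x| <= cabs x.
Proof. by rewrite -lecR -normr_cabs normc_ge_Re. Qed.

Lemma Im_le_cabs x : `|complex.Im x| <= cabs x.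
Proof.
rewrite -(@ler_pXn2r _ 2) ?nnegrE ?cabs_ge0// cabs_sqr.
by rewrite real_normK ?num_real// lerDr sqr_ge0.
Qed.

Lemma complex_ext x y :
  complex.Re x = complex.Re y -> complex.Im x = complex.Im y -> x = y.
Proof. by case: x y => [a b] [c d] /= -> ->. Qed.

Lemma ReD x y : complex.Re (x + y) = complex.Re x + complex.Re y.
Proof. by case: x y => [a b] [c d]. Qed.
Lemma ImD x y : complex.Im (x + y) = complex.Im x + complex.Im y.
Proof. by case: x y => [a b] [c d]. Qed.
Lemma ReB x y : complex.Re (x - y) = complex.Re x - complex.Re y.
Proof. by case: x y => [a b] [c d]. Qed.
Lemma ImB x y : complex.Im (x - y) = complex.Im x - complex.Im y.
Proof. by case: x y => [a b] [c d]. Qed.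

Lemma cabs_le_ReIm x : cabs x <= `|complex.Re x| + `|complex.Im x|.
Proof.
rewrite -(@ler_pXn2r _ 2) ?nnegrE ?cabs_ge0 ?addr_ge0// cabs_sqr.
rewrite sqrrD !real_normK ?num_real//.
have := mulr_ge0 (normr_ge0 (complex.Re x)) (normr_ge0 (complex.Im x)).
lra.
Qed.

Lemma cvgC_cabsP (u : nat -> R[i]^o) (l : R[i]^o) :
  (u @ \oo --> l) <->
  (forall e : R, 0 < e -> \forall n \near \oo, cabs (u n - l) < e).
Proof.
split=> [/cvgrPdist_lt ul e e0|ul].
  have /ul : 0 < e%:C by rewrite ltcR.
  by apply: filterS => n; rewrite distrC normr_cabs ltcR.
apply/cvgrPdist_lt => -[e e']; rewrite ltcE /= => /andP[/eqP -> e0].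
by have := ul _ e0; apply: filterS => n; rewrite distrC normr_cabs ltcR.
Qed.

End ComplexModulus.

(** * Limits of bounded sequences along an ultrafilter *)

Section UltraLimit.
Context {R : realType}.

(** A nonprincipal ultrafilter gives every bounded sequence a limit at once, so
   that limits of Riemann sums need no convergence proof. *)
Definition omega : set_system nat :=
  projT1 (cid (ultraFilterLemma eventually_filter)).

Lemma omega_ultra : UltraFilter omega.
Proof. by rewrite /omega; case: cid => G []. Qed.

Global Instance omega_filter : ProperFilter omega.
Proof. exact: (@ultra_proper _ _ omega_ultra). Qed.

Lemma omega_oo (A : set nat) : \oo A -> omega A.
Proof. by rewrite /omega; case: cid => G [_ /=]; apply. Qed.

Lemma omega_is_cvg (u : nat -> R) (B : R) :
  (forall n, `|u n| <= B) -> cvg (u n @[n --> omega]).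
Proof.
move=> uB; have cK := @segment_compact R (- B) B.
have uK : (u n @[n --> omega]) `[- B, B]%classic.
  by apply: (@filterE _ omega) => n /=; rewrite in_itv/= -ler_norml.
have [p [_ pc]] := cK _ (fmap_proper_filter u omega_filter) uK.
apply/cvg_ex; exists p => V Vp.
have [//|UV] := in_ultra_setVsetC (u @^-1` V) omega_ultra.
by have [x []] := pc (~` V) V UV Vp.
Qed.

Definition bounded_seq (u : nat -> R[i]) := exists B : R, forall n, cabs (u n) <= B.

Definition ulim (u : nat -> R[i]) : R[i] :=
  lim (complex.Re (u n) @[n --> omega]) +i* lim (complex.Im (u n) @[n --> omega]).

Lemma bounded_seq_Re u : bounded_seq u -> cvg (complex.Re (u n) @[n --> omega]).
Proof.
move=> [B uB]; apply: (@omega_is_cvg _ B) => n.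
exact: le_trans (Re_le_cabs _) (uB n).
Qed.

Lemma bounded_seq_Im u : bounded_seq u -> cvg (complex.Im (u n) @[n --> omega]).
Proof.
move=> [B uB]; apply: (@omega_is_cvg _ B) => n.
exact: le_trans (Im_le_cabs _) (uB n).
Qed.

Lemma ulimD u v : bounded_seq u -> bounded_seq v ->
  ulim (fun n => u n + v n) = ulim u + ulim v.
Proof.
move=> bu bv; apply: complex_ext.
  rewrite ReD /=; rewrite (_ : (fun n => complex.Re _) =
    (fun n => complex.Re (u n) + complex.Re (v n))).
    by rewrite limD//; exact: bounded_seq_Re.
  by apply/funext => n; rewrite ReD.
rewrite ImD /=; rewrite (_ : (fun n => complex.Im _) =
  (fun n => complex.Im (u n) + complex.Im (v n))).
  by rewrite limD//; exact: bounded_seq_Im.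
by apply/funext => n; rewrite ImD.
Qed.

Lemma ulimZ (c : R[i]) u : bounded_seq u -> ulim (fun n => c * u n) = c * ulim u.
Proof.
move=> bu; have ru := bounded_seq_Re bu; have iu := bounded_seq_Im bu.
case: c => a b.
have cZ (x : R) (f : nat -> R) : cvg (f n @[n --> omega]) ->
    cvg (x * f n @[n --> omega]).
  by move=> cf; apply: (@is_cvgM _ _ _ _ (cst x) f) => //; exact: is_cvg_cst.
have lZ (x : R) (f : nat -> R) : cvg (f n @[n --> omega]) ->
    lim (x * f n @[n --> omega]) = x * lim (f n @[n --> omega]).
  move=> cf; rewrite (@limM _ _ _ _ (cst x) f)//; last exact: is_cvg_cst.
  by rewrite lim_cst.
apply: complex_ext => /=.
  rewrite (_ : (fun n => _) =
     (fun n => a * complex.Re (u n) - b * complex.Im (u n))); last first.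
    by apply/funext => n; case: (u n).
  by rewrite limB; [rewrite !lZ|exact: cZ|exact: cZ].
rewrite (_ : (fun n => _) =
   (fun n => a * complex.Im (u n) + b * complex.Re (u n))); last first.
  by apply/funext => n; case: (u n).
by rewrite limD; [rewrite !lZ|exact: cZ|exact: cZ].
Qed.

Lemma bounded_seqZ c u : bounded_seq u -> bounded_seq (fun n => c * u n).
Proof.
move=> [B uB]; exists (cabs c * B) => n.
by rewrite cabsM ler_wpM2l// cabs_ge0.
Qed.

Lemma ulimB u v : bounded_seq u -> bounded_seq v ->
  ulim (fun n => u n - v n) = ulim u - ulim v.
Proof.
move=> bu bv; rewrite -[- ulim v]mulN1r -ulimZ// -ulimD//; last exact: bounded_seqZ.
by congr ulim; apply/funext => n; rewrite mulN1r.
Qed.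

(** The factor 2 comes from treating real and imaginary parts separately. *)
Lemma cabs_ulim_le u B : bounded_seq u ->
  (\forall n \near \oo, cabs (u n) <= B) -> cabs (ulim u) <= 2 * B.
Proof.
move=> bu /omega_oo uB; rewrite (le_trans (cabs_le_ReIm _))//= mulrDl !mul1r.
have bound (f : R[i] -> R) : (forall x, `|f x| <= cabs x) ->
    cvg (f (u n) @[n --> omega]) -> `|lim (f (u n) @[n --> omega])| <= B.
  move=> fc fu; rewrite ler_norml; apply/andP; split.
    apply: limr_ge => //; apply: filterS uB => n un.
    by rewrite lerNl (le_trans _ un)// (le_trans _ (fc _))// -normrN ler_norm.
  apply: limr_le => //; apply: filterS uB => n un.
  by rewrite (le_trans _ un)// (le_trans _ (fc _))// ler_norm.
apply: lerD; apply: bound => //.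
- exact: Re_le_cabs.
- exact: bounded_seq_Re.
- exact: Im_le_cabs.
- exact: bounded_seq_Im.
Qed.

Lemma ulim_eq0 u : bounded_seq u ->
  (forall e : R, 0 < e -> \forall n \near \oo, cabs (u n) <= e) -> ulim u = 0.
Proof.
move=> bu u0; apply/eqP; rewrite -cabs_eq0 eq_le cabs_ge0 andbT.
apply/ler_addgt0Pl => e e0; rewrite addr0.
have -> : e = 2 * (e / 2) by rewrite mulrC divfK.
by apply: cabs_ulim_le => //; apply: u0; rewrite divr_gt0.
Qed.

Lemma ulim_eq u v : bounded_seq u -> bounded_seq v ->
  (forall e : R, 0 < e -> \forall n \near \oo, cabs (u n - v n) <= e) ->
  ulim u = ulim v.
Proof.
move=> bu bv uv; apply/eqP; rewrite -subr_eq0 -ulimB//; apply/eqP/ulim_eq0 => //.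
have [A uA] := bu; have [B vB] := bv; exists (A + B) => n.
by rewrite (le_trans (cabsB _ _))// lerD.
Qed.

Lemma Re_ulim_ge u c : bounded_seq u ->
  (\forall n \near \oo, c <= complex.Re (u n)) -> c <= complex.Re (ulim u).
Proof.
by move=> bu /omega_oo uc; apply: limr_ge => //; exact: bounded_seq_Re.
Qed.

End UltraLimit.

(** * Partial derivatives of real functions *)

Section Coordinates.
Context {R : realType}.
Variable k : nat.
Implicit Types (f : 'rV[R]_k -> R) (x y : 'rV[R]_k) (i j : 'I_k).

Local Notation basis i := (delta_mx 0 i : 'rV[R]_k).

Lemma is_derive_line f x e (s : R) : derivable f (x + s *: e) e ->
  is_derive s 1 (fun r : R => f (x + r *: e)) ('D_e f (x + s *: e)).
Proof.
have E : (fun h : R => h^-1 *: (((fun r : R => f (x + r *: e)) \o shift s) (h *: 1)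
     - f (x + s *: e))) =
  (fun h : R => h^-1 *: ((f \o shift (x + s *: e)) (h *: e) - f (x + s *: e))).
  apply/funext => h /=; congr (_ *: (f _ - _)).
  by rewrite [h *: 1]mulr1 scalerDl addrCA addrA addrC.
by move=> df; split; [rewrite /derivable E|rewrite /derive E].
Qed.

Lemma mvt_line f e x (h : R) : (forall y, derivable f y e) ->
  exists2 c : R, `|c| <= `|h| & f (x + h *: e) - f x = h * 'D_e f (x + c *: e).
Proof.
move=> df.
have dl (s : R) : is_derive s 1 (fun r : R => f (x + r *: e)) ('D_e f (x + s *: e)).
  exact: is_derive_line.
have cl (a b : R) : {within `[a, b], continuous (fun r : R => f (x + r *: e))}.
  by apply: derivable_within_continuous => s _; exact: ex_derive.
have [h0|h0] := leP 0 h.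
  have [c] := MVT_segment h0 (fun s _ => dl s) (cl 0 h).
  rewrite in_itv /= => /andP[c0 ch]; rewrite scale0r addr0 subr0 => ->.
  by exists c; rewrite 1?mulrC// !ger0_norm.
have [c] := MVT_segment (ltW h0) (fun s _ => dl s) (cl h 0).
rewrite in_itv /= => /andP[c0 ch]; rewrite scale0r addr0 sub0r => E.
exists c; first by rewrite !ler0_norm ?lerN2// ltW.
by rewrite -opprB E mulrN opprK mulrC.
Qed.

Lemma smooth_derivable f : smooth f -> forall i x, derivable f x (basis i).
Proof. by move=> sf i x; exact: (sf [::]).1. Qed.

Lemma smooth_continuous f : smooth f -> continuous f.
Proof. by move=> sf; exact: (sf [::]).2. Qed.

Lemma norm_basis i : `|basis i| <= 1.
Proof.
rewrite [leLHS]mx_normrE; apply/bigmax_leP; split => // -[a b] _ /=.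
by rewrite mxE; case: (_ && _); rewrite ?normr1 ?normr0.
Qed.

(** The mean value theorem is applied to the j-difference of f along direction
   i, then to the i-derivative along direction j. *)
Lemma second_difference f i j x (h : R) : smooth f ->
  exists a b : R, [/\ `|a| <= `|h|, `|b| <= `|h| &
   f (x + h *: basis i + h *: basis j) - f (x + h *: basis i)
   - (f (x + h *: basis j) - f x) =
   h * (h * pderiv j (pderiv i f) (x + a *: basis i + b *: basis j))].
Proof.
move=> sf; pose g y := f (y + h *: basis j) - f y.
have dg y : derivable g y (basis i).
  apply: derivableB; last exact: smooth_derivable.
  exact: (smooth_derivable (smooth_shift (h *: basis j) sf)).
have [a ah E] := mvt_line x h dg.
have [b bh E'] := mvt_line (x + a *: basis i) h
  (@smooth_derivable _ (smooth_pderiv i sf) j).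
exists a, b; split => //.
rewrite /g in E; rewrite E; congr (h * _); rewrite -E' deriveB.
- by have := pderivs_shift [:: i] f (h *: basis j) => /(congr1 (@^~ (x + a *: basis i))) /= <-.
- exact: (smooth_derivable (smooth_shift (h *: basis j) sf)).
- exact: smooth_derivable.
Qed.

(** Schwarz: both mixed derivatives are limits of the same second difference
   quotient. *)
Lemma pderivC f i j : smooth f -> pderiv i (pderiv j f) = pderiv j (pderiv i f).
Proof.
move=> sf; apply/funext => x.
set F := pderiv i _; set G := pderiv j _.
have near_pt (u : 'rV[R]_k -> R) (e : R) : continuous u -> 0 < e ->
    exists2 d : R, 0 < d & forall y, `|x - y| < d -> `|u x - u y| < e.
  move=> cu e0; have /cvgrPdist_lt/(_ e e0)/nbhs_ballP[d d0 dP] := cu x.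
  by exists d => // y xy; apply: dP; rewrite -ball_normE.
have cF : continuous F by exact: (smooth_continuous (smooth_pderiv i (smooth_pderiv j sf))).
have cG : continuous G by exact: (smooth_continuous (smooth_pderiv j (smooth_pderiv i sf))).
apply/eqP; rewrite -subr_eq0 -normr_eq0 eq_le normr_ge0 andbT.
apply/ler_addgt0Pl => e e0; rewrite addr0.
have e2 : 0 < e / 2 by rewrite divr_gt0.
have [d d0 Fd] := near_pt F _ cF e2; have [d' d'0 Gd] := near_pt G _ cG e2.
pose h := Num.min d d' / 3.
have m0 : 0 < Num.min d d' by rewrite lt_min d0.
have h0 : 0 < h by rewrite divr_gt0.
have close (a b : R) l m : `|a| <= `|h| -> `|b| <= `|h| ->
    `|x - (x + a *: basis l + b *: basis m)| < Num.min d d'.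
  move=> ah bh; rewrite -addrA opprD addrA subrr add0r normrN.
  rewrite (le_lt_trans (ler_normD _ _))// !normrZ.
  have := ler_pM (normr_ge0 _) (normr_ge0 _) ah (norm_basis l).
  have := ler_pM (normr_ge0 _) (normr_ge0 _) bh (norm_basis m).
  by rewrite !mulr1 (gtr0_norm h0) /h; lra.
have [a [b [ah bh E1]]] := second_difference i j x h sf.
have [a' [b' [ah' bh' E2]]] := second_difference j i x h sf.
have E : G (x + a *: basis i + b *: basis j) = F (x + a' *: basis j + b' *: basis i).
  have h1 := mulfI (lt0r_neq0 h0); apply/h1/h1.
  rewrite -[LHS]E1 -[RHS]E2 [x + _ + h *: basis i]addrAC.
  ring.
have := close a b i j ah bh; rewrite lt_min => /andP[_ /Gd].
have := close a' b' j i ah' bh'; rewrite lt_min => /andP[/Fd + _].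
rewrite E; set z := F (_ + _ + _) => Fz Gz.
move: (F x) (G x) {E1 E2 E}z Fz Gz => u v z uz vz.
rewrite (le_trans (ler_distD z _ _))// [e]splitr lerD ?ltW//.
by rewrite distrC.
Qed.

End Coordinates.

(** * Estimates on test functions *)

Section TestEstimates.
Context {R : realType}.
Variable k : nat.
Implicit Types (f : 'rV[R]_k -> R) (x y : 'rV[R]_k) (i : 'I_k) (s : seq 'I_k).
Implicit Types (phi psi : test R k).
Local Notation C := (R[i]^o).
Local Notation basis i := (delta_mx 0 i : 'rV[R]_k).

(** Increments are measured coordinate by coordinate, which is how the mean
   value theorem produces them. *)
Definition l1norm y : R := \sum_i `|y 0 i|.

Lemma l1norm_ge0 y : 0 <= l1norm y.
Proof. exact: sumr_ge0. Qed.

Lemma l1normZ (c : R) y : l1norm (c *: y) = `|c| * l1norm y.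
Proof. by rewrite mulr_sumr; apply: eq_bigr => i _; rewrite mxE normrM. Qed.

Lemma l1norm_coord y i : `|y 0 i| <= l1norm y.
Proof. by rewrite /l1norm (bigD1 i)//= lerDl sumr_ge0. Qed.

Lemma lipschitz_pderiv f (B : R) x y : smooth f ->
  (forall i z, `|pderiv i f z| <= B) -> `|f (x + y) - f x| <= B * l1norm y.
Proof.
move=> sf fB; rewrite {1}(row_sum_delta y) /l1norm mulr_sumr.
elim: (index_enum _) x => [|i r IH] x.
  by rewrite !big_nil addr0 subrr normr0.
rewrite !big_cons addrA [leRHS]addrC.
apply: (le_trans (ler_distD (f (x + y 0 i *: basis i)) _ _)).
apply: lerD; first exact: IH.
have [c _ ->] := mvt_line x (y 0 i) (fun z => @smooth_derivable _ _ _ sf i z).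
by rewrite normrM mulrC ler_wpM2r//; exact: fB.
Qed.

(** A difference quotient is the derivative at an intermediate point, whose
   distance to the derivative at x costs one more derivative. *)
Lemma pderiv_quotient f i (B : R) x (h : R) : smooth f ->
  (forall z, `|pderiv i (pderiv i f) z| <= B) ->
  `|f (x + h *: basis i) - f x - h * pderiv i f x| <= B * h ^+ 2.
Proof.
move=> sf fB.
have [c ch ->] := mvt_line x h (fun z => @smooth_derivable _ _ _ sf i z).
have [c' _] := mvt_line x c
  (fun z => @smooth_derivable _ _ _ (smooth_pderiv i sf) i z).
rewrite -mulrBr => ->; rewrite !normrM.
apply: (le_trans (ler_wpM2l (normr_ge0 h)
  (ler_pM (normr_ge0 c) (normr_ge0 _) ch (fB _)))).
by rewrite mulrA -expr2 real_normK ?num_real// mulrC.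
Qed.

Lemma pderivs_pderiv s i f : smooth f ->
  pderivs s (pderiv i f) = pderiv i (pderivs s f).
Proof.
move=> sf; elim: s => //= j s ->; rewrite pderivC// => t.
by have := sf (t ++ s); rewrite /pderivs foldr_cat.
Qed.

Lemma smooth_pderivs s f : smooth f -> smooth (pderivs s f).
Proof. by move=> sf t; have := sf (t ++ s); rewrite /pderivs foldr_cat. Qed.

Lemma cpderivs_deriv s i phi : cpderivs s (test_deriv i phi) = cpderivs (rcons s i) phi.
Proof. by rewrite /cpderivs !pderivs_rcons. Qed.

(** Differentiating first or last gives the same result, by symmetry of mixed
   derivatives. *)
Lemma cpderivs_derivC s i phi :
  cpderivs s (test_deriv i phi) = cpderivs (i :: s) phi.
Proof.
have [rf jf] := csmooth_test phi; apply/funext => x; rewrite /cpderivs.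
have -> : pderivs s (@complex.Re R \o test_deriv i phi) =
   pderivs (i :: s) (@complex.Re R \o phi) by exact: pderivs_pderiv.
by have -> : pderivs s (@complex.Im R \o test_deriv i phi) =
   pderivs (i :: s) (@complex.Im R \o phi) by exact: pderivs_pderiv.
Qed.

Lemma cpderivs0 phi : cpderivs [::] phi = phi.
Proof. by apply/funext => x; rewrite /cpderivs /=; case: (phi x). Qed.

Lemma test_derivC i j phi :
  test_deriv i (test_deriv j phi) = test_deriv j (test_deriv i phi).
Proof.
have E : cpderivs [::] (test_deriv i (test_deriv j phi)) =
         cpderivs [::] (test_deriv j (test_deriv i phi)).
  by rewrite [LHS]cpderivs_derivC [LHS]cpderivs_deriv [RHS]cpderivs_deriv
    [RHS]cpderivs_derivC.
have E' := etrans (esym (cpderivs0 _)) (etrans E (cpderivs0 _)).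
by apply: test_ext => x; rewrite E'.
Qed.

Lemma test_bounded s phi :
  exists2 B : R, 0 < B & forall x, cabs (cpderivs s phi x) <= B.
Proof.
by have [B B0 sB] := cpderivs_bounded s phi; exists B => // x; rewrite -lecR -normr_cabs.
Qed.

Lemma test_lipschitz s phi : exists2 B : R, 0 <= B &
  forall x y, cabs (cpderivs s phi (x + y) - cpderivs s phi x) <= B * l1norm y.
Proof.
have /choice[B sB] : forall i, exists B : R, 0 < B /\
    forall x, cabs (cpderivs (i :: s) phi x) <= B.
  by move=> i; have [B B0 H] := test_bounded (i :: s) phi; exists B.
have B0 : 0 <= \sum_i B i by apply: sumr_ge0 => i _; exact: ltW (sB i).1.
have le i : B i <= \sum_i B i.
  by rewrite (bigD1 i)//= lerDl sumr_ge0// => j _; exact: ltW (sB j).1.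
have [rf jf] := csmooth_test phi.
exists (\sum_i B i + \sum_i B i) => [|x y]; first exact: addr_ge0.
apply: (le_trans (cabs_le_ReIm _)); rewrite ReB ImB mulrDl lerD//.
  apply: (@lipschitz_pderiv (pderivs s (@complex.Re R \o phi))) => [|i z].
    exact: smooth_pderivs.
  apply: le_trans (le i); apply: le_trans ((sB i).2 z).
  exact: (Re_le_cabs (cpderivs (i :: s) phi z)).
apply: (@lipschitz_pderiv (pderivs s (@complex.Im R \o phi))) => [|i z].
  exact: smooth_pderivs.
apply: le_trans (le i); apply: le_trans ((sB i).2 z).
exact: (Im_le_cabs (cpderivs (i :: s) phi z)).
Qed.

(** The bound is uniform in x and holds after any number of derivatives, so
   difference quotients converge in the space of test functions. *)
Lemma test_quotient s i phi : exists2 B : R, 0 <= B &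
  forall x (h : R), cabs (cpderivs s phi (x + h *: basis i) - cpderivs s phi x
    - h%:C * cpderivs s (test_deriv i phi) x) <= B * h ^+ 2.
Proof.
have [B B0 sB] := test_bounded [:: i, i & s] phi.
have [rf jf] := csmooth_test phi.
exists (B + B) => [|x h]; first by rewrite addr_ge0// ltW.
apply: (le_trans (cabs_le_ReIm _)); rewrite !ReB !ImB mulrDl cpderivs_derivC /=.
rewrite !mul0r subr0 addr0 lerD//.
  apply: (@pderiv_quotient (pderivs s (@complex.Re R \o phi))) => [|z].
    exact: smooth_pderivs.
  by apply: le_trans (sB z); exact: (Re_le_cabs (cpderivs [:: i, i & s] phi z)).
apply: (@pderiv_quotient (pderivs s (@complex.Im R \o phi))) => [|z].
  exact: smooth_pderivs.
by apply: le_trans (sB z); exact: (Im_le_cabs (cpderivs [:: i, i & s] phi z)).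
Qed.

Definition in_cube (B : R) (f : 'rV[R]_k -> C) :=
  forall x, f x != 0 -> forall i, `|x 0 i| <= B.

Lemma compact_cube (B : R) : compact [set x : 'rV[R]_k | forall i, `|x 0 i| <= B].
Proof.
apply: bounded_closed_compact.
  exists (Num.max 0 B); split=> [|M]; first exact: num_real.
  rewrite gt_max => /andP[M0 BM] x xB; rewrite /= [`|x|]mx_normrE.
  apply/bigmax_leP; split=> [|[a b] _]; first exact: ltW.
  by rewrite (ord1 a) (le_trans (xB b))// ltW.
rewrite (_ : [set _ | _] = \bigcap_(i : 'I_k) ((fun x : 'rV[R]_k => x 0 i) @^-1` `[- B, B]%classic)).
  apply: closed_bigI => i _; apply: closed_comp; last exact: itv_closed.
  by move=> x _; exact: coord_continuous.
apply/seteqP; split=> x H i.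
  by move=> _; suff: x 0 i \in `[- B, B] by []; rewrite in_itv /= -ler_norml; exact: H.
have : x 0 i \in `[- B, B] by exact: (H i Logic.I).
by rewrite in_itv /= -ler_norml.
Qed.

Lemma test_in_cube phi : exists2 B : R, 0 <= B & in_cube B phi.
Proof.
have [B [_ KB]] := compact_bounded (@compact_supp_test _ _ phi).
exists (Num.max 0 (B + 1)); first by rewrite le_max lexx.
move=> x fx i; have /KB : B < Num.max 0 (B + 1) by rewrite lt_max ltrDl ltr01 orbT.
move=> /(_ x (supp_sub fx)); apply: le_trans.
rewrite [leRHS]mx_normrE.
by apply: (@le_bigmax _ _ _ _ (fun ij => `|x ij.1 ij.2|) (0, i)).
Qed.

Lemma supp_in_cube B (f : 'rV[R]_k -> C) : in_cube B f ->
  supp f `<=` [set x | forall i, `|x 0 i| <= B].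
Proof. by move=> fB; apply: supp_subset; [exact: compact_cube|exact: fB]. Qed.

Lemma in_cube_shift B D phi y : (forall i, `|y 0 i| <= D) -> in_cube B phi ->
  in_cube (B + D) (test_shift y phi).
Proof.
move=> yD pB x /pB xy i; rewrite -[x 0 i](addrK (y 0 i)).
by rewrite (le_trans (ler_normB _ _))// lerD//; have := xy i; rewrite mxE.
Qed.

Lemma test_cvgI (u : nat -> test R k) phi B : (forall j, in_cube B (u j)) ->
  (forall s (e : R), 0 < e -> \forall j \near \oo,
     forall x, cabs (cpderivs s (u j) x - cpderivs s phi x) < e) ->
  test_cvg u phi.
Proof.
move=> uB ue; split.
  by exists [set x | forall i, `|x 0 i| <= B] => [|j];
    [exact: compact_cube|exact: supp_in_cube].
move=> s e /(ue s); apply: filterS => j H x.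
by rewrite normr_cabs ltcR.
Qed.

Lemma test_cvg_cabs (u : nat -> test R k) phi : test_cvg u phi ->
  forall s (e : R), 0 < e -> \forall j \near \oo,
     forall x, cabs (cpderivs s (u j) x - cpderivs s phi x) < e.
Proof.
move=> [_ ue] s e /(ue s); apply: filterS => j H x.
by have := H x; rewrite normr_cabs ltcR.
Qed.

Lemma test_cvg_cube (u : nat -> test R k) phi : test_cvg u phi ->
  exists2 B : R, 0 <= B & forall j, in_cube B (u j).
Proof.
move=> [[K cK uK] _].
have [B [_ KB]] := compact_bounded cK.
exists (Num.max 0 (B + 1)); first by rewrite le_max lexx.
move=> j x fx i; have /KB : B < Num.max 0 (B + 1) by rewrite lt_max ltrDl ltr01 orbT.
move=> /(_ x (uK j _ (supp_sub fx))); apply: le_trans.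
rewrite [leRHS]mx_normrE.
by apply: (@le_bigmax _ _ _ _ (fun ij => `|x ij.1 ij.2|) (0, i)).
Qed.

Lemma cpderivs_testD s phi psi :
  cpderivs s (phi + psi) = cpderivs s phi + cpderivs s psi :> (_ -> C).
Proof.
have -> : (phi + psi : 'rV[R]_k -> C) = (1 *: (phi : _ -> C) + psi :> (_ -> C)).
  by apply/funext => x; rewrite scale1r.
by rewrite cpderivsZD ?scale1r//; exact: csmooth_test.
Qed.

Lemma cpderivs_testZ s (a : R[i]) phi :
  cpderivs s (a *: phi) = a *: cpderivs s phi :> (_ -> C).
Proof.
have -> : (a *: phi : 'rV[R]_k -> C) =
    (a *: (phi : _ -> C) + (0 : test R k) :> (_ -> C)).
  by apply/funext => x; rewrite addr0.
rewrite cpderivsZD; [|exact: csmooth_test..].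
have -> : cpderivs s (0 : test R k) = 0.
  apply: (addrI (cpderivs s (0 : test R k) : 'rV[R]_k -> C)).
  by rewrite -(cpderivs_testD s 0 0) !addr0.
by rewrite addr0.
Qed.

End TestEstimates.

(** * Distributions under translation *)

Section DistributionBasics.
Context {R : realType}.
Variable k : nat.
Implicit Types (phi psi : test R k) (w u : @distribution R k) (i : 'I_k).
Local Notation C := (R[i]^o).
Local Notation basis i := (delta_mx 0 i : 'rV[R]_k).

Lemma distrD w phi psi : w (phi + psi) = w phi + w psi.
Proof. by have := distribution_linear w 1 phi psi; rewrite !scale1r. Qed.

Lemma distr0 w : w 0 = 0.
Proof. by apply: (addrI (w 0)); rewrite -distrD !addr0. Qed.

Lemma distrZ w (a : R[i]) phi : w (a *: phi) = a * w phi.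
Proof. by have := distribution_linear w a phi 0; rewrite !addr0 distr0 addr0. Qed.

Lemma distrN w phi : w (- phi) = - w phi.
Proof. by rewrite -scaleN1r distrZ mulN1r. Qed.

Lemma distrB w phi psi : w (phi - psi) = w phi - w psi.
Proof. by rewrite distrD distrN. Qed.

Lemma distr_sum w I (r : seq I) (P : pred I) (F : I -> test R k) :
  w (\sum_(i <- r | P i) F i) = \sum_(i <- r | P i) w (F i).
Proof.
elim/big_rec2 : _ => [|i y z _ <-]; first exact: distr0.
exact: distrD.
Qed.

Lemma distribution_ext u w : (forall phi, u phi = w phi) -> u = w.
Proof. by move=> uw; apply: val_inj; apply/funext. Qed.

Lemma distr_cvg_cabs w (v : nat -> test R k) phi : test_cvg v phi ->
  forall e : R, 0 < e -> \forall j \near \oo, cabs (w (v j) - w phi) < e.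
Proof. by move=> vphi; apply/cvgC_cabsP; exact: distribution_cvg. Qed.

Lemma cpderivs_testN s phi : cpderivs s (- phi) = - cpderivs s phi :> (_ -> C).
Proof. by rewrite -scaleN1r cpderivs_testZ scaleN1r. Qed.

Lemma cpderivs_testB s phi psi x :
  cpderivs s (phi - psi) x = cpderivs s phi x - cpderivs s psi x.
Proof. by rewrite cpderivs_testD cpderivs_testN. Qed.

Lemma cpderivs_test_shift s y phi x :
  cpderivs s (test_shift y phi) x = cpderivs s phi (x + y).
Proof. exact: (congr1 (@^~ x) (cpderivs_shift s y phi)). Qed.

Lemma test_shiftE y phi x : test_shift y phi x = phi (x + y).
Proof. by []. Qed.

Lemma test_shiftD y z phi : test_shift y (test_shift z phi) = test_shift (y + z) phi.
Proof. by apply: test_ext => x; rewrite !test_shiftE addrA. Qed.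

Lemma test_shift0 phi : test_shift 0 phi = phi.
Proof. by apply: test_ext => x; rewrite test_shiftE addr0. Qed.

Lemma test_shiftB y phi psi : test_shift y (phi - psi) = test_shift y phi - test_shift y psi.
Proof. exact: test_ext. Qed.

Lemma test_shiftZ y a phi : test_shift y (a *: phi) = a *: test_shift y phi.
Proof. exact: test_ext. Qed.

Lemma test_deriv_shift i y phi :
  test_deriv i (test_shift y phi) = test_shift y (test_deriv i phi).
Proof. apply: test_ext => x; exact: (cpderivs_test_shift [:: i] y phi x). Qed.

Lemma in_cube_lin B D (a : R[i]) phi psi : in_cube B phi -> in_cube D psi ->
  in_cube (Num.max B D) (a *: (phi - psi)).
Proof.
move=> pB pD x; have [px|px _ i] := eqVneq (phi x) 0; last first.
  by rewrite le_max pB.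
have [qx|qx _ i] := eqVneq (psi x) 0; last by rewrite le_max pD// orbT.
have -> : (a *: (phi - psi)) x = a * (phi x - psi x) by [].
by rewrite px qx subrr mulr0 eqxx.
Qed.

Lemma seq_null_bounded (h : nat -> R) :
  (forall e : R, 0 < e -> \forall j \near \oo, `|h j| < e) ->
  exists D : R, forall j, `|h j| <= D.
Proof.
move=> /(_ 1 ltr01)[N _ hN]; exists (1 + \sum_(j < N) `|h j|) => j.
have [jN|Nj] := ltnP j N.
  by rewrite (bigD1 (Ordinal jN))//= addrCA lerDl addr_ge0// sumr_ge0.
by rewrite (le_trans (ltW (hN j Nj)))// lerDl sumr_ge0.
Qed.

Lemma shift_cvg (h : nat -> 'rV[R]_k) phi :
  (forall e : R, 0 < e -> \forall j \near \oo, l1norm (h j) < e) ->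
  test_cvg (fun j => test_shift (h j) phi) phi.
Proof.
move=> h0; have [B B0 pB] := test_in_cube phi.
have h0' (e : R) : 0 < e -> \forall j \near \oo, `|l1norm (h j)| < e.
  by move=> /h0; apply: filterS => j; rewrite ger0_norm ?l1norm_ge0.
have [D hD] := seq_null_bounded h0'.
apply: (@test_cvgI _ _ _ _ (B + D)) => [j|s e e0].
  apply: in_cube_shift => // i; apply: le_trans (l1norm_coord _ _) _.
  exact: le_trans (ler_norm _) (hD j).
have [L L0 lip] := test_lipschitz s phi.
have L1 : 0 < L + 1 by rewrite ltr_wpDl.
have /h0 : 0 < e / (L + 1) by rewrite divr_gt0.
apply: filterS => j hj x; rewrite cpderivs_test_shift (le_lt_trans (lip _ _))//.
rewrite ltr_pdivlMr// in hj; rewrite (le_lt_trans _ hj)// mulrC.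
by rewrite ler_wpM2l ?l1norm_ge0// lerDl.
Qed.

(** Hence the value of a distribution on translates of phi is differentiable in
   the translation, and the derivative falls on phi. *)
Lemma quotient_cvg (h : nat -> R) i phi : (forall j, h j != 0) ->
  (forall e : R, 0 < e -> \forall j \near \oo, `|h j| < e) ->
  test_cvg (fun j => (h j)^-1%:C *: (test_shift (h j *: basis i) phi - phi))
    (test_deriv i phi).
Proof.
move=> hn0 h0; have [B B0 pB] := test_in_cube phi.
have [D hD] := seq_null_bounded h0.
apply: (@test_cvgI _ _ _ _ (Num.max (B + D) B)) => [j|s e e0].
  apply: in_cube_lin => //; apply: in_cube_shift => // l.
  rewrite !mxE normrM; apply: le_trans (hD j).
  by rewrite ler_piMr//; case: (_ && _); rewrite ?normr1 ?normr0.
have [L L0 quo] := test_quotient s i phi.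
have L1 : 0 < L + 1 by rewrite ltr_wpDl.
have /h0 : 0 < e / (L + 1) by rewrite divr_gt0.
apply: filterS => j hj x; rewrite cpderivs_testZ.
rewrite -[X in cabs X]/((h j)^-1%:C * cpderivs s (test_shift _ phi - phi) x - _).
rewrite cpderivs_testB cpderivs_test_shift.
have hc : (h j)%:C != 0 :> R[i] by rewrite -(rmorph0 (real_complex R)) (inj_eq (@complexI _)).
have hi : 0 < `|h j| by rewrite normr_gt0.
have -> A D' : (h j)^-1%:C * A - D' = (h j)^-1%:C * (A - (h j)%:C * D').
  by rewrite mulrBr mulrA -rmorphM mulVf// mul1r.
rewrite cabsM cabsr normfV mulrC ltr_pdivrMr//.
apply: (le_lt_trans (quo x (h j))); rewrite -real_normK ?num_real// expr2 mulrA.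
rewrite ltr_pM2r//; rewrite ltr_pdivlMr// in hj; apply: (le_lt_trans _ hj).
by rewrite mulrC ler_wpM2l// lerDl.
Qed.

Lemma supp_closed (A : set 'rV[R]_k) (f : 'rV[R]_k -> C) : closed A ->
  (forall x, f x != 0 -> A x) -> supp f `<=` A.
Proof. by move=> cA fA; move/closure_id: cA => ->; apply: closureS. Qed.

Lemma closed_coord_le i (b : R) : closed [set z : 'rV[R]_k | z 0 i <= b].
Proof.
apply: (@closed_comp _ _ (fun z : 'rV[R]_k => z 0 i) [set r | r <= b]).
  by move=> x _; exact: coord_continuous.
exact: closed_le.
Qed.

Lemma dderiv_shift_quotient w i phi (h : nat -> R) : (forall j, h j != 0) ->
  (forall e : R, 0 < e -> \forall j \near \oo, `|h j| < e) ->
  forall e : R, 0 < e -> \forall j \near \oo,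
    cabs ((h j)^-1%:C * (w (test_shift (h j *: basis i) phi) - w phi)
          - w (test_deriv i phi)) < e.
Proof.
move=> hn0 h0 e e0; have := distr_cvg_cabs w (quotient_cvg i phi hn0 h0) e0.
by apply: filterS => j; rewrite distrZ distrB.
Qed.

Lemma is_derive_component (f : C -> R) w i phi (t : R) :
  (forall x y, f (x - y) = f x - f y) -> (forall (a : R) x, f (a%:C * x) = a * f x) ->
  (forall x, `|f x| <= cabs x) ->
  is_derive t 1 (fun t : R => f (w (test_shift (t *: basis i) phi)))
    (f (w (test_shift (t *: basis i) (test_deriv i phi)))).
Proof.
move=> fB fZ fle.
set g := fun t : R => _; set l := f _.
suff gl : h^-1 *: ((g \o shift t) (h *: (1 : R)) - g t) @[h --> 0^'] --> l.
  split; first by apply/cvg_ex; exists l.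
  exact/cvg_lim.
apply/cvgr_dnbhsP => h [hn0 /cvgrPdist_lt h0].
have h0' (e : R) : 0 < e -> \forall j \near \oo, `|h j| < e.
  by move=> /h0; apply: filterS => j; rewrite sub0r normrN.
apply/cvgrPdist_lt => e e0.
have := dderiv_shift_quotient w i (test_shift (t *: basis i) phi) hn0 h0' e0.
apply: filterS => j; apply: le_lt_trans.
rewrite /l /g /= [h j *: 1]mulr1 distrC /GRing.scale /=.
rewrite -fB -fZ test_deriv_shift test_shiftD -scalerDl -fB; exact: fle.
Qed.

(** The function g(t) = u(phi(. + t e_i)) satisfies g' = - lambda g, so that
   exp(2 t Re lambda) |g(t)|^2 is constant. For large t the translate of phi is
   supported in the half-space where u vanishes, hence g(0) = u(phi) is 0. *)
Lemma first_order_unique (lambda : C) u i : dderiv i u = lambda *: u ->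
  vanishes_on [set z | z 0 i < 0] u -> u = 0.
Proof.
move=> du u0; apply: distribution_ext => phi.
pose g (t : R) := u (test_shift (t *: basis i) phi).
pose x t := complex.Re (g t); pose y t := complex.Im (g t).
have dg t : u (test_shift (t *: basis i) (test_deriv i phi)) = - (lambda * g t).
  rewrite -test_deriv_shift; have := congr1 (fun v : distribution k => v (test_shift (t *: basis i) phi)) du.
  by rewrite dderivE => E; rewrite -[LHS]opprK E.
pose a := complex.Re lambda; pose b := complex.Im lambda.
have dx (t : R) : is_derive t 1 x (- (a * x t - b * y t)).
  have := @is_derive_component (@complex.Re R) u i phi t (@ReB R) _ (@Re_le_cabs R).
  by rewrite dg /a /b /x /y; case: (lambda) (g t) => [? ?] [? ?]; apply => c [? ?] /=; rewrite mul0r subr0.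
have dy (t : R) : is_derive t 1 y (- (a * y t + b * x t)).
  have := @is_derive_component (@complex.Im R) u i phi t (@ImB R) _ (@Im_le_cabs R).
  by rewrite dg /a /b /x /y; case: (lambda) (g t) => [? ?] [? ?]; apply => c [? ?] /=; rewrite mul0r addr0.
pose E : R -> R := (expR \o ((2 * a) \*: id)) * (x * x + y * y).
have dE (t : R) : is_derive t 1 E 0.
  apply: is_derive_eq; rewrite /GRing.scale /=.
  rewrite -[(x * x + y * y) t]/(x t * x t + y t * y t); ring.
have [B B0 pB] := test_in_cube phi.
(* Translating by B + 1 moves the support of phi into z_i <= -1. *)
have gB : g (B + 1) = 0.
  apply: u0; apply: (@subset_trans _ [set z : 'rV[R]_k | z 0 i <= -1]); last first.
    by move=> z /= zi; rewrite (le_lt_trans zi)// oppr_lt0.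
  have cl := @closed_coord_le i (-1).
  apply: (supp_closed cl) => z /pB /(_ i); rewrite !mxE !eqxx mulr1 /= ler_norml => /andP[_].
  lra.
have E0 : E 0 = 0.
  rewrite (is_derive_0_is_cst 0 (B + 1) dE).
  rewrite -[E _]/(expR _ * (x _ * x _ + y _ * y _)).
  by rewrite /x /y gB /= mulr0 addr0 mulr0.
move: E0; rewrite -[E _]/(expR (2 * a * 0) * (x _ * x _ + y _ * y _)).
rewrite mulr0 expR0 mul1r /x /y -!expr2 -cabs_sqr => /eqP.
by rewrite sqrf_eq0 cabs_eq0 /g scale0r test_shift0 => /eqP.
Qed.

End DistributionBasics.

(** * Polynomials in a linear operator *)

Section PolynomialOperators.
Variables (K : fieldType) (V : lmodType K) (D : V -> V).
Hypothesis linD : linear D.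
Implicit Types (p q : {poly K}) (v w : V).

Definition poly_op p v := \sum_(i < size p) p`_i *: iter i D v.

Lemma poly_opE n p v : (size p <= n)%N ->
  poly_op p v = \sum_(i < n) p`_i *: iter i D v.
Proof.
move=> pn; rewrite /poly_op -(big_mkord predT (fun i => p`_i *: iter i D v)).
rewrite -(big_mkord predT (fun i => p`_i *: iter i D v)).
rewrite [RHS](@big_cat_nat _ _ _ (size p))//= [in RHS]addrC.
rewrite -[LHS]add0r; congr (_ + _).
rewrite big_nat_cond big1// => i /andP[/andP[pi _] _].
by rewrite nth_default// scale0r.
Qed.

Lemma poly_opD p q v : poly_op (p + q) v = poly_op p v + poly_op q v.
Proof.
rewrite (@poly_opE (maxn (size p) (size q)) (p + q))//; last exact: size_polyD.
rewrite (@poly_opE (maxn (size p) (size q)) p) ?leq_maxl//.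
rewrite (@poly_opE (maxn (size p) (size q)) q) ?leq_maxr// -big_split /=.
by apply: eq_bigr => i _; rewrite coefD scalerDl.
Qed.

Lemma poly_opC c v : poly_op c%:P v = c *: v.
Proof.
by rewrite (@poly_opE 1) ?size_polyC ?leq_b1// big_ord1 coefC.
Qed.

Lemma poly_op0 v : poly_op 0 v = 0.
Proof. by rewrite -polyC0 poly_opC scale0r. Qed.

Lemma poly_op_sum I (r : seq I) (P : pred I) (F : I -> {poly K}) v :
  poly_op (\sum_(i <- r | P i) F i) v = \sum_(i <- r | P i) poly_op (F i) v.
Proof.
elim/big_rec2 : _ => [|i x y _ <-]; first exact: poly_op0.
by rewrite poly_opD.
Qed.

Lemma poly_opMX p v : poly_op (p * 'X) v = poly_op p (D v).
Proof.
rewrite (@poly_opE (size p).+1).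
  rewrite big_ord_recl coefMX /= scale0r add0r; apply: eq_bigr => i _.
  by rewrite coefMX /= -iterSr.
by have [->|p0] := eqVneq p 0; rewrite ?mul0r ?size_poly0// size_mulX.
Qed.

Lemma iter_linear n : linear (iter n D).
Proof. by elim: n => // n IH a v w; rewrite /= IH linD. Qed.

Lemma lin_op0 : D 0 = 0.
Proof. by apply: (addrI (1 *: D 0)); rewrite -linD scaler0 !addr0 scale1r. Qed.

Lemma lin_opD v w : D (v + w) = D v + D w.
Proof. by have := linD 1 v w; rewrite !scale1r. Qed.

Lemma lin_opZ c v : D (c *: v) = c *: D v.
Proof. by have := linD c v 0; rewrite !addr0 lin_op0 addr0. Qed.

Lemma poly_opDv p v w : poly_op p (v + w) = poly_op p v + poly_op p w.
Proof.
rewrite /poly_op -big_split; apply: eq_bigr => i _ /=.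
by have := iter_linear i 1 v w; rewrite !scale1r => ->; rewrite scalerDr.
Qed.

Lemma poly_opv0 p : poly_op p 0 = 0.
Proof. by apply: (addrI (poly_op p 0)); rewrite -poly_opDv !addr0. Qed.

Lemma poly_opZv p c v : poly_op p (c *: v) = c *: poly_op p v.
Proof.
rewrite /poly_op scaler_sumr; apply: eq_bigr => i _ /=; rewrite !scalerA mulrC -scalerA.
congr (_ *: _); elim: (nat_of_ord i) => //= n ->; exact: lin_opZ.
Qed.

Lemma poly_op_comm p (E : V -> V) v : linear E -> (forall v, E (D v) = D (E v)) ->
  E (poly_op p v) = poly_op p (E v).
Proof.
move=> linE ED; have E0 : E 0 = 0.
  by apply: (addrI (1 *: E 0)); rewrite -linE scaler0 !addr0 scale1r.
rewrite /poly_op; elim/big_rec2 : _ => [//|i x y _ <-].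
rewrite linE; congr (_ *: _ + _).
by elim: (nat_of_ord i) => //= n <-.
Qed.

Lemma poly_opM p q v : poly_op (p * q) v = poly_op p (poly_op q v).
Proof.
elim/poly_ind: p v => [|p c IH] v; first by rewrite mul0r !poly_op0.
rewrite mulrDl !poly_opD -mulrA [ 'X * q]mulrC mulrA !poly_opMX IH.
rewrite -(poly_op_comm q v linD)//; congr (_ + _).
rewrite poly_opC mul_polyC; have [->|c0] := eqVneq c 0.
  by rewrite !scale0r poly_op0.
rewrite /poly_op size_scale// scaler_sumr; apply: eq_bigr => i _.
by rewrite coefZ scalerA.
Qed.

Lemma poly_opX v : poly_op 'X v = D v.
Proof. by rewrite -['X]mul1r poly_opMX -polyC1 poly_opC scale1r. Qed.

End PolynomialOperators.

(** * Matrices of polynomials in one variable *)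

Section PolynomialMatrices.

Lemma fraction_repr (T : idomainType) (x : {fraction T}) :
  exists2 b : T, b != 0 & exists a : T, FracField.tofrac b * x = FracField.tofrac a.
Proof.
elim/quotW: x => r; exists (frac r).2; first exact: denom_ratioP.
exists (frac r).1; unlock FracField.tofrac; rewrite -[LHS]FracField.pi_mul.
rewrite /FracField.mulf; apply/eqmodP.
by rewrite /= /FracField.equivf !numden_Ratio ?mulr1 ?mul1r ?oner_eq0 ?denom_ratioP.
Qed.

Lemma clear_denominators (T : idomainType) m n (B : 'M[{fraction T}]_(m, n)) :
  exists2 b : T, b != 0 & exists A : 'M[T]_(m, n),
    FracField.tofrac b *: B = map_mx (@FracField.tofrac T) A.
Proof.
have /choice[c cP] : forall ij : 'I_m * 'I_n, exists ba : T * T, ba.1 != 0 /\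
    FracField.tofrac ba.1 * B ij.1 ij.2 = FracField.tofrac ba.2.
  by move=> [i j]; have [b b0 [a ab]] := fraction_repr (B i j); exists (b, a).
exists (\prod_ij (c ij).1); first by apply/prodf_neq0 => ij _; exact: (cP ij).1.
exists (\matrix_(i, j) (\prod_(ij | ij != (i, j)) (c ij).1 * (c (i, j)).2)).
apply/matrixP => i j; rewrite !mxE (bigD1 (i, j))//= [_ * \prod_(_ | _) _]mulrC.
by rewrite !rmorphM /= -mulrA (cP (i, j)).2.
Qed.

Variable K : closedFieldType.
Implicit Types (t : K).

Definition eval_mx m n (Q : 'M[{poly K}]_(m, n)) t : 'M[K]_(m, n) :=
  map_mx (horner_eval t) Q.

Lemma eval_mxM m n p (A : 'M[{poly K}]_(m, n)) (B : 'M[{poly K}]_(n, p)) t :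
  eval_mx (A *m B) t = eval_mx A t *m eval_mx B t.
Proof. exact: map_mxM. Qed.

(** A constant left inverse N of Q at the point t makes N Q a square matrix whose
   determinant does not vanish at t; its adjugate provides the rest of U. *)
Lemma poly_left_inverse m n (Q : 'M[{poly K}]_(m, n)) t :
  \rank (eval_mx Q t) = n ->
  exists U : 'M[{poly K}]_(n, m), exists2 p, p != 0 & U *m Q = p%:M.
Proof.
move=> /eqP rQ; have /row_fullP[N NQ] : row_full (eval_mx Q t) by [].
pose N' : 'M[{poly K}]_(n, m) := map_mx polyC N.
exists (\adj (N' *m Q) *m N'), (\det (N' *m Q)); last first.
  by rewrite -mulmxA mul_adj_mx.
apply: contra_eqN NQ => /eqP d0; apply/eqP => NQ.
have N'E : eval_mx N' t = N.
  by apply/matrixP => i j; rewrite !mxE /horner_eval hornerC.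
have : (\det (N' *m Q)).[t] = 1.
  rewrite -[LHS]/(horner_eval t _) -det_map_mx -[map_mx _ _]/(eval_mx _ t).
  by rewrite eval_mxM N'E NQ det1.
by move/eqP; rewrite d0 horner0 eq_sym oner_eq0.
Qed.

(** Over the fraction field a matrix without left inverse has a kernel; clearing
   denominators makes the kernel vector polynomial, and turns a left inverse
   into full rank at every point off the zeros of one polynomial. *)
Lemma poly_kernel m n (Q : 'M[{poly K}]_(m, n)) :
  (forall t, \rank (eval_mx Q t) <> n) ->
  exists2 r : 'cV[{poly K}]_n, r != 0 & Q *m r = 0.
Proof.
move=> rQ; pose F := map_mx (@FracField.tofrac _) Q.
have tofrac_inj m' n' :
    injective (fun A : 'M[{poly K}]_(m', n') => map_mx (@FracField.tofrac {poly K}) A).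
  move=> A B /matrixP AB; apply/matrixP => i j; have := AB i j; rewrite !mxE => /eqP.
  by rewrite tofrac_eq => /eqP.
have [/row_fullP[B BF]|] := boolP (row_full F).
  have [b b0 [A bA]] := clear_denominators B.
  have AQ : A *m Q = b%:M.
    apply: tofrac_inj; rewrite map_mxM -bA -scalemxAl BF map_scalar_mx.
    by rewrite scalemx1.
  have [t bt] := closed_nonrootP b b0.
  case: (rQ t); apply/eqP; rewrite -[_ == _]/(row_full _); apply/row_fullP.
  exists (b.[t]^-1 *: eval_mx A t); rewrite -scalemxAl -eval_mxM AQ.
  by rewrite /eval_mx map_scalar_mx scale_scalar_mx mulVf.
rewrite /row_full -mxrank_tr => rF.
have /rowV0Pn[u /sub_kermxP uF u0] : kermx F^T != 0 by rewrite kermx_eq0.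
have [b b0 [v bv]] := clear_denominators u.
exists v^T.
  apply: contraNneq u0 => /(congr1 trmx); rewrite trmxK trmx0 => v0.
  move: bv; rewrite v0 map_mx0 => /eqP; rewrite scaler_eq0 tofrac_eq0 (negbTE b0).
  by [].
apply: tofrac_inj; rewrite map_mx0 map_mxM -map_trmx -bv -[map_mx _ Q]/F.
by rewrite -[F]trmxK -trmx_mul -scalemxAl uF scaler0 trmx0.
Qed.

End PolynomialMatrices.

(** * Constant-coefficient operators on distributions *)

Section ConstantCoefficients.
Context {R : realType}.
Variable k : nat.
Implicit Types (phi psi : test R k) (w u : @distribution R k) (i j : 'I_k).
Local Notation C := (R[i]^o).

Lemma dderiv_linear i : linear (@dderiv R k i).
Proof.
move=> a u w; apply: distribution_ext => phi.
rewrite -[RHS]/(a * dderiv i u phi + dderiv i w phi) !dderivE.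
by rewrite -[(a *: u + w) _]/(a * u _ + w _) opprD mulrN.
Qed.

Lemma dderivC i j w : dderiv i (dderiv j w) = dderiv j (dderiv i w).
Proof. by apply: distribution_ext => phi; rewrite !dderivE test_derivC. Qed.

Lemma vanishes_on_dderiv U i w : vanishes_on U w -> vanishes_on U (dderiv i w).
Proof.
move=> w0 phi phiU; rewrite dderivE w0 ?oppr0//.
apply: subset_trans phiU; apply: supp_closed; first exact: closed_closure.
by move=> x; exact: (@cpderivs_supp _ k [:: i] phi).
Qed.

Lemma vanishes_onZD U (a : C) u w :
  vanishes_on U u -> vanishes_on U w -> vanishes_on U (a *: u + w).
Proof.
move=> u0 w0 phi phiU; rewrite -[LHS]/(a * u phi + w phi).
by rewrite u0// w0// mulr0 addr0.
Qed.

Lemma vanishes_on_poly_op U i (p : {poly R[i]}) w : vanishes_on U w ->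
  vanishes_on U (poly_op (@dderiv R k i) p w).
Proof.
move=> w0; rewrite /poly_op; elim/big_rec : _ => [phi _ //|l x _ x0].
apply: vanishes_onZD => //; elim: (nat_of_ord l) => //= n.
exact: vanishes_on_dderiv.
Qed.

(** Over the complex numbers the operator splits into first-order factors. *)
Lemma poly_op_unique i (p : {poly R[i]}) w : p != 0 ->
  poly_op (@dderiv R k i) p w = 0 -> vanishes_on [set z | z 0 i < 0] w -> w = 0.
Proof.
have [r pr] := closed_field_poly_normal p; move=> p0.
rewrite pr -mul_polyC poly_opM; last exact: dderiv_linear.
rewrite poly_opC => /eqP; rewrite scaler_eq0 lead_coef_eq0 (negbTE p0) /= => /eqP.
elim: r {pr} w => [|c r IH] w.
  by rewrite big_nil -polyC1 poly_opC scale1r.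
rewrite big_cons mulrC poly_opM; last exact: dderiv_linear.
move=> + w0; move=> /IH; rewrite poly_opD -polyCN poly_opC poly_opX.
rewrite scaleNr => H; apply: (@first_order_unique _ _ c _ i) => //.
apply/eqP; rewrite -subr_eq0; apply/eqP/H.
rewrite addrC -scaleNr; apply: vanishes_onZD => //; exact: vanishes_on_dderiv.
Qed.

Variables (i0 : 'I_k) (c : 'I_k -> R[i]).

Definition symbol_point i : {poly R[i]} := if i == i0 then 'X else (c i)%:P.

Definition eigen_derivs w := forall i, i != i0 -> dderiv i w = c i *: w.

Lemma eigen_derivs_poly_op (p : {poly R[i]}) w :
  eigen_derivs w -> eigen_derivs (poly_op (@dderiv R k i0) p w).
Proof.
move=> ew i ii0; rewrite (poly_op_comm _ _ (@dderiv_linear i)) ?ew//.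
  by rewrite poly_opZv//; exact: dderiv_linear.
by move=> v; rewrite dderivC.
Qed.

(** The derivatives in the other directions act on w as scalars, also after
   differentiating along i0, so each monomial reduces to a scalar times a power
   of the derivative along i0. *)
Lemma poly_deriv_eigen (P : mpoly k R[i]) w : eigen_derivs w ->
  poly_deriv P w = poly_op (@dderiv R k i0) (mmap polyC symbol_point P) w.
Proof.
move=> ew; rewrite /poly_deriv /mmap poly_op_sum; apply: eq_bigr => mu _.
rewrite mul_polyC -mul_polyC poly_opM; last exact: dderiv_linear.
rewrite poly_opC; congr (_ *: _).
rewrite /monomial_deriv /mmap1 -big_enum /=.
elim: (enum 'I_k) => [|i s /= ->].
  by rewrite big_nil -polyC1 poly_opC scale1r.
rewrite big_cons poly_opM; last exact: dderiv_linear.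
set v := poly_op _ (\prod_(_ <- s) _) w.
have ev : eigen_derivs v by exact: eigen_derivs_poly_op.
elim: (mu i) => [|n IH]; first by rewrite expr0 -polyC1 poly_opC scale1r.
rewrite iterS IH exprS poly_opM; last exact: dderiv_linear.
set u := poly_op _ (_ ^+ n) v.
have eu : eigen_derivs u by exact: eigen_derivs_poly_op.
rewrite /symbol_point; have [->|ii0] := eqVneq i i0; first by rewrite poly_opX.
by rewrite poly_opC eu.
Qed.

End ConstantCoefficients.

(** * Products of smooth functions *)

Section SmoothFunctions.
Context {R : realType}.
Variable k : nat.
Implicit Types (f g : 'rV[R]_k -> R).

(** Coinduction: no derivative of f has to be computed, only a family closed
   under differentiation that contains it. *)
Lemma smooth_stable (S : set ('rV[R]_k -> R)) f :
  (forall g, S g -> (forall i x, derivable g x (delta_mx 0 i)) /\ continuous g) ->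
  (forall g i, S g -> S (pderiv i g)) -> S f -> smooth f.
Proof.
move=> Sreg Sd Sf s; apply: Sreg; elim: s => //= i s; exact: Sd.
Qed.

(** The smallest family containing the product and stable under derivatives, by
   the Leibniz rule. *)
Inductive product_sum : set ('rV[R]_k -> R) :=
| product_sum_mul f g : smooth f -> smooth g -> product_sum (f * g)
| product_sum_add f g : product_sum f -> product_sum g -> product_sum (f + g).

Lemma smoothM f g : smooth f -> smooth g -> smooth (f * g).
Proof.
have reg h : product_sum h ->
    (forall i x, derivable h x (delta_mx 0 i)) /\ continuous h.
  elim=> {h} [u v su sv|u v _ [du cu] _ [dv cv]].
    split=> [i x|x]; first by apply: derivableM; exact: smooth_derivable.
    exact: (cvgM (@smooth_continuous _ _ _ su x) (@smooth_continuous _ _ _ sv x)).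
  split=> [i x|x]; first exact: derivableD.
  exact: (cvgD (cu x) (cv x)).
move=> sf sg; apply: (smooth_stable reg); last exact: product_sum_mul.
move=> h i; elim=> {h} [u v su sv|u v pu IHu pv IHv].
  rewrite (_ : pderiv i (u * v) = u * pderiv i v + v * pderiv i u).
    by apply: product_sum_add; apply: product_sum_mul => //; exact: smooth_pderiv.
  by apply/funext => x; rewrite /pderiv deriveM//; exact: smooth_derivable.
rewrite (_ : pderiv i (u + v) = pderiv i u + pderiv i v).
  exact: product_sum_add.
apply/funext => x; rewrite /pderiv deriveD//; [exact: (reg _ pu).1|exact: (reg _ pv).1].
Qed.

End SmoothFunctions.

(** * Bump functions *)

Section Bump.
Context {R : realType}.
Implicit Types (q : {poly R}) (t e : R).

(** Derivatives of [flat 1], that is of exp(-1/t) continued by 0, are again of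
   this form. *)
Definition flat q t : R := if 0 < t then q.[t^-1] * expR (- t^-1) else 0.

Definition flat_deriv q := 'X^2 * (q - q^`()).

Lemma poly_bound q (u : R) : 1 <= u ->
  `|q.[u]| <= (\sum_(i < size q) `|q`_i|) * u ^+ size q.
Proof.
move=> u1; have u0 : 0 <= u by rewrite (le_trans ler01).
rewrite horner_coef (le_trans (ler_norm_sum _ _ _))// mulr_suml.
apply: ler_sum => i _; rewrite normrM ler_wpM2l// normrX ger0_norm//.
by rewrite ler_weXn2l// ltnW.
Qed.

(** The exponential of u = 1/t outgrows the power of u of degree two more than
   that of q, which leaves a factor t^2. *)
Lemma flat_small q : exists2 B : R, 0 <= B &
  forall t, `|t| <= 1 -> `|flat q t| <= B * t ^+ 2.
Proof.
set s := size q; set S := \sum_(i < s) `|q`_i|.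
have S0 : 0 <= S by exact: sumr_ge0.
exists (S * s.+2`!%:R) => [|t]; first by rewrite mulr_ge0.
rewrite /flat; case: ifPn => [t0 t1|_ _]; last first.
  by rewrite normr0 mulr_ge0 ?sqr_ge0// mulr_ge0.
rewrite gtr0_norm// in t1; set u := t^-1.
have u1 : 1 <= u by rewrite /u invf_ge1.
have u0 : 0 < u by rewrite (lt_le_trans ltr01).
rewrite normrM (ger0_norm (expR_ge0 _)) expRN.
have tu : t = u^-1 by rewrite invrK.
have qb : `|q.[u]| <= S * u ^+ s := poly_bound q u1.
have eb : u ^+ s.+2 / s.+2`!%:R <= expR u.
  by apply: le_trans (expR_ge1Dxn s.+1 (ltW u0)); rewrite lerDr.
rewrite ler_pdivrMr ?expR_gt0// (le_trans qb)//.
have -> (a : R) : S * a * t ^+ 2 * expR u = S * (t ^+ 2 * (a * expR u)) by ring.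
rewrite ler_wpM2l//.
have f0 : 0 < s.+2`!%:R :> R by rewrite ltr0n fact_gt0.
have u2 : u ^+ s.+2 = u ^+ s * u ^+ 2 by rewrite -exprD addn2.
have u20 : 0 < u ^+ 2 by rewrite exprn_gt0.
clearbody u; rewrite tu exprVn mulrC ler_pdivlMr// -u2.
by move: eb; rewrite ler_pdivrMr// mulrC.
Qed.

Lemma is_derive_quadratic (f : R -> R) (B : R) : f 0 = 0 ->
  (forall t, `|t| <= 1 -> `|f t| <= B * t ^+ 2) -> is_derive (0 : R) 1 f 0.
Proof.
move=> f0 fB.
have B0 : 0 <= B by have := fB 1; rewrite normr1 lexx expr1n mulr1 => /(_ isT); apply: le_trans.
suff gl : h^-1 *: ((f \o shift 0) (h *: (1 : R)) - f 0) @[h --> 0^'] --> (0 : R).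
  by split; [apply/cvg_ex; exists 0|exact/cvg_lim].
apply/cvgr_dnbhsP => h [hn0 /cvgrPdist_lt h0].
apply/cvgrPdist_lt => e e0.
have e1 : 0 < Num.min 1 (e / (B + 1)) by rewrite lt_min ltr01 divr_gt0// ltr_wpDl.
have := h0 _ e1; apply: filterS => j; rewrite lt_min => /andP[h1 h2].
rewrite sub0r normrN in h1 h2; rewrite sub0r normrN /= f0 subr0 addr0.
rewrite -[h j *: 1]/(h j * 1) mulr1 /GRing.scale /= normrM normfV mulrC.
rewrite ltr_pdivrMr ?normr_gt0// (le_lt_trans (fB _ (ltW h1)))//.
rewrite -real_normK ?num_real// expr2 mulrA ltr_pM2r ?normr_gt0//.
rewrite ltr_pdivlMr ?ltr_wpDl// in h2; apply: le_lt_trans h2.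
by rewrite mulrC ler_wpM2l// lerDl.
Qed.

Lemma flat_is_derive q t : is_derive t 1 (flat q) (flat (flat_deriv q) t).
Proof.
have [t0|t0|->] := ltgtP t 0.
- rewrite {2}/flat ltNge (ltW t0) /=.
  apply: (@near_eq_is_derive _ _ _ (cst 0)).
    apply: filterS (lt_nbhsl t0) => s s0.
  by rewrite /flat ifN// -leNgt ltW.
- apply: (@near_eq_is_derive _ _ _ ((horner q \o GRing.inv) * (expR \o (-%R \o GRing.inv)))).
    by apply: filterS (lt_nbhsr t0) => s s0; rewrite /flat s0.
  have tn0 : t != 0 by rewrite gt_eqF.
  have di : is_derive t 1 (@GRing.inv R) (- t ^- 2).
    apply: DeriveDef; first exact: derivableV.
    by rewrite deriveV// derive_id /GRing.scale /= mulr1.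
  apply: is_derive_eq.
  rewrite /flat t0 /flat_deriv /GRing.scale /= !hornerE.
  rewrite -[LHS]/(q.[t^-1] * expR (- t^-1) * (- - t ^- 2)
    + expR (- t^-1) * q^`().[t^-1] * (- t ^- 2)) exprVn; ring.
- rewrite {2}/flat ltxx; have [B B0 fB] := flat_small q.
  by apply: (@is_derive_quadratic _ B) => //; rewrite /flat ltxx.
Qed.

Lemma flat1_ge0 t : 0 <= flat 1 t.
Proof. by rewrite /flat; case: ifP => // _; rewrite hornerC mul1r expR_ge0. Qed.

Lemma flat1_mono e t : 0 < e -> e <= t -> flat 1 e <= flat 1 t.
Proof.
move=> e0 et; have t0 := lt_le_trans e0 et.
by rewrite /flat e0 t0 !hornerC !mul1r ler_expR lerN2 lef_pV2.
Qed.

Lemma flat1_gt0 t : 0 < t -> 0 < flat 1 t.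
Proof. by move=> t0; rewrite /flat t0 hornerC mul1r expR_gt0. Qed.

(** Stated for an affine argument because the bump multiplies two reflected
   copies of the same flat function. *)
Lemma smooth_flat q (s c : R) :
  smooth (fun x : 'rV[R]_1 => flat q (s * x 0 0 + c)).
Proof.
pose F q (x : 'rV[R]_1) := flat q (s * x 0 0 + c).
have dF p (x : 'rV[R]_1) i : derivable (F p) x (delta_mx 0 i) /\
    'D_(delta_mx 0 i) (F p) x = F (s *: flat_deriv p) x.
  have dline : is_derive (x 0 0) 1 (flat p \o (s \*: id + cst c))
      (F (s *: flat_deriv p) x).
    have dflat := flat_is_derive p ((s \*: id + cst c) (x 0 0)).
    apply: is_derive_eq; rewrite /F /flat -[(_ + _) _]/(s * x 0 0 + c).
    case: ifP => _; last by rewrite mul0r.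
    by rewrite hornerZ addr0 -[s *: 1]/(s * 1) mulr1 mulrC mulrA.
  have E : (fun h : R => h^-1 *: ((F p \o shift x) (h *: delta_mx 0 i) - F p x)) =
     (fun h : R => h^-1 *: (((flat p \o (s \*: id + cst c)) \o shift (x 0 0)) (h *: 1)
       - (flat p \o (s \*: id + cst c)) (x 0 0))).
    apply/funext => h /=; rewrite /F !mxE (ord1 i) !eqxx.
    by rewrite -[(_ + cst c) _]/(s * (h * 1 + x 0 0) + c).
  split; first by rewrite /derivable E; case: dline.
  by rewrite /derive E; case: dline.
apply: (@smooth_stable _ _ [set f | exists p, f = F p]); last by exists q.
  move=> _ [p ->]; split=> [i x|x]; first exact: (dF p x i).1.
  have cflat : continuous (flat p).
    by move=> t; apply/differentiable_continuous/derivable1_diffP; case: (flat_is_derive p t).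
  apply: (@continuous_comp _ _ _ (fun x : 'rV[R]_1 => s * x 0 0 + c) (flat p));
    last exact: cflat.
  apply: (@continuousD _ _ _ (fun x : 'rV[R]_1 => s * x 0 0) (cst c)).
    apply: (@continuousM _ _ (cst s) (fun x : 'rV[R]_1 => x 0 0)).
      exact: cst_continuous.
    exact: coord_continuous.
  exact: cst_continuous.
move=> _ i [p ->]; exists (s *: flat_deriv p).
by apply/funext => x; exact: (dF p x i).2.
Qed.

Lemma csmooth_real k (f : 'rV[R]_k -> R) : smooth f ->
  csmooth (fun x => (f x)%:C : R[i]^o).
Proof. by move=> sf; split; [exact: sf|exact: smooth0]. Qed.

(** [c] bounds the bump from below on the middle cube, which keeps its Riemann
   sums away from 0. *)
Definition is_bump k e (phi : test R k) := [/\ in_cube e phi,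
  forall x, complex.Im (phi x) = 0 /\ 0 <= complex.Re (phi x) &
  exists2 c : R, 0 < c &
    forall x : 'rV[R]_k, (forall i, `|x 0 i| <= e / 2) -> c <= complex.Re (phi x)].

Lemma bump1 e : 0 < e -> exists phi : test R 1, is_bump e phi.
Proof.
move=> e0; pose f : 'rV[R]_1 -> R :=
  (fun x => flat 1 (1 * x 0 0 + e)) * (fun x => flat 1 (-1 * x 0 0 + e)).
have sf : smooth f by apply: smoothM; exact: smooth_flat.
have fE x : f x = flat 1 (x 0 0 + e) * flat 1 (e - x 0 0).
  by rewrite /f -[LHS]/(flat 1 (1 * x 0 0 + e) * flat 1 (-1 * x 0 0 + e)) mul1r mulN1r addrC [- _ + _]addrC.
have fcube : in_cube e (fun x => (f x)%:C : R[i]^o).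
  move=> x fx i; rewrite (ord1 i) leNgt; apply: contra fx => ex.
  rewrite fE /flat; move: ex; rewrite ltr_normr.
  have [xe|xe] := ltP 0 (x 0 0 + e); last by rewrite mul0r eqxx.
  have [xe'|xe'] := ltP 0 (e - x 0 0); last by rewrite mulr0 eqxx.
  by move=> /orP[|]; lra.
have cs : compact (supp (fun x => (f x)%:C : R[i]^o)).
  by apply: (compact_supp (@compact_cube R 1 e)) => x; exact: fcube.
exists (mk_test (csmooth_real sf) cs); split => //.
  by move=> x; split => //=; rewrite fE mulr_ge0// flat1_ge0.
have e2 : 0 < e / 2 by rewrite divr_gt0.
exists (flat 1 (e / 2) * flat 1 (e / 2)); first by rewrite mulr_gt0// flat1_gt0.
move=> x /(_ 0); rewrite ler_norml => /andP[x1 x2] /=; rewrite fE.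
by apply: ler_pM; rewrite ?flat1_ge0//; apply: flat1_mono => //; lra.
Qed.

Lemma bump_exists k e : 0 < e -> exists phi : test R k, is_bump e phi.
Proof.
move=> e0; elim: k => [|k [psi [psiB psi0 [c c0 cpsi]]]].
  have cs : compact (supp (fun x : 'rV[R]_0 => ((cst 1 : 'rV[R]_0 -> R) x)%:C : R[i]^o)).
    by apply: (compact_supp (@compact_cube R 0 e)) => x _ [].
  have s1 : smooth (cst 1 : 'rV[R]_0 -> R).
    apply: (@smooth_stable _ _ [set cst 1]) => // g; last by move=> [].
    by move=> ->; split=> [[]//|]; exact: cst_continuous.
  exists (mk_test (csmooth_real s1) cs); split => //; first by move=> x _ [].
  by exists 1.
have [phi [phiB phi0 [b b0 bphi]]] := bump1 e0.
pose chi : test R (1 + k) := test_tensor phi psi.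
have chiE x : chi x = phi (lsubmx x) * psi (rsubmx x) by [].
have coord (x : 'rV[R]_(1 + k)) (P : R -> Prop) :
    (forall i, P (lsubmx x 0 i)) -> (forall i, P (rsubmx x 0 i)) -> forall i, P (x 0 i).
  move=> Pl Pr i; case: (fintype.splitP i) => j ij.
    by have := Pl j; rewrite mxE; congr P; congr (x _ _); exact: val_inj.
  by have := Pr j; rewrite mxE; congr P; congr (x _ _); exact: val_inj.
have ReE x : complex.Re (chi x) = complex.Re (phi (lsubmx x)) * complex.Re (psi (rsubmx x)).
  rewrite chiE; have [p0 _] := phi0 (lsubmx x); have [q0 _] := psi0 (rsubmx x).
  by case: (phi _) (psi _) p0 q0 => [a b'] [a' b''] /= -> ->; rewrite mulr0 subr0.
suff H : exists phi : test R (1 + k), is_bump e phi by exact: H.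
exists chi; split.
- move=> x chix; apply: (coord x (fun r => `|r| <= e)).
    by apply: phiB; apply: contraNneq chix => H; rewrite chiE H mul0r.
  by apply: psiB; apply: contraNneq chix => H; rewrite chiE H mulr0.
- move=> x; split; last by rewrite ReE mulr_ge0//; [have [] := phi0 (lsubmx x)|have [] := psi0 (rsubmx x)].
  rewrite chiE; have [p0 _] := phi0 (lsubmx x); have [q0 _] := psi0 (rsubmx x).
  by case: (phi _) (psi _) p0 q0 => [a b'] [a' b''] /= -> ->; rewrite mulr0 mul0r addr0.
- exists (b * c); first exact: mulr_gt0.
  move=> x xe; rewrite ReE; apply: ler_pM; [exact: ltW|exact: ltW| |].
    by apply: bphi => i; rewrite mxE; exact: xe.
  by apply: cpsi => i; rewrite mxE; exact: xe.
Qed.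

End Bump.

(** * The characters of the circle *)

Section UnitExponential.
Context {R : realType}.
Implicit Types (s t h : R).
Local Notation C := (R[i]^o).

Definition unit_exp s : R[i] := cos (2 * pi * s) +i* sin (2 * pi * s).

Lemma unit_exp0 : unit_exp 0 = 1.
Proof. by rewrite /unit_exp mulr0 cos0 sin0. Qed.

Lemma unit_expD s t : unit_exp (s + t) = unit_exp s * unit_exp t.
Proof. by rewrite /unit_exp mulrDr cosD sinD; apply: complex_ext => //=; rewrite addrC. Qed.

Lemma unit_expN s : unit_exp (- s) = (unit_exp s)^*%C.
Proof. by rewrite /unit_exp mulrN cosN sinN. Qed.

Lemma cabs_unit_exp s : cabs (unit_exp s) = 1.
Proof.
apply/eqP; rewrite -sqrp_eq1 ?cabs_ge0// cabs_sqr /= cos2Dsin2.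
by [].
Qed.

Lemma unit_expK s : unit_exp (- s) * unit_exp s = 1.
Proof. by rewrite -unit_expD addNr unit_exp0. Qed.

Lemma unit_exp_nat (n : nat) : unit_exp n%:R = 1.
Proof.
elim: n => [|n IH]; first exact: unit_exp0.
rewrite -addn1 natrD unit_expD IH mul1r /unit_exp mulr1 mulr_natl cos2pi sin2pi.
by [].
Qed.

Lemma unit_exp_int (z : int) : unit_exp z%:~R = 1.
Proof.
case: z => n; first exact: unit_exp_nat.
have := unit_expK n.+1%:R; rewrite unit_exp_nat mulr1 => <-.
by rewrite NegzE mulrNz.
Qed.

Lemma unit_expX s n : unit_exp (n%:R * s) = unit_exp s ^+ n.
Proof.
elim: n => [|n IH]; first by rewrite mul0r unit_exp0.
by rewrite -addn1 natrD mulrDl mul1r unit_expD IH exprD.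
Qed.

Lemma unit_exp_near1 (e : R) : 0 < e ->
  exists2 d : R, 0 < d & forall h, `|h| < d -> cabs (unit_exp h - 1) < e.
Proof.
move=> e0; have e2 : 0 < e / 2 by rewrite divr_gt0.
have cont (f : R -> R) : continuous f ->
    exists2 d : R, 0 < d & forall h, `|h| < d -> `|f (2 * pi * h) - f 0| < e / 2.
  move=> cf; have /cvgrPdist_lt/(_ _ e2)/nbhs_ballP[d d0 dP] := cf 0.
  have p0 : 0 < 2 * pi :> R by rewrite mulr_gt0 ?pi_gt0.
  exists (d / (2 * pi)) => [|h hd]; first by rewrite divr_gt0.
  rewrite distrC; apply: dP; rewrite -ball_normE /ball_ /= sub0r normrN normrM.
  by rewrite (gtr0_norm p0) mulrC -ltr_pdivlMr.
have [d d0 dc] := cont _ (@continuous_cos R).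
have [d' d'0 ds] := cont _ (@continuous_sin R).
exists (Num.min d d') => [|h]; first by rewrite lt_min d0.
rewrite lt_min => /andP[/dc hc /ds hs]; apply: (le_lt_trans (cabs_le_ReIm _)).
rewrite ReB ImB /= [e]splitr; rewrite cos0 in hc; rewrite sin0 in hs.
exact: ltrD.
Qed.

(** The derivative of the exponential at 0, along sequences, in the form in which
   distributions are differentiated. *)
Lemma unit_exp_quotient (c : R) (h : nat -> R) : (forall j, h j != 0) ->
  (forall e : R, 0 < e -> \forall j \near \oo, `|h j| < e) ->
  forall e : R, 0 < e -> \forall j \near \oo,
    cabs ((h j)^-1%:C * (unit_exp (c * h j) - 1) - (2 * pi)%:C * 'i%C * c%:C) < e.
Proof.
move=> hn0 h0 e e0; have e2 : 0 < e / 2 by rewrite divr_gt0.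
have quot (f : R -> R) (l : R) : is_derive (0 : R) 1 (f \o ((2 * pi * c) \*: id)) l ->
    \forall j \near \oo, `|(h j)^-1 * (f (2 * pi * (c * h j)) - f 0) - l| < e / 2.
  move=> [df dfl]; set F := f \o _ in df dfl.
  have : k^-1 *: ((F \o shift 0) (k *: (1 : R)) - F 0) @[k --> 0^'] --> l.
    by rewrite -dfl; exact: df.
  move=> /cvgr_dnbhsP/(_ h) Fl.
  have h0' : h @ \oo --> (0 : R).
    by apply/cvgrPdist_lt => a a0; have := h0 a a0; apply: filterS => j; rewrite sub0r normrN.
  move: Fl => /(_ (conj hn0 h0')) /cvgrPdist_lt/(_ _ e2); apply: filterS => j.
  rewrite distrC -[h j *: 1]/(h j * 1) mulr1 /= addr0 /F /= scaler0.
  by rewrite -[(2 * pi * c) *: h j]/(2 * pi * c * h j) -!mulrA.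
have dl : is_derive (0 : R) 1 ((2 * pi * c) \*: (id : R -> R)) (2 * pi * c).
  by have := is_deriveZ (2 * pi * c) (is_derive_id (0 : R) 1); rewrite -[_ *: 1]/(_ * 1) mulr1.
have dc : is_derive (0 : R) 1 (cos \o ((2 * pi * c) \*: id)) 0.
  have := is_derive1_comp (is_derive_cos (((2 * pi * c) \*: id) 0)) dl.
  by rewrite -[(_ \*: id) _]/(2 * pi * c * 0) mulr0 sin0 oppr0 mul0r.
have ds : is_derive (0 : R) 1 (sin \o ((2 * pi * c) \*: id)) (2 * pi * c).
  have := is_derive1_comp (is_derive_sin (((2 * pi * c) \*: id) 0)) dl.
  by rewrite -[(_ \*: id) _]/(2 * pi * c * 0) mulr0 cos0 mul1r.
apply: filterS2 (quot _ _ dc) (quot _ _ ds) => j.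
rewrite cos0 sin0 !subr0 => hc hs.
apply: (le_lt_trans (cabs_le_ReIm _)); rewrite [e]splitr ReB ImB /=.
apply: ltrD; first by move: hc; congr (`|_| < _); ring.
by move: hs; congr (`|_| < _); ring.
Qed.

End UnitExponential.

(** * Riemann sums on the line *)

Section RiemannSums.
Context {R : realType}.
Implicit Types (f g : R -> R[i]) (s t h : R) (Q K : nat).

Lemma count_interval n lo hi : (lo <= hi)%N ->
  (\sum_(0 <= j < n) (lo <= j < hi)%N = minn n hi - minn n lo)%N.
Proof.
move=> lohi; elim: n => [|n IH]; first by rewrite big_nil !min0n.
rewrite big_nat_recr//= IH; case: (leqP lo n) => a; case: (ltnP n hi) => b /=; lia.
Qed.

(** Shifting the summation range exchanges the terms leaving at one end with
   those entering at the other: both vanish for compact supports and cancel for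
   periodic functions. *)
Lemma sum_shift (V : zmodType) (H : nat -> V) n i :
  \sum_(0 <= j < n) H (j + i)%N + \sum_(0 <= j < i) H j =
  \sum_(0 <= j < n) H j + \sum_(0 <= j < i) H (n + j)%N.
Proof.
have -> : \sum_(0 <= j < n) H (j + i)%N = \sum_(i <= j < n + i) H j.
  by rewrite -[RHS]/(\sum_(0 + i <= j < n + i) H j) big_addn addnK.
have -> : \sum_(0 <= j < i) H (n + j)%N = \sum_(n <= j < n + i) H j.
  rewrite -[RHS]/(\sum_(0 + n <= j < n + i) H j) big_addn addKn; apply: eq_bigr => j _.
  by rewrite addnC.
rewrite addrC -!big_cat_nat//= ?leq_addr ?leq_addl//.
Qed.

Definition mesh Q : R := Q.+1%:R^-1.
Definition node Q (j : nat) : R := j%:R * mesh Q - Q.+1%:R.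
Definition nodes Q := (2 * Q.+1 ^ 2)%N.
(** The interval [-(Q+1), Q+1] grows while the step 1/(Q+1) shrinks, so a single
   parameter serves for the integral over the whole line. *)
Definition riemann Q f : R[i] := (mesh Q)%:C * \sum_(0 <= j < nodes Q) f (node Q j).

Lemma mesh_gt0 Q : 0 < mesh Q.
Proof. by rewrite invr_gt0 ltr0n. Qed.

Lemma meshE Q : mesh Q * Q.+1%:R = 1.
Proof. by rewrite mulVf// pnatr_eq0. Qed.

Lemma riemannD Q f g : riemann Q (fun s => f s + g s) = riemann Q f + riemann Q g.
Proof. by rewrite /riemann big_split mulrDr. Qed.

Lemma riemannZ Q (c : R[i]) f : riemann Q (fun s => c * f s) = c * riemann Q f.
Proof. by rewrite /riemann -mulr_sumr mulrCA. Qed.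

Lemma riemannB Q f g : riemann Q (fun s => f s - g s) = riemann Q f - riemann Q g.
Proof. by rewrite /riemann sumrB mulrBr. Qed.

Lemma node_le Q j s : (node Q j <= s) = (j%:R <= (s + Q.+1%:R) * Q.+1%:R).
Proof. by rewrite /node lerBlDr ler_pdivrMr// ltr0n. Qed.

Lemma node_ge Q j s : (s <= node Q j) = ((s + Q.+1%:R) * Q.+1%:R <= j%:R).
Proof. by rewrite /node lerBrDr ler_pdivlMr// ltr0n. Qed.

(** At most 2 K (Q+1) + 1 nodes meet the support. *)
Lemma cabs_riemann_le Q f K (B : R) : 0 <= B ->
  (forall s, f s != 0 -> `|s| <= K%:R) -> (forall s, cabs (f s) <= B) ->
  cabs (riemann Q f) <= (2 * K%:R + 1) * B.
Proof.
move=> B0 fK fB; rewrite /riemann cabsM cabsr gtr0_norm ?mesh_gt0//.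
rewrite mulrC /mesh ler_pdivrMr ?ltr0n//.
apply: (le_trans (cabs_sum _ _ _)).
set lo := (Q.+1 ^ 2 - K * Q.+1)%N; set hi := (Q.+1 ^ 2 + K * Q.+1).+1%N.
have H j : cabs (f (node Q j)) <= B * (lo <= j < hi)%N%:R.
  have [fj|fj] := eqVneq (f (node Q j)) 0; first by rewrite fj cabs0 mulr_ge0.
  suff -> : (lo <= j < hi)%N by rewrite mulr1.
  have := fK _ fj; rewrite ler_norml node_ge node_le => /andP[].
  move=> a b.
  have {}a : (Q.+1 * Q.+1)%:R <= (j + K * Q.+1)%:R :> R by rewrite natrD !natrM; lra.
  have {}b : j%:R <= (Q.+1 * Q.+1 + K * Q.+1)%:R :> R by rewrite natrD !natrM; lra.
  by rewrite !ler_nat in a b; rewrite /lo /hi -mulnn; lia.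
apply: (le_trans (ler_sum _ (fun j _ => H j))).
rewrite -mulr_sumr [leRHS]mulrC mulrA [_ * B]mulrC ler_wpM2l//.
rewrite -natr_sum count_interval; last by rewrite /lo /hi; lia.
have -> : Q.+1%:R * (2 * K%:R + 1) = (Q.+1 * (2 * K + 1))%:R :> R.
  by rewrite natrM natrD natrM.
by rewrite ler_nat /lo /hi; lia.
Qed.

Lemma node_shift Q j i : node Q (j + i) = node Q j + i%:R * mesh Q.
Proof. by rewrite /node natrD mulrDl addrAC. Qed.

Lemma riemann_mesh_shift Q f K i : (forall s, f s != 0 -> `|s| <= K%:R) ->
  (K < Q.+1)%N -> (K * Q.+1 + i <= Q.+1 ^ 2)%N ->
  riemann Q (fun s => f (s + i%:R * mesh Q)) = riemann Q f.
Proof.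
rewrite -mulnn => fK KQ KiQ; congr (_ * _).
have := sum_shift (fun j => f (node Q j)) (nodes Q) i.
rewrite [X in _ + X = _]big_nat_cond [X in _ + X = _]big1; last first.
  move=> j; rewrite andbT leq0n /= => ji; apply/eqP; apply: contraT => /fK.
  rewrite ler_norml => /andP[+ _]; rewrite node_ge => a.
  have {a} : (Q.+1 * Q.+1)%:R <= (j + K * Q.+1)%:R :> R by rewrite natrD !natrM; lra.
  by rewrite ler_nat; nia.
rewrite [X in _ = _ + X]big1; last first.
  move=> j _; apply/eqP; apply: contraT => /fK.
  rewrite ler_norml => /andP[_]; rewrite node_le => a.
  have {a} : (nodes Q + j)%:R <= (Q.+1 * Q.+1 + K * Q.+1)%:R :> R.
    by rewrite [leRHS]natrD !natrM; lra.
  by rewrite ler_nat /nodes -mulnn; nia.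
rewrite !addr0 => <-; apply: eq_bigr => j _; congr f; exact/esym/node_shift.
Qed.

End RiemannSums.

Section RiemannEstimates.
Context {R : realType}.
Implicit Types (f g : R -> R[i]) (s t h : R) (Q K D : nat).

Lemma mesh_floor Q t : 0 <= t ->
  exists i, i%:R * mesh Q <= t <= i%:R * mesh Q + mesh Q.
Proof.
move=> t0; have tQ : 0 <= t * Q.+1%:R by rewrite mulr_ge0.
exists (Num.truncn (t * Q.+1%:R)).
have /andP[a b] := truncn_itv tQ.
rewrite /mesh ler_pdivrMr ?ltr0n// a /= -[X in _ + X]mul1r -mulrDl.
by rewrite ler_pdivlMr ?ltr0n// natr1 ltW.
Qed.

(** Translation by a multiple of the mesh only reindexes the sum; the remaining
   translation is shorter than the mesh and is controlled by the modulus of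
   continuity. *)
Lemma riemann_shift_ge0 Q f K D (e : R) t : 0 <= e ->
  (forall s, f s != 0 -> `|s| <= K%:R) ->
  (forall s h, 0 <= h <= mesh Q -> cabs (f (s + h) - f s) <= e) ->
  0 <= t <= D%:R -> (K + D < Q.+1)%N ->
  cabs (riemann Q (fun s => f (s + t)) - riemann Q f) <= (2 * (K + D)%:R + 1) * e.
Proof.
move=> e0 fK fe /andP[t0 tD] KDQ.
have [i /andP[it ti]] := mesh_floor Q t0.
have iD : (i <= D * Q.+1)%N.
  rewrite -(ler_nat R) natrM -ler_pdivrMr ?ltr0n//; exact: le_trans it tD.
rewrite -(@riemann_mesh_shift _ Q f K i fK); [|lia|by rewrite -mulnn; nia].
have i0 : 0 <= i%:R * mesh Q :> R by rewrite mulr_ge0// ltW// mesh_gt0.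
have far s r : 0 <= r <= D%:R -> f (s + r) != 0 -> `|s| <= (K + D)%:R.
  by move=> /andP[r0 rD] /fK; rewrite natrD !ler_norml => /andP[a b]; apply/andP; split; lra.
rewrite -riemannB; apply: cabs_riemann_le => // [s ft|s].
  have [f1|/far] := eqVneq (f (s + t)) 0; last by apply; rewrite t0.
  rewrite f1 sub0r oppr_eq0 in ft; apply: far ft.
  by rewrite i0 (le_trans it).
have -> : s + t = s + i%:R * mesh Q + (t - i%:R * mesh Q) by ring.
by apply: fe; rewrite subr_ge0 it lerBlDl.
Qed.

Lemma riemann_shift Q f K D (e : R) t : 0 <= e ->
  (forall s, f s != 0 -> `|s| <= K%:R) ->
  (forall s h, 0 <= h <= mesh Q -> cabs (f (s + h) - f s) <= e) ->
  `|t| <= D%:R -> (K + 2 * D < Q.+1)%N ->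
  cabs (riemann Q (fun s => f (s + t)) - riemann Q f)
    <= (2 * (K + 2 * D)%:R + 1) * e.
Proof.
move=> e0 fK fe tD KDQ; have [t0|t0] := leP 0 t.
  rewrite ger0_norm// in tD.
  apply: (@le_trans _ _ ((2 * (K + D)%:R + 1) * e)).
    by apply: riemann_shift_ge0 => //; [rewrite t0|lia].
  by rewrite ler_wpM2r// lerD2r ler_wpM2l// ler_nat; lia.
rewrite ltr0_norm// in tD.
rewrite cabsC -{1}(_ : (fun s => f (s + - t + t)) = f); last first.
  by apply/funext => s; rewrite subrK.
have KD : (K + 2 * D = (K + D) + D)%N by lia.
rewrite KD; apply: (@riemann_shift_ge0 Q (fun s => f (s + t)) (K + D) D e) => //.
- move=> s /fK; rewrite natrD !ler_norml => /andP[a b]; apply/andP; split; lra.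
- by move=> s h he; rewrite addrAC; exact: fe.
- by rewrite tD andbT oppr_ge0 ltW.
- by lia.
Qed.

Lemma Re_sum I (r : seq I) (P : pred I) (F : I -> R[i]) :
  complex.Re (\sum_(i <- r | P i) F i) = \sum_(i <- r | P i) complex.Re (F i).
Proof. by elim/big_rec2 : _ => [//|i x y _ <-]; rewrite ReD. Qed.

Lemma Re_realM (a : R) (x : R[i]) : complex.Re (a%:C * x) = a * complex.Re x.
Proof. by case: x => u v /=; rewrite mul0r subr0. Qed.

Lemma Re_riemann Q f : complex.Re (riemann Q f) =
  mesh Q * \sum_(0 <= j < nodes Q) complex.Re (f (node Q j)).
Proof. by rewrite /riemann Re_realM Re_sum. Qed.

(** The (Q+1)/m nodes to the right of 0 already contribute c/m. *)
Lemma Re_riemann_ge Q f m (c : R) : (0 < Q)%N -> (0 < m)%N -> 0 <= c ->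
  (forall s, 0 <= complex.Re (f s)) ->
  (forall s, `|s| <= m%:R^-1 -> c <= complex.Re (f s)) ->
  c / m%:R <= complex.Re (riemann Q f).
Proof.
move=> Q0 m0 c0 f0 fc; rewrite Re_riemann.
set lo := (Q.+1 * Q.+1)%N; set hi := (Q.+1 * Q.+1 + (Q.+1 %/ m).+1)%N.
have dQ : (Q.+1 %/ m <= Q.+1)%N by exact: leq_div.
have H j : c * (lo <= j < hi)%N%:R <= complex.Re (f (node Q j)).
  case: (boolP (lo <= j < hi)%N) => [/andP[a b]|_]; last by rewrite mulr0.
  rewrite mulr1; apply: fc; rewrite ler_norml node_ge node_le.
  have mR : 0 < m%:R :> R by rewrite ltr0n.
  apply/andP; split.
    apply: (@le_trans _ _ (Q.+1%:R * Q.+1%:R)); last by rewrite -natrM ler_nat.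
    by rewrite ler_wpM2r// gerDr oppr_le0 invr_ge0 ltW.
  rewrite mulrDl -lerBlDr [m%:R^-1 * _]mulrC ler_pdivlMr//.
  have : ((j - lo) * m)%:R <= Q.+1%:R :> R.
    rewrite ler_nat; apply: leq_trans (leq_trunc_div Q.+1 m).
    by rewrite leq_mul2r; apply/orP; right; move: b; rewrite /hi /lo; move: (_ %/ _)%N => k; lia.
  by rewrite natrM natrB// /lo natrM.
apply: (@le_trans _ _ (mesh Q * \sum_(0 <= j < nodes Q) c * (lo <= j < hi)%N%:R)); last first.
  rewrite ler_wpM2l ?(ltW (mesh_gt0 _))//; exact: (ler_sum _ (fun j _ => H j)).
rewrite -mulr_sumr -natr_sum count_interval; last by rewrite /lo /hi leq_addr.
have -> : (minn (nodes Q) hi - minn (nodes Q) lo = (Q.+1 %/ m).+1)%N.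
  rewrite /nodes -mulnn /lo /hi; move: (_ %/ _)%N dQ => k kQ; nia.
rewrite mulrCA ler_wpM2l// mulrC /mesh ler_pdivlMr ?ltr0n// mulrC.
rewrite ler_pdivrMr ?ltr0n// -natrM ler_nat.
rewrite mulSn [X in (X <= _)%N](divn_eq Q.+1 m) addnC leq_add2r.
by rewrite ltnW// ltn_pmod.
Qed.

Definition average Q f : R[i] :=
  (mesh Q)%:C * \sum_(0 <= j < Q.+1) f (j%:R * mesh Q).

Lemma averageD Q f g : average Q (fun s => f s + g s) = average Q f + average Q g.
Proof. by rewrite /average big_split mulrDr. Qed.

Lemma averageZ Q (c : R[i]) f : average Q (fun s => c * f s) = c * average Q f.
Proof. by rewrite /average -mulr_sumr mulrCA. Qed.

Lemma averageB Q f g : average Q (fun s => f s - g s) = average Q f - average Q g.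
Proof. by rewrite /average sumrB mulrBr. Qed.

Lemma average_cst Q (c : R[i]) : average Q (fun=> c) = c.
Proof.
rewrite /average sumr_const_nat subn0 -mulr_natl mulrA.
by rewrite -(rmorph_nat (real_complex R)) -rmorphM meshE mul1r.
Qed.

Lemma node01 Q j : (j < Q.+1)%N -> 0 <= j%:R * (mesh Q : R) < 1.
Proof.
move=> jQ; rewrite mulr_ge0//= ?(ltW (mesh_gt0 _))//.
by rewrite ltr_pdivrMr ?ltr0n// mul1r ltr_nat.
Qed.

Lemma cabs_average_le Q f (g : R -> R) :
  (forall s, 0 <= s < 1 -> cabs (f s) <= g s) ->
  cabs (average Q f) <= mesh Q * \sum_(0 <= j < Q.+1) g (j%:R * mesh Q).
Proof.
move=> fg; rewrite /average cabsM cabsr (gtr0_norm (mesh_gt0 _)).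
rewrite ler_wpM2l ?(ltW (mesh_gt0 _))// (le_trans (cabs_sum _ _ _))//.
rewrite big_nat_cond [leRHS]big_nat_cond; apply: ler_sum => j /andP[/andP[_ jQ] _].
by apply: fg; exact: node01.
Qed.

Lemma cabs_average_bound Q f (B : R) : (forall s, 0 <= s < 1 -> cabs (f s) <= B) ->
  cabs (average Q f) <= B.
Proof.
move=> fB; apply: (le_trans (@cabs_average_le Q f (fun=> B) fB)).
by rewrite sumr_const_nat subn0 -mulr_natl mulrA meshE mul1r.
Qed.

Definition periodic1 f := forall s, f (s + 1) = f s.

Lemma periodic1_nat f n s : periodic1 f -> f (s + n%:R) = f s.
Proof.
by move=> pf; elim: n => [|n IH]; [rewrite addr0|rewrite -natr1 addrA pf].
Qed.

Lemma average_shift Q f (e : R) t : periodic1 f ->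
  (forall s h, 0 <= h <= mesh Q -> cabs (f (s + h) - f s) <= e) ->
  cabs (average Q (fun s => f (s + t)) - average Q f) <= e.
Proof.
move=> pf fe.
wlog t0 : t / 0 <= t => [H|].
  pose n := (Num.truncn `|t|).+1.
  have tn : 0 <= t + n%:R.
    have := ltW (truncnS_gt `|t|); rewrite -/n => a; have := ler_norm (- t); rewrite normrN.
    lra.
  have := H _ tn; congr (cabs (average Q _ - _) <= e).
  by apply/funext => s; rewrite addrA periodic1_nat.
have [i /andP[it ti]] := mesh_floor Q t0.
have -> : average Q f = average Q (fun s => f (s + i%:R * mesh Q)).
  congr (_ * _).
  have := sum_shift (fun j => f (j%:R * mesh Q)) Q.+1 i.
  have -> : \sum_(0 <= j < i) f ((Q.+1 + j)%:R * mesh Q) = \sum_(0 <= j < i) f (j%:R * mesh Q).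
    apply: eq_bigr => j _; rewrite natrD mulrDl [_ * mesh Q]mulrC meshE addrC.
    exact: pf.
  move=> /addIr <-; apply: eq_bigr => j _; by rewrite natrD mulrDl.
rewrite -averageB; apply: cabs_average_bound => s _.
have -> : s + t = s + i%:R * mesh Q + (t - i%:R * mesh Q) by ring.
by apply: fe; rewrite subr_ge0 it lerBlDl.
Qed.

End RiemannEstimates.

(** * Means over a period and Fourier uniqueness *)

Section Mean.
Context {R : realType}.
Implicit Types (f g : R -> R[i]) (s t h : R) (Q N : nat).

Definition bounded_fun01 f := exists B : R, forall s, 0 <= s < 1 -> cabs (f s) <= B.

Definition uniform_cont f := forall e : R, 0 < e ->
  exists2 d : R, 0 < d & forall s h, `|h| < d -> cabs (f (s + h) - f s) <= e.

(** The integral over a period, for bounded functions. *)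
Definition mean f : R[i] := ulim (fun Q => average Q f).

Lemma bounded_average f : bounded_fun01 f -> bounded_seq (fun Q => average Q f).
Proof. by move=> [B fB]; exists B => Q; exact: cabs_average_bound. Qed.

Lemma meanD f g : bounded_fun01 f -> bounded_fun01 g ->
  mean (fun s => f s + g s) = mean f + mean g.
Proof.
move=> bf bg; rewrite -ulimD; [|exact: bounded_average..].
by congr ulim; apply/funext => Q; exact: averageD.
Qed.

Lemma meanZ (c : R[i]) f : bounded_fun01 f -> mean (fun s => c * f s) = c * mean f.
Proof.
move=> bf; rewrite -ulimZ; last exact: bounded_average.
by congr ulim; apply/funext => Q; exact: averageZ.
Qed.

Lemma cabs_mean_le f (B : R) : (forall s, 0 <= s < 1 -> cabs (f s) <= B) ->
  cabs (mean f) <= 2 * B.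
Proof.
move=> fB; apply: cabs_ulim_le; first by apply: bounded_average; exists B.
by apply: filterE => Q; exact: cabs_average_bound.
Qed.

Lemma mesh_small (d : R) : 0 < d -> \forall Q \near \oo, mesh Q < d.
Proof.
move=> d0; near=> Q; rewrite /mesh invf_plt ?posrE ?ltr0n//.
rewrite (@lt_trans _ _ Q%:R) ?ltr_nat//; near: Q.
exact: nbhs_infty_gtr.
Unshelve. all: by end_near. Qed.

Lemma mean_shift f t : periodic1 f -> uniform_cont f -> bounded_fun01 f ->
  bounded_fun01 (fun s => f (s + t)) -> mean (fun s => f (s + t)) = mean f.
Proof.
move=> pf uf bf bft; apply: ulim_eq; [exact: bounded_average..|].
move=> e /uf[d d0 fd]; apply: filterS (mesh_small d0) => Q Qd.
apply: average_shift => // s h /andP[h0 hQ]; apply: fd.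
by rewrite ger0_norm// (le_lt_trans hQ).
Qed.

Lemma mean_sum I (r : seq I) (F : I -> R -> R[i]) :
  (forall i, bounded_fun01 (F i)) ->
  mean (fun s => \sum_(i <- r) F i s) = \sum_(i <- r) mean (F i).
Proof.
move=> bF.
have bS r' : bounded_fun01 (fun s => \sum_(i <- r') F i s).
  elim: r' => [|i r' [B IH]]; first by exists 0 => s _; rewrite big_nil cabs0.
  have [A FA] := bF i; exists (A + B) => s s01.
  by rewrite big_cons (le_trans (cabsD _ _))// lerD ?FA ?IH.
elim: r => [|i r IH].
  rewrite big_nil; apply: ulim_eq0; first exact: bounded_average.
  move=> e e0; apply: filterE => Q.
  by apply: cabs_average_bound => s _; rewrite big_nil cabs0 ltW.
rewrite big_cons -IH -meanD//; congr ulim; apply/funext => Q; congr average.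
by apply/funext => s; rewrite big_cons.
Qed.

Definition dirichlet N s : R[i] := \sum_(0 <= k < N) unit_exp (k%:R * s).

Definition fejer N s : R[i] := N%:R^-1 * (dirichlet N s * (dirichlet N s)^*%C).

Lemma mulconj_cabs (x : R[i]) : x * x^*%C = (cabs x ^+ 2)%:C.
Proof. by rewrite -sqr_normc normr_cabs rmorphXn. Qed.

Lemma fejer_real N s : fejer N s = (N%:R^-1 * cabs (dirichlet N s) ^+ 2)%:C.
Proof.
rewrite /fejer mulconj_cabs [RHS](rmorphM _ N%:R^-1); congr (_ * _).
by rewrite (fmorphV (real_complex R)) rmorph_nat.
Qed.

Lemma fejer_exp N s : fejer N s =
  N%:R^-1 * \sum_(0 <= k < N) \sum_(0 <= l < N) unit_exp ((k%:R - l%:R) * s).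
Proof.
have -> : fejer N s = N%:R^-1 * (dirichlet N s *
    \sum_(0 <= l < N) unit_exp (- (l%:R * s))).
  rewrite /fejer {2}/dirichlet rmorph_sum; congr (_ * (_ * _)).
  by apply: eq_bigr => l _; exact/esym/unit_expN.
congr (_ * _); rewrite mulr_suml.
apply: eq_bigr => k _; rewrite mulr_sumr; apply: eq_bigr => l _.
by rewrite -unit_expD mulrBl.
Qed.

Lemma cos_lt1 t : 0 < t < 2 * pi -> cos t < 1.
Proof.
have pi0 : 0 < pi :> R := pi_gt0 _.
have H (u : R) : 0 < u <= pi -> cos u < 1.
  move=> /andP[u0 up].
  have uin : u \in `[0, pi] by rewrite in_itv/= (ltW u0).
  have zin : (0 : R) \in `[0, pi] by rewrite in_itv/= lexx ltW.
  by rewrite -cos0 (ltr_cos zin uin).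
move=> /andP[t0 t2]; have [tp|tp] := leP t pi; first by apply: H; rewrite t0.
rewrite -[t](subrK (2 * pi)) -cosN opprD opprB.
have -> : cos (2 * pi - t - 2 * pi) = cos (2 * pi - t).
  by rewrite mulr_natl cosB cos2pi sin2pi mulr1 mulr0 addr0.
by apply: H; apply/andP; split; lra.
Qed.

Lemma Re_unit_exp_lt1 s : 0 < s < 1 -> complex.Re (unit_exp s) < 1.
Proof.
move=> /andP[s0 s1] /=; apply: cos_lt1; have pi0 : 0 < pi :> R := pi_gt0 _.
by rewrite !mulr_gt0//= -{2}[2 * pi]mulr1 ltr_pM2l// mulr_gt0.
Qed.

(** Orthogonality of the characters of the cyclic group of order Q+1. *)
Lemma average_exp Q k l : (k < Q.+1)%N -> (l < Q.+1)%N ->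
  average Q (fun s => unit_exp ((k%:R - l%:R) * s)) = (k == l)%:R.
Proof.
move=> kQ lQ; have [->|kl] := eqVneq k l.
  rewrite -(average_cst Q (1%:R)); congr average.
  by apply/funext => s; rewrite subrr mul0r unit_exp0.
pose x : R[i] := unit_exp ((k%:R - l%:R) * mesh Q).
have x1 : x != 1.
  have H (a b : nat) : (a < b)%N -> (b < Q.+1)%N ->
      unit_exp ((b%:R - a%:R) * mesh Q) != 1 :> R[i].
    move=> ab bQ; apply/eqP => /(congr1 (@complex.Re R)) /= E.
    have : 0 < (b%:R - a%:R) * (mesh Q : R) < 1.
      rewrite -natrB ?(ltnW ab)// mulr_gt0 ?mesh_gt0 ?ltr0n ?subn_gt0//=.
      by rewrite ltr_pdivrMr ?ltr0n// mul1r ltr_nat (leq_ltn_trans (leq_subr _ _)).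
    by move=> /Re_unit_exp_lt1; rewrite /= E ltxx.
  have [kl'|lk] := ltnP k l; last by apply: H => //; rewrite ltn_neqAle eq_sym kl.
  apply: contra (H _ _ kl' lQ) => /eqP E.
  by rewrite -opprB mulNr unit_expN -/x E rmorph1.
have xQ : x ^+ Q.+1 = 1.
  rewrite -unit_expX mulrC -mulrA meshE mulr1.
  have -> : k%:R - l%:R = (k%:Z - l%:Z)%:~R :> R by rewrite rmorphB.
  exact: unit_exp_int.
rewrite /average; under eq_bigr => j _ do rewrite mulrCA unit_expX.
suff -> : \sum_(0 <= j < Q.+1) x ^+ j = 0 by rewrite mulr0.
apply: (mulfI (_ : x - 1 != 0)); first by rewrite subr_eq0.
by rewrite mulr0 big_mkord -subrX1 xQ subrr.
Qed.

(** The total mass of the kernel is 1 already on the mesh. *)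
Lemma average_fejer Q N : (0 < N)%N -> (N <= Q.+1)%N ->
  mesh Q * \sum_(0 <= j < Q.+1) (N%:R^-1 * cabs (dirichlet N (j%:R * mesh Q)) ^+ 2) = 1.
Proof.
move=> N0 NQ; apply: complexI; rewrite rmorphM rmorph_sum /=.
under eq_bigr => j _ do rewrite -fejer_real.
rewrite -[LHS]/(average Q (fejer N)).
have -> : fejer N = fun s => N%:R^-1 * \sum_(0 <= k < N) \sum_(0 <= l < N)
    unit_exp ((k%:R - l%:R) * s) by apply/funext => s; exact: fejer_exp.
rewrite averageZ.
have average_sum (r : seq nat) (F : nat -> R -> R[i]) :
    average Q (fun s => \sum_(i <- r) F i s) = \sum_(i <- r) average Q (F i).
  by rewrite /average exchange_big mulr_sumr.
rewrite average_sum (eq_big_nat _ _ (F2 := fun=> 1)) => [|k /andP[_ kN]].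
  by rewrite sumr_const_nat subn0 mulVf// pnatr_eq0 -lt0n.
rewrite average_sum (eq_big_nat _ _ (F2 := fun l => (k == l)%:R)) => [|l /andP[_ lN]].
  rewrite (bigD1_seq k) ?iota_uniq ?mem_index_iota//= eqxx big1 ?addr0// => l lk.
  by rewrite eq_sym (negbTE lk).
by rewrite average_exp// (leq_trans _ NQ).
Qed.

(** The geometric sum gives (1 - e(s)) D(s) = 1 - e(N s), of modulus at most 2. *)
Lemma fejer_off_center N s : (0 < N)%N ->
  cabs (1 - unit_exp s) ^+ 2 * (N%:R^-1 * cabs (dirichlet N s) ^+ 2) <= 4 / N%:R.
Proof.
move=> N0; rewrite mulrCA -exprMn -cabsM mulrC ler_wpM2r ?invr_ge0//.
have -> : (1 - unit_exp s) * dirichlet N s = 1 - unit_exp s ^+ N.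
  rewrite /dirichlet; under eq_bigr => k _ do rewrite unit_expX.
  by rewrite big_mkord -opprB mulNr -subrX1 opprB.
have : cabs (1 - unit_exp s ^+ N) <= 2.
  by rewrite (le_trans (cabsB _ _))// cabs1 -unit_expX cabs_unit_exp.
have := cabs_ge0 (1 - unit_exp s ^+ N); move: (cabs _) => c; nra.
Qed.

(** Continuity controls the oscillation of f near the endpoints of the period;
   elsewhere 1 - e(s) is bounded below, and the weight |1 - e(s)|^2 is the one
   that the Fejer kernel compensates. *)
Lemma period_modulus f (e : R) : periodic1 f -> bounded_fun01 f -> uniform_cont f ->
  0 < e -> exists2 B : R, 0 <= B & forall s, 0 <= s < 1 ->
    cabs (f s - f 0) <= e + B * cabs (1 - unit_exp s) ^+ 2.
Proof.
move=> pf [A fA] /(_ e) uf e0; have [d d0 fd] := uf e0.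
pose r := Num.min (d / 2) (1 / 4).
have r0 : 0 < r by rewrite lt_min !divr_gt0.
have rd : r < d by rewrite gt_min; apply/orP; left; lra.
have r4 : r <= 1 / 4 by rewrite ge_min lexx orbT.
have near0 s : `|s| <= r -> cabs (f s - f 0) <= e.
  by move=> sr; have := fd 0 s (le_lt_trans sr rd); rewrite add0r.
pose c := 1 - complex.Re (unit_exp r).
have c0 : 0 < c by rewrite subr_gt0; apply: Re_unit_exp_lt1; rewrite r0; lra.
have A0 : 0 <= A by apply: le_trans (fA 0 _); rewrite ?cabs_ge0// lexx ltr01.
exists (2 * A / c ^+ 2) => [|s /andP[s0 s1]].
  by rewrite divr_ge0 ?sqr_ge0// mulr_ge0.
have rhs0 : 0 <= 2 * A / c ^+ 2 * cabs (1 - unit_exp s) ^+ 2.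
  by rewrite mulr_ge0 ?sqr_ge0// divr_ge0 ?sqr_ge0// mulr_ge0.
have [sr|rs] := leP s r.
  by apply: (le_trans (near0 s _)); rewrite ?ger0_norm// lerDl.
have [sr|rs'] := leP (1 - s) r.
  have -> : f s = f (s - 1) by rewrite -(pf (s - 1)) subrK.
  apply: (le_trans (near0 _ _)); rewrite ?lerDl//.
  by rewrite distrC ger0_norm// subr_ge0 ltW.
apply: (@le_trans _ _ (2 * A)).
  rewrite (le_trans (cabsB _ _))// mulrDl mul1r lerD// fA ?s0//.
  by rewrite lexx ltr01.
suff H : c <= cabs (1 - unit_exp s).
  apply: (@le_trans _ _ (2 * A / c ^+ 2 * cabs (1 - unit_exp s) ^+ 2)).
    rewrite mulrAC ler_pdivlMr ?exprn_gt0// ler_wpM2l ?mulr_ge0//.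
    by rewrite ler_pXn2r ?nnegrE ?(ltW c0) ?cabs_ge0.
  by rewrite lerDr ltW.
apply: le_trans (Re_le_cabs _); apply: le_trans (ler_norm _).
rewrite ReB /c /= lerD2l lerN2.
have pi0 : 0 < pi :> R := pi_gt0 _.
have lecos (u v : R) : 0 <= u -> u <= v -> v <= pi -> cos v <= cos u.
  move=> u0; rewrite le_eqVlt => /predU1P[->//|uv] vp.
  have uin : u \in `[0, pi] by rewrite in_itv/= u0 (le_trans (ltW uv)).
  have vin : v \in `[0, pi] by rewrite in_itv/= vp (le_trans u0 (ltW uv)).
  by rewrite ltW// (ltr_cos uin vin).
have [sh|sh] := leP s (1 / 2).
  by apply: lecos; nra.
have -> : cos (2 * pi * s) = cos (2 * pi * (1 - s)).
  by rewrite mulrBr mulr1 mulr_natl cosB cos2pi sin2pi mul1r mul0r addr0.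
by apply: lecos; nra.
Qed.

Lemma bounded_fun01M f (u : R -> R) (c : R) : bounded_fun01 f ->
  bounded_fun01 (fun s => unit_exp (c * u s) * f s).
Proof.
by move=> [B fB]; exists B => s s01; rewrite cabsM cabs_unit_exp mul1r fB.
Qed.

(** The mean of f times the Fejer kernel is a combination of Fourier
   coefficients, hence 0. It differs from f(0) by the mean of (f - f(0)) times
   the kernel, which tends to 0 by [period_modulus] and [fejer_off_center]. *)
Lemma fourier_unique f : periodic1 f -> bounded_fun01 f -> uniform_cont f ->
  (forall z : int, mean (fun s => unit_exp (z%:~R * s) * f s) = 0) -> f 0 = 0.
Proof.
move=> pf bf uf f0; have [A fA] := bf.
apply/eqP; rewrite -cabs_eq0 eq_le cabs_ge0 andbT.
apply/ler_addgt0Pl => e e0; rewrite addr0.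
have e4 : 0 < e / 4 by rewrite divr_gt0.
have [B B0 fB] := period_modulus pf bf uf e4.
(* N makes the contribution off the center, B * (4 / N), at most e / 4. *)
pose N := (Num.truncn (16 * B / e)).+1.
have N0 : 0 < N%:R :> R by rewrite ltr0n.
have BN : B * (4 / N%:R) <= e / 4.
  have := ltW (truncnS_gt (16 * B / e)); rewrite -/N ler_pdivrMr// => H.
  rewrite mulrA ler_pdivrMr//; lra.
have mF : mean (fun s => fejer N s * f s) = 0.
  have -> : (fun s => fejer N s * f s) = fun s => N%:R^-1 *
     \sum_(kl <- [seq (k, l) | k <- index_iota 0 N, l <- index_iota 0 N])
       (unit_exp ((kl.1%:R - kl.2%:R) * s) * f s).
    apply/funext => s; rewrite fejer_exp -mulrA mulr_suml; congr (_ * _).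
    rewrite big_allpairs; apply: eq_bigr => k _.
    by rewrite mulr_suml.
  rewrite meanZ ?mean_sum.
  - rewrite big1 ?mulr0// => -[k l] _ /=.
    have -> : k%:R - l%:R = (k%:Z - l%:Z)%:~R :> R by rewrite rmorphB.
    exact: f0.
  - by move=> kl; exact: bounded_fun01M.
  - exists (\sum_(kl <- [seq (k, l) | k <- index_iota 0 N, l <- index_iota 0 N]) A) => s s01.
    apply: (le_trans (cabs_sum _ _ _)); apply: ler_sum => kl _.
    by rewrite cabsM cabs_unit_exp mul1r fA.
have bF : bounded_fun01 (fun s => fejer N s * f s).
  exists (N%:R * N%:R * A) => s s01; rewrite fejer_real cabsM cabsr.
  apply: ler_pM; rewrite ?cabs_ge0 ?fA// normrM ger0_norm ?invr_ge0// normrX.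
  rewrite mulrC ler_pdivrMr//.
  have : cabs (dirichlet N s) <= N%:R.
    apply: (le_trans (cabs_sum _ _ _)).
    under eq_bigr => k _ do rewrite cabs_unit_exp.
    by rewrite sumr_const_nat subn0.
  have N1 : 1 <= N%:R :> R by rewrite ler1n.
  have := cabs_ge0 (dirichlet N s); rewrite (ger0_norm (cabs_ge0 _)).
  move: (cabs _) => c c0 cN; rewrite (@le_trans _ _ (N%:R * N%:R))//.
    by rewrite expr2 ler_pM.
  by rewrite ler_peMr// mulr_ge0.
have close Q : (N <= Q.+1)%N ->
    cabs (average Q (fun s => fejer N s * f s) - f 0) <= e / 2.
  move=> NQ; pose k s : R := N%:R^-1 * cabs (dirichlet N s) ^+ 2.
  have k1 : average Q (fun s => f 0 * (k s)%:C) = f 0.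
    rewrite averageZ -[RHS]mulr1; congr (_ * _); rewrite /average -rmorph_sum -rmorphM.
    by rewrite average_fejer.
  rewrite -[X in _ - X]k1 -averageB.
  have bound s : 0 <= s < 1 ->
      cabs (fejer N s * f s - f 0 * (k s)%:C) <= k s * (e / 4) + e / 4.
    move=> s01; rewrite fejer_real -/(k s) [f 0 * _]mulrC -mulrBr cabsM cabsr.
    have ks0 : 0 <= k s by rewrite mulr_ge0 ?invr_ge0// sqr_ge0.
    rewrite ger0_norm//; apply: (le_trans (ler_wpM2l ks0 (fB s s01))).
    rewrite mulrDr lerD2l; apply: le_trans BN; rewrite mulrCA ler_wpM2l//.
    by rewrite mulrC; exact: fejer_off_center.
  apply: (le_trans (cabs_average_le Q bound)).
  rewrite big_split mulrDr /= -mulr_suml mulrA average_fejer//.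
  rewrite sumr_const_nat subn0 -[X in _ + _ * X]mulr_natl mulrA meshE.
  lra.
have -> : cabs (f 0) = cabs (ulim (fun Q => average Q (fun s => fejer N s * f s) - f 0)).
  rewrite (@ulimB _ _ (fun=> f 0)); [|exact: bounded_average|by exists (cabs (f 0))].
  by rewrite -/(mean _) mF sub0r cabsN /ulim !lim_cst//; case: (f 0).
apply: (@le_trans _ _ (2 * (e / 2))); last by lra.
apply: cabs_ulim_le.
  have [A' fA'] := bounded_average bF; exists (A' + cabs (f 0)) => Q.
  by rewrite (le_trans (cabsB _ _))// lerD2r.
near=> Q; apply: close; apply: leqW; near: Q.
exact: nbhs_infty_ge.
Unshelve. all: by end_near. Qed.

End Mean.

(** * Uniform estimates over bounded sets of translations *)

Section UniformShift.
Context {R : realType}.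
Variable k : nat.
Implicit Types (phi psi : test R k) (w u : @distribution R k) (y v : 'rV[R]_k).
Local Notation C := (R[i]^o).

Lemma cpderivs_test0 s x : cpderivs s (0 : test R k) x = 0.
Proof.
by have := cpderivs_testZ s 0 (0 : test R k); rewrite !scale0r => ->.
Qed.

Lemma test_cvg_sub (u : nat -> test R k) phi (m : nat -> nat) :
  (forall j, (j <= m j)%N) -> test_cvg u phi -> test_cvg (u \o m) phi.
Proof.
move=> jm [[K cK uK] ue]; split; first by exists K => // j; exact: uK.
move=> s e e0; have [N _ uN] := ue s e e0; exists N => // j Nj.
by apply: uN; exact: leq_trans Nj (jm j).
Qed.

(** Sequential continuity is uniform over bounded sets of translations:
   otherwise translates of a null sequence would violate it. *)
Lemma uniform_shift w (S : set 'rV[R]_k) (D : R) (u : nat -> test R k) :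
  (forall y, S y -> l1norm y <= D) -> test_cvg u 0 ->
  forall e : R, 0 < e ->
    \forall j \near \oo, forall y, S y -> cabs (w (test_shift y (u j))) < e.
Proof.
move=> SD u0 e e0; apply: contrapT => nH.
have /choice[g gP] : forall N, exists jy : nat * 'rV[R]_k,
    [/\ (N <= jy.1)%N, S jy.2 & ~ cabs (w (test_shift jy.2 (u jy.1))) < e].
  move=> N; apply: contrapT => nN; apply: nH; exists N => // j Nj y Sy.
  by apply: contrapT => H; apply: nN; exists (j, y).
have uc : test_cvg (fun N => test_shift (g N).2 (u (g N).1)) 0.
  have gm N : (N <= (g N).1)%N by have [] := gP N.
  have ug := test_cvg_sub gm u0; have [B B0 uB] := test_cvg_cube ug.
  apply: (@test_cvgI _ _ _ _ (B + D)) => [N|s d d0].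
    apply: in_cube_shift; last exact: uB.
    by move=> i; apply: le_trans (l1norm_coord _ _) _; apply: SD; have [] := gP N.
  have := test_cvg_cabs ug s d0; apply: filterS => N H x.
  have := H (x + (g N).2); rewrite /= !cpderivs_test0 !subr0.
  by rewrite cpderivs_test_shift.
have [N _ /(_ N (leqnn N))] := distr_cvg_cabs w uc e0.
by rewrite /= distr0 subr0; have [_ _] := gP N.
Qed.

Lemma harmonic_small (e : R) : 0 < e -> \forall j \near \oo, j.+1%:R^-1 < e :> R.
Proof. exact: (@mesh_small R). Qed.

(** The translates phi(. + h v) - phi form a null sequence as h tends to 0. *)
Lemma shift_uniform_continuous w phi v (S : set R) (D : R) (e : R) :
  (forall s, S s -> `|s| <= D) -> 0 < e ->
  exists2 d : R, 0 < d & forall s h, S s -> `|h| < d ->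
    cabs (w (test_shift ((s + h) *: v) phi) - w (test_shift (s *: v) phi)) < e.
Proof.
move=> SD e0; apply: contrapT => nH.
have /choice[h hP] : forall j : nat, exists h : R, `|h| < j.+1%:R^-1 /\
   ~ (forall s, S s -> cabs (w (test_shift ((s + h) *: v) phi)
        - w (test_shift (s *: v) phi)) < e).
  move=> j; apply: contrapT => nj; apply: nH; exists j.+1%:R^-1.
    by rewrite invr_gt0.
  move=> s h Ss hj; apply: contrapT => H; apply: nj; exists h; split => // H'.
  exact/H/H'.
pose u j := test_shift (h j *: v) phi - phi.
have h0 (d : R) : 0 < d -> \forall j \near \oo, l1norm (h j *: v) < d.
  move=> d0; have v1 : 0 < l1norm v + 1 by rewrite ltr_wpDl ?l1norm_ge0.
  have /harmonic_small : 0 < d / (l1norm v + 1) by rewrite divr_gt0.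
  apply: filterS => j jd; rewrite l1normZ.
  have := lt_trans (hP j).1 jd; rewrite ltr_pdivlMr// => /le_lt_trans; apply.
  by rewrite ler_wpM2l// lerDl.
have u0 : test_cvg u 0.
  have c := shift_cvg phi h0; have [B B0 cB] := test_cvg_cube c.
  have [B' B'0 pB] := test_in_cube phi.
  apply: (@test_cvgI _ _ _ _ (Num.max B B')) => [j|s d d0].
    by rewrite /u -[_ - phi]scale1r; apply: in_cube_lin.
  have := test_cvg_cabs c s d0; apply: filterS => j H x.
  by rewrite /u cpderivs_testB cpderivs_test0 subr0.
have Sv y : [set s *: v | s in S] y -> l1norm y <= D * l1norm v.
  by move=> [s Ss <-]; rewrite l1normZ ler_wpM2r ?l1norm_ge0 ?SD.
have [N _ /(_ N (leqnn N)) /= H] := uniform_shift w Sv u0 e0.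
apply: (hP N).2 => s Ss; have := H _ (ex_intro2 _ _ s Ss erefl).
by rewrite /u test_shiftB distrB test_shiftD scalerDl.
Qed.

(** The multiples phi/j form a null sequence. *)
Lemma shift_bounded w phi v (D : R) : exists B : R, forall s : R, `|s| <= D ->
  cabs (w (test_shift (s *: v) phi)) <= B.
Proof.
pose u (j : nat) : test R k := (j.+1%:R^-1)%:C *: phi.
have u0 : test_cvg u 0.
  have [B B0 pB] := test_in_cube phi.
  apply: (@test_cvgI _ _ _ _ B) => [j x ux|s e e0].
    apply: pB; apply: contraNneq ux => px.
    by rewrite -[u j x]/((j.+1%:R^-1)%:C * phi x) px mulr0.
  have [A A0 pA] := test_bounded s phi.
  have /harmonic_small : 0 < e / A by rewrite divr_gt0.
  apply: filterS => j je x; rewrite cpderivs_testZ cpderivs_test0 subr0.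
  rewrite -[X in cabs X]/((j.+1%:R^-1)%:C * cpderivs s phi x) cabsM cabsr ger0_norm//.
  rewrite ltr_pdivlMr// in je; apply: le_lt_trans je.
  by rewrite ler_wpM2l// invr_ge0.
have Sv y : [set s *: v | s in [set s : R | `|s| <= D]] y -> l1norm y <= D * l1norm v.
  by move=> [s Ss <-]; rewrite l1normZ ler_wpM2r ?l1norm_ge0.
have [N _ /(_ N (leqnn N)) /= H] := uniform_shift w Sv u0 ltr01.
exists N.+1%:R => s Ss; have := H _ (ex_intro2 _ _ s Ss erefl).
rewrite test_shiftZ distrZ cabsM cabsr ger0_norm// mulrC ltr_pdivrMr ?ltr0n//.
by rewrite mul1r => /ltW.
Qed.

End UniformShift.

(** * Slices and tensor products of test functions *)

Section Slices.
Context {R : realType}.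
Variables p q : nat.
Implicit Types (phi psi : test R (p + q)) (x : 'rV[R]_p) (c : 'rV[R]_q).
Local Notation C := (R[i]^o).

Lemma row_mx_norm (x : 'rV[R]_p) : `|row_mx x (0 : 'rV[R]_q)| <= `|x|.
Proof.
rewrite [leLHS]mx_normrE; apply/bigmax_leP; split=> [|[i j] _ /=]; first exact: normr_ge0.
rewrite mxE; case: (fintype.split j) => l; last by rewrite mxE normr0.
rewrite [leRHS]mx_normrE (ord1 i).
by apply: (@le_bigmax _ _ _ _ (fun ij => `|x ij.1 ij.2|) (0, l)).
Qed.

Lemma row_mx_continuous c : continuous (fun x : 'rV[R]_p => row_mx x c).
Proof.
move=> x A /nbhs_ballP[e e0 eA]; apply/nbhs_ballP; exists e => // y.
rewrite -ball_normE /= => xy; apply: eA; rewrite -ball_normE /=.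
rewrite opp_row_mx add_row_mx subrr; exact: le_lt_trans (row_mx_norm _) xy.
Qed.

(** Partial derivatives of a slice are slices of partial derivatives, already for
   the difference quotients. *)
Lemma slice_growth (f : 'rV[R]_(p + q) -> R) c (i : 'I_p) x :
  (fun h : R => h^-1 *: (((fun x => f (row_mx x c)) \o shift x) (h *: delta_mx 0 i)
     - f (row_mx x c))) =
  (fun h : R => h^-1 *: ((f \o shift (row_mx x c)) (h *: delta_mx 0 (lshift q i))
     - f (row_mx x c))).
Proof.
apply/funext => h /=; congr (_ *: (f _ - _)).
apply/rowP => j; rewrite !mxE; case: (fintype.splitP j) => l jl; rewrite ?mxE !eqxx /=.
  by congr (_ * (_ : bool)%:R + _); rewrite -!val_eqE /= -jl.
rewrite (_ : (j == lshift q i) = false) ?mulr0 ?add0r//.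
by apply/eqP => jE; move: jl; rewrite jE /=; have := ltn_ord i; lia.
Qed.

Lemma smooth_slice (f : 'rV[R]_(p + q) -> R) c : smooth f ->
  smooth (fun x => f (row_mx x c)).
Proof.
move=> sf; apply: (@smooth_stable _ _ [set g | exists2 f : 'rV[R]_(p + q) -> R,
  smooth f & g = fun x => f (row_mx x c)]); last by exists f.
  move=> _ [g sg ->]; split=> [i x|x].
    by rewrite /derivable slice_growth; exact: (smooth_derivable sg).
  apply: (@continuous_comp _ _ _ (fun x : 'rV[R]_p => row_mx x c) g).
    exact: row_mx_continuous.
  exact: smooth_continuous.
move=> _ i [g sg ->]; exists (pderiv (lshift q i) g); first exact: smooth_pderiv.
by apply/funext => x; rewrite /pderiv /derive slice_growth.
Qed.

Lemma csmooth_slice phi c : csmooth (fun x => phi (row_mx x c) : C).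
Proof.
by have [rf jf] := csmooth_test phi; split; [exact: (smooth_slice c rf)|exact: (smooth_slice c jf)].
Qed.

Lemma in_cube_slice B phi c : in_cube B phi ->
  in_cube B (fun x => phi (row_mx x c) : C).
Proof. by move=> pB x /pB H i; have := H (lshift q i); rewrite row_mxEl. Qed.

Lemma compact_supp_slice phi c : compact (supp (fun x => phi (row_mx x c) : C)).
Proof.
have [B B0 pB] := test_in_cube phi.
by apply: (compact_supp (@compact_cube R p B)) => x; exact: in_cube_slice.
Qed.

Definition test_slice c phi : test R p :=
  mk_test (csmooth_slice phi c) (@compact_supp_slice phi c).

Lemma test_deriv_slice c i phi :
  test_deriv i (test_slice c phi) = test_slice c (test_deriv (lshift q i) phi).
Proof.
apply: test_ext => x; rewrite /=/cpderivs /= /pderiv /derive.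
congr (_ +i* _).
  by rewrite -(slice_growth (@complex.Re R \o phi) c i x).
by rewrite -(slice_growth (@complex.Im R \o phi) c i x).
Qed.

Lemma test_deriv_tensor_l (f : test R p) (g : test R q) i :
  test_deriv (lshift q i) (test_tensor f g) = test_tensor (test_deriv i f) g.
Proof.
apply: test_ext => z.
have := congr1 (@^~ z) (cpderivs_tensor [:: lshift q i] (csmooth_test f) (csmooth_test g)).
have -> : lindices [:: lshift q i] = [:: i] by rewrite /lindices /= (unsplitK (inl i)).
have -> : rindices [:: lshift q i] = [::] by rewrite /rindices /= (unsplitK (inl i)).
by rewrite (cpderivs0 g).
Qed.

Lemma test_deriv_tensor_r (f : test R p) (g : test R q) i :
  test_deriv (rshift p i) (test_tensor f g) = test_tensor f (test_deriv i g).
Proof.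
apply: test_ext => z.
have := congr1 (@^~ z) (cpderivs_tensor [:: rshift p i] (csmooth_test f) (csmooth_test g)).
have -> : lindices [:: rshift p i] = [::] by rewrite /lindices /= (unsplitK (inr i)).
have -> : rindices [:: rshift p i] = [:: i] by rewrite /rindices /= (unsplitK (inr i)).
by rewrite (cpderivs0 f).
Qed.

End Slices.

(** * Tensor products are total *)

Section Density.
Context {R : realType}.
Variable p : nat.
Implicit Types (phi psi : test R (p + 1)) (rho : test R 1) (z : 'rV[R]_(p + 1)) (Q : nat).
Local Notation C := (R[i]^o).

Definition time_dir : 'rV[R]_(p + 1) := delta_mx 0 (rshift p 0).

Lemma test_sumE k I (r : seq I) (P : pred I) (F : I -> test R k) x :
  (\sum_(i <- r | P i) F i) x = \sum_(i <- r | P i) F i x.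
Proof.
elim/big_rec2 : _ => [//|i y1 y2 _ <-].
by [].
Qed.

Lemma test_scaleE k (a : R[i]) (f : test R k) x : (a *: f) x = a * f x.
Proof. by []. Qed.

Lemma test_deriv_linear k (i : 'I_k) : linear (@test_deriv R k i).
Proof. exact: (test_op_deriv i).1. Qed.

Lemma test_derivZ k (i : 'I_k) (a : R[i]) (f : test R k) :
  test_deriv i (a *: f) = a *: test_deriv i f.
Proof. by rewrite lin_opZ//; exact: test_deriv_linear. Qed.

Lemma test_deriv_sum k (i : 'I_k) I (r : seq I) (F : I -> test R k) :
  test_deriv i (\sum_(j <- r) F j) = \sum_(j <- r) test_deriv i (F j).
Proof.
have lin := test_deriv_linear i.
elim: r => [|j r IH]; first by rewrite !big_nil (lin_op0 lin).
by rewrite !big_cons (lin_opD lin) IH.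
Qed.

(** Two discretizations of the convolution of phi and rho in time: one is a sum
   of tensor products, the other a combination of translates of phi. *)
Definition tensor_sum Q phi rho : test R (p + 1) := (mesh Q)%:C *:
  \sum_(0 <= j < nodes Q) test_tensor (test_slice (const_mx (node Q j)) phi)
    (test_shift (const_mx (- node Q j)) rho).

Definition shift_sum Q phi rho : test R (p + 1) := (mesh Q)%:C *:
  \sum_(0 <= j < nodes Q)
     rho (const_mx (- node Q j)) *: test_shift (node Q j *: time_dir) phi.

Lemma tensor_sumE Q phi rho z : tensor_sum Q phi rho z =
  riemann Q (fun s => phi (z + (s - z 0 (rshift p 0)) *: time_dir)
     * rho (const_mx (z 0 (rshift p 0) - s))).
Proof.
rewrite /tensor_sum test_scaleE test_sumE.
congr (_ * _); apply: eq_bigr => j _.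
rewrite -[LHS]/(phi (row_mx (lsubmx z) (const_mx (node Q j))) *
   rho (rsubmx z + const_mx (- node Q j))).
congr (phi _ * rho _).
  apply/rowP => l; rewrite !mxE; case: (fintype.splitP l) => m lm; rewrite ?mxE eqxx /=.
    have -> : l = lshift 1 m by exact: val_inj.
    by rewrite eq_lrshift mulr0 addr0.
  have -> : l = rshift p m by exact: val_inj.
  by rewrite eq_rshift (ord1 m) eqxx mulr1 addrC subrK.
by apply/rowP => l; rewrite !mxE (ord1 l).
Qed.

Lemma shift_sumE Q phi rho z : shift_sum Q phi rho z =
  riemann Q (fun s => phi (z + s *: time_dir) * rho (const_mx (- s))).
Proof.
rewrite /shift_sum test_scaleE test_sumE.
congr (_ * _); apply: eq_bigr => j _.
by rewrite test_scaleE mulrC.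
Qed.

Lemma tensor_sum_deriv_l Q i phi rho :
  test_deriv (lshift 1 i) (tensor_sum Q phi rho) =
  tensor_sum Q (test_deriv (lshift 1 i) phi) rho.
Proof.
rewrite /tensor_sum test_derivZ test_deriv_sum; congr (_ *: _).
by apply: eq_bigr => j _; rewrite test_deriv_tensor_l test_deriv_slice.
Qed.

Lemma tensor_sum_deriv_r Q phi rho :
  test_deriv (rshift p 0) (tensor_sum Q phi rho) = tensor_sum Q phi (test_deriv 0 rho).
Proof.
rewrite /tensor_sum test_derivZ test_deriv_sum; congr (_ *: _).
by apply: eq_bigr => j _; rewrite test_deriv_tensor_r test_deriv_shift.
Qed.

Lemma shift_sum_deriv Q i phi rho :
  test_deriv i (shift_sum Q phi rho) = shift_sum Q (test_deriv i phi) rho.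
Proof.
rewrite /shift_sum test_derivZ test_deriv_sum; congr (_ *: _).
by apply: eq_bigr => j _; rewrite test_derivZ test_deriv_shift.
Qed.

Definition unif_null (u : nat -> 'rV[R]_(p + 1) -> R[i]) := forall e : R, 0 < e ->
  \forall Q \near \oo, forall z, cabs (u Q z) < e.

Lemma unif_nullD u v : unif_null u -> unif_null v ->
  unif_null (fun Q z => u Q z + v Q z).
Proof.
move=> nu nv e e0; have e2 : 0 < e / 2 by rewrite divr_gt0.
apply: filterS2 (nu _ e2) (nv _ e2) => Q uQ vQ z.
by rewrite (le_lt_trans (cabsD _ _))// [e]splitr ltrD.
Qed.

Lemma unif_null_mesh u (B : R) : 0 <= B ->
  (\forall Q \near \oo, forall z, cabs (u Q z) <= B * mesh Q) -> unif_null u.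
Proof.
move=> B0 uB e e0; have B1 : 0 < B + 1 by rewrite ltr_wpDl.
have e1 : 0 < e / (B + 1) by rewrite divr_gt0.
apply: filterS2 uB (mesh_small e1) => Q uQ mQ z; apply: (le_lt_trans (uQ z)).
rewrite ltr_pdivlMr// in mQ; apply: le_lt_trans mQ.
by rewrite mulrC ler_wpM2l ?(ltW (mesh_gt0 _))// lerDl.
Qed.

Lemma in_cube_nat k (f : test R k) : exists K : nat, in_cube K%:R f.
Proof.
have [B B0 fB] := test_in_cube f; exists (Num.truncn B).+1 => x /fB H i.
exact: le_trans (H i) (ltW (truncnS_gt B)).
Qed.

Lemma const_mx_shift (s h : R) : const_mx (s + h) = const_mx s + h *: delta_mx 0 0 :> 'rV[R]_1.
Proof. by apply/rowP => l; rewrite !mxE (ord1 l) eqxx mulr1. Qed.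

Lemma time_coord z (s : R) : (z + (s - z 0 (rshift p 0)) *: time_dir) 0 (rshift p 0) = s.
Proof. by rewrite !mxE !eqxx mulr1 addrC subrK. Qed.

(** At a point (x, t) both sums are Riemann sums of s |-> phi(x, s) rho(t - s),
   one of them translated by t. *)
Lemma tensor_shift_null phi rho :
  unif_null (fun Q z => tensor_sum Q phi rho z - shift_sum Q phi rho z).
Proof.
have [K phiK] := in_cube_nat phi; have [K' rhoK] := in_cube_nat rho.
have [L L0 lip] := test_lipschitz [::] phi; have [L' L'0 lip'] := test_lipschitz [::] rho.
have [A A0 phiA] := test_bounded [::] phi; have [A' A'0 rhoA] := test_bounded [::] rho.
rewrite cpderivs0 in lip phiA; rewrite cpderivs0 in lip' rhoA.
pose D := (K + K')%N; pose c := L * l1norm time_dir * A' + A * L' * l1norm (delta_mx 0 0 : 'rV[R]_1).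
have c0 : 0 <= c.
  by rewrite addr_ge0// !mulr_ge0// ?l1norm_ge0// ltW.
apply: (@unif_null_mesh _ ((2 * (K + 2 * D)%:R + 1) * c)).
  by rewrite mulr_ge0// addr_ge0// mulr_ge0.
near=> Q => z; rewrite tensor_sumE shift_sumE; set t := z 0 (rshift p 0).
pose g (s : R) : R[i] := phi (z + (s - t) *: time_dir) * rho (const_mx (t - s)).
have gK s : g s != 0 -> `|s| <= K%:R.
  rewrite mulf_eq0 negb_or => /andP[/phiK H _].
  by have := H (rshift p 0); rewrite time_coord.
have gD s : g s != 0 -> `|t| <= D%:R.
  move=> gs; have sK := gK s gs; move: gs; rewrite mulf_eq0 negb_or => /andP[_ /rhoK].
  move=> /(_ 0); rewrite mxE => ts; rewrite -(subrK s t) natrD addrC.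
  by rewrite (le_trans (ler_normD _ _))// lerD.
rewrite -[riemann Q _]/(riemann Q g).
have -> : (fun s => phi (z + s *: time_dir) * rho (const_mx (- s))) = fun s => g (s + t).
  apply/funext => s; rewrite /g addrK; congr (_ * rho (const_mx _)).
  by rewrite opprD addrCA subrr addr0.
have [tD|tD] := leP `|t| D%:R; last first.
  have g0 : g = fun=> 0.
    by apply/funext => s; apply/eqP; apply: contraTT tD => /gD; rewrite -leNgt.
  by rewrite g0 subrr cabs0 mulr_ge0 ?(ltW (mesh_gt0 _))// mulr_ge0// addr_ge0// mulr_ge0.
rewrite cabsC -mulrA; apply: riemann_shift => //.
- by rewrite mulr_ge0// ltW// mesh_gt0.
- move=> s h /andP[h0 hQ].
  have -> : g (s + h) - g s =
      (phi (z + (s - t) *: time_dir + h *: time_dir) - phi (z + (s - t) *: time_dir))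
        * rho (const_mx (t - (s + h))) +
      phi (z + (s - t) *: time_dir) *
        (rho (const_mx (t - s) + (- h) *: delta_mx 0 0) - rho (const_mx (t - s))).
    have -> : z + (s - t) *: time_dir + h *: time_dir = z + (s + h - t) *: time_dir.
      by rewrite -addrA -scalerDl addrAC.
    have -> : const_mx (t - s) + (- h) *: delta_mx 0 0 = const_mx (t - (s + h)) :> 'rV[R]_1.
      by rewrite -const_mx_shift opprD addrA.
    by rewrite /g mulrBl mulrBr addrA subrK.
  rewrite (le_trans (cabsD _ _))// !cabsM mulrDl; apply: lerD.
    rewrite [leRHS](_ : _ = (L * (mesh Q * l1norm time_dir)) * A'); last by ring.
    apply: ler_pM; rewrite ?cabs_ge0// (le_trans (lip _ _))// l1normZ ger0_norm//.
    by rewrite ler_wpM2l// ler_wpM2r ?l1norm_ge0.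
  rewrite [leRHS](_ : _ = A * (L' * (mesh Q * l1norm (delta_mx 0 0 : 'rV[R]_1)))); last by ring.
  apply: ler_pM; rewrite ?cabs_ge0// (le_trans (lip' _ _))// l1normZ normrN ger0_norm//.
  by rewrite ler_wpM2l// ler_wpM2r ?l1norm_ge0.
- by rewrite ltnS; near: Q; exact: nbhs_infty_ge.
Unshelve. all: by end_near. Qed.

(** Integration by parts: each derivative is replaced by a difference quotient
   whose step is the mesh, at the cost of the step, and for difference quotients
   the identity is exact by reindexing. *)
Lemma tensor_sum_parts phi rho :
  unif_null (fun Q z => tensor_sum Q phi (test_deriv 0 rho) z
    - tensor_sum Q (test_deriv (rshift p 0) phi) rho z).
Proof.
have [K phiK] := in_cube_nat phi; have [K' phi'K] := in_cube_nat (test_deriv (rshift p 0) phi).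
have [L L0 quo] := test_quotient [::] (rshift p 0) phi.
have [L' L'0 quo'] := test_quotient [::] 0 rho.
have [A A0 phiA] := test_bounded [::] phi; have [A' A'0 rhoA] := test_bounded [::] rho.
rewrite cpderivs0 in phiA; rewrite cpderivs0 in rhoA.
have {}quo x h : cabs (phi (x + h *: time_dir) - phi x
    - h%:C * test_deriv (rshift p 0) phi x) <= L * h ^+ 2.
  by have := quo x h; rewrite !cpderivs0.
have {}quo' x h : cabs (rho (x + h *: delta_mx 0 0) - rho x
    - h%:C * test_deriv 0 rho x) <= L' * h ^+ 2.
  by have := quo' x h; rewrite !cpderivs0.
pose K0 := (K + K' + 1)%N; pose c := A * L' + L * A'.
have c0 : 0 <= c by rewrite addr_ge0// mulr_ge0// ltW.
apply: (@unif_null_mesh _ ((2 * K0%:R + 1) * c)).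
  by rewrite mulr_ge0// addr_ge0// mulr_ge0.
near=> Q => z; rewrite !tensor_sumE -riemannB; set t := z 0 (rshift p 0).
set h : R := mesh Q; have h0 : 0 < h := mesh_gt0 Q.
have hC : h%:C != 0 :> R[i].
  by rewrite -(rmorph0 (real_complex R)) (inj_eq (@complexI _)) gt_eqF.
have h1 : h <= 1 by rewrite /h /mesh invf_le1 ?ltr0n// ler1n.
pose X (s : R) := z + (s - t) *: time_dir.
pose Y (s : R) : 'rV[R]_1 := const_mx (t - s).
have XS s : X (s + h) = X s + h *: time_dir.
  by rewrite /X -[RHS]addrA -scalerDl addrAC.
have YS s : Y s + h *: delta_mx 0 0 = const_mx (t - s + h).
  by rewrite /Y -const_mx_shift.
have XK s : phi (X s) != 0 -> `|s| <= K%:R.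
  by move=> /phiK /(_ (rshift p 0)); rewrite time_coord.
have X'K s : test_deriv (rshift p 0) phi (X s) != 0 -> `|s| <= K'%:R.
  by move=> /phi'K /(_ (rshift p 0)); rewrite time_coord.
pose k (s : R) : R[i] := phi (X s) * rho (Y s + h *: delta_mx 0 0).
have k0 : riemann Q (fun s => k s - k (s + h)) = 0.
  rewrite riemannB; apply/eqP; rewrite subr_eq0 eq_sym; apply/eqP.
  have := @riemann_mesh_shift R Q k K 1 _ _ _; rewrite mul1r; apply.
  - by move=> s; rewrite mulf_eq0 negb_or => /andP[/XK].
  - by rewrite ltnS; near: Q; exact: nbhs_infty_ge.
  - have : (K.+1 <= Q)%N by near: Q; exact: nbhs_infty_ge.
    by rewrite -mulnn; nia.
(* The errors of the two difference quotients; the rest of the integrand is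
   k s - k (s + h), whose Riemann sum is 0. *)
pose E s : R[i] := - phi (X s) * (rho (Y s + h *: delta_mx 0 0) - rho (Y s)
    - h%:C * test_deriv 0 rho (Y s))
  + (phi (X s + h *: time_dir) - phi (X s)
    - h%:C * test_deriv (rshift p 0) phi (X s)) * rho (Y s).
have -> : riemann Q (fun s => phi (X s) * test_deriv 0 rho (Y s)
     - test_deriv (rshift p 0) phi (X s) * rho (Y s)) =
   h^-1%:C * riemann Q E.
  have hE : h^-1%:C = h%:C^-1 :> R[i] by rewrite (fmorphV (real_complex R)).
  apply: (mulfI hC); rewrite [RHS]mulrA hE mulfV// mul1r -riemannZ -[RHS]addr0 -k0 -riemannD.
  congr riemann; apply/funext => s; rewrite /E /k XS.
  have -> : Y (s + h) + h *: delta_mx 0 0 = Y s.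
    by rewrite YS /Y; congr const_mx; rewrite opprD addrA subrK.
  ring.
rewrite cabsM cabsr gtr0_norm ?invr_gt0// mulrC ler_pdivrMr//.
have -> : (2 * K0%:R + 1) * c * h * h = (2 * K0%:R + 1) * (c * h ^+ 2) by ring.
apply: cabs_riemann_le; first by rewrite mulr_ge0// sqr_ge0.
  move=> s Es; have [XsK|] := leP `|s| K0%:R => //; rewrite natrD natrD => sK.
  have far1 : phi (X s) = 0.
    by apply/eqP; apply: contraTT sK => /XK; rewrite -leNgt; have := ler0n R K'; lra.
  have far2 : test_deriv (rshift p 0) phi (X s) = 0.
    by apply/eqP; apply: contraTT sK => /X'K; rewrite -leNgt; have := ler0n R K; lra.
  have far3 : phi (X s + h *: time_dir) = 0.
    apply/eqP; apply: contraTT sK; rewrite -XS => /XK; rewrite -leNgt.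
    have := ler0n R K'; rewrite !ler_norml => ? /andP[? ?]; apply/andP; split; lra.
  by move: Es; rewrite /E far1 far2 far3 !(oppr0, mul0r, mulr0, subr0, addr0) eqxx.
move=> s; rewrite /E (le_trans (cabsD _ _))// !cabsM cabsN /c mulrDl; apply: lerD.
  by rewrite -mulrA; apply: ler_pM; rewrite ?cabs_ge0.
by rewrite mulrAC; apply: ler_pM; rewrite ?cabs_ge0.
Unshelve. all: by end_near. Qed.

End Density.

Section TensorsTotal.
Context {R : realType}.
Variable p : nat.
Implicit Types (phi psi : test R (p + 1)) (rho : test R 1) (z : 'rV[R]_(p + 1)) (Q : nat).
Local Notation C := (R[i]^o).
Local Notation td := (@time_dir R p).

Lemma split_index (i : 'I_(p + 1)) : (exists j, i = lshift 1 j) \/ i = rshift p 0.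
Proof.
case: (fintype.splitP i) => j ij; [left; exists j|right]; apply: val_inj => //=.
by rewrite ij (ord1 j).
Qed.

Lemma tensor_sum_parts_derivs s phi rho :
  unif_null (fun Q z => cpderivs s (tensor_sum Q phi (test_deriv 0 rho)) z
    - cpderivs s (tensor_sum Q (test_deriv (rshift p 0) phi) rho) z).
Proof.
elim/last_ind: s phi rho => [|s i IH] phi rho e e0.
  apply: filterS (tensor_sum_parts phi rho e0) => Q H z.
  by rewrite !cpderivs0.
have [[j ->]|->] := split_index i.
  apply: filterS (IH (test_deriv (lshift 1 j) phi) rho e e0) => Q H z.
  by rewrite -!cpderivs_deriv !tensor_sum_deriv_l test_derivC.
apply: filterS (IH phi (test_deriv 0 rho) e e0) => Q H z.
by rewrite -!cpderivs_deriv !tensor_sum_deriv_r.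
Qed.

(** Time derivatives fall on rho in one sum and on phi in the other; they are
   moved one at a time with [tensor_sum_parts_derivs]. *)
Lemma tensor_shift_null_derivs s phi rho :
  unif_null (fun Q z => cpderivs s (tensor_sum Q phi rho) z
    - cpderivs s (shift_sum Q phi rho) z).
Proof.
elim/last_ind: s phi rho => [|s i IH] phi rho.
  move=> e e0; apply: filterS (tensor_shift_null phi rho e0) => Q H z.
  by rewrite !cpderivs0.
have [[j ->]|->] := split_index i.
  move=> e e0; apply: filterS (IH (test_deriv (lshift 1 j) phi) rho e e0) => Q H z.
  by rewrite -!cpderivs_deriv tensor_sum_deriv_l shift_sum_deriv.
have := unif_nullD (tensor_sum_parts_derivs s phi rho) (IH (test_deriv (rshift p 0) phi) rho).
move=> H e e0; apply: filterS (H e e0) => Q {}H z; have := H z.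
by rewrite -!cpderivs_deriv tensor_sum_deriv_r shift_sum_deriv addrA subrK.
Qed.

Lemma riemann_neq0 Q (f : R -> R[i]) : riemann Q f != 0 -> exists s, f s != 0.
Proof.
move=> rf; apply: contrapT => nf; case/eqP: rf; rewrite /riemann big1 ?mulr0// => j _.
by apply: contrapT => /eqP fj; apply: nf; exists (node Q j).
Qed.

Lemma tensor_shift_cvg phi rho :
  test_cvg (fun Q => tensor_sum Q phi rho - shift_sum Q phi rho) 0.
Proof.
have [K K0 phiK] := test_in_cube phi; have [K' K'0 rhoK] := test_in_cube rho.
have line_coord z (r : R) (j : 'I_p) : (z + r *: td) 0 (lshift 1 j) = z 0 (lshift 1 j).
  by rewrite !mxE eq_lrshift mulr0 addr0.
have tK Q : in_cube (K + K') (tensor_sum Q phi rho).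
  move=> z; rewrite tensor_sumE => /riemann_neq0[s].
  rewrite mulf_eq0 negb_or => /andP[/phiK zK /rhoK /(_ 0)]; rewrite mxE => ts i.
  have [[j ->]|->] := split_index i.
    by have := zK (lshift 1 j); rewrite line_coord => /le_trans; apply; rewrite lerDl.
  have := zK (rshift p 0); rewrite time_coord => sK.
  by rewrite -(subrK s (z _ _)) addrC (le_trans (ler_normD _ _))// lerD.
have sK Q : in_cube (K + K') (shift_sum Q phi rho).
  move=> z; rewrite shift_sumE => /riemann_neq0[s].
  rewrite mulf_eq0 negb_or => /andP[/phiK zK /rhoK /(_ 0)]; rewrite mxE => ts i.
  have [[j ->]|->] := split_index i.
    by have := zK (lshift 1 j); rewrite line_coord => /le_trans; apply; rewrite lerDl.
  have := zK (rshift p 0); rewrite !mxE !eqxx mulr1 => sK.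
  by rewrite -(addrK s (z _ _)) (le_trans (ler_normD _ _))// lerD.
apply: (@test_cvgI _ _ _ _ (Num.max (K + K') (K + K'))) => [Q|s e e0].
  by rewrite -[_ - _]scale1r; apply: in_cube_lin.
apply: filterS (tensor_shift_null_derivs s phi rho e0) => Q H z.
by rewrite cpderivs_testB cpderivs_test0 subr0.
Qed.

(** If w kills tensor products, then w(shift_sum Q phi rho) tends to 0. This is a
   Riemann sum of Phi(s) rho(-s), where Phi(s) = w(phi(. + s e_t)) is continuous:
   for a bump rho concentrated near 0 it stays away from 0 unless
   Phi(0) = w(phi) is 0. *)
Lemma tensors_total (w : @distribution R (p + 1)) :
  (forall (psi : test R p) (rho : test R 1), w (test_tensor psi rho) = 0) -> w = 0.
Proof.
move=> w0; apply: distribution_ext => phi; rewrite -[RHS]/(0 : R[i]).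
apply/eqP; apply: contraT => Phi0.
pose Phi (s : R) := w (test_shift (s *: td) phi).
have Phi0E : Phi 0 = w phi by rewrite /Phi scale0r test_shift0.
pose a := cabs (w phi); have a0 : 0 < a by rewrite lt_neqAle eq_sym cabs_eq0 Phi0 cabs_ge0.
have a2 : 0 < a / 2 by rewrite divr_gt0.
have S0 (s : R) : [set (0 : R)] s -> `|s| <= 0 by move=> ->; rewrite normr0.
have [d d0 Phid] := shift_uniform_continuous w phi td S0 a2.
have {}Phid (h : R) : `|h| < d -> cabs (Phi h - w phi) < a / 2.
  by move=> hd; have := Phid 0 h erefl hd; rewrite add0r scale0r test_shift0.
(* The bump is supported in |s| <= 2 / m < d, where Phi stays close to w phi. *)
pose m := (Num.truncn (2 / d)).+1.
have m0 : 0 < m%:R :> R by rewrite ltr0n.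
have md : 2 / m%:R < d.
  rewrite ltr_pdivrMr// mulrC -ltr_pdivrMr//; exact: truncnS_gt.
have e0 : 0 < 2 / m%:R :> R by rewrite divr_gt0.
have [rho [rhoK rhoR [c c0 rhoc]]] := bump_exists 1 e0.
(* The conjugate factor turns the value at 0 into the positive real a^2. *)
pose g (s : R) : R[i] := (w phi)^*%C * (Phi s * rho (const_mx (- s))).
have reg s : `|s| < d -> a * (a / 2) <= complex.Re ((w phi)^*%C * Phi s).
  move=> sd; have -> : (w phi)^*%C * Phi s = (a ^+ 2)%:C + (w phi)^*%C * (Phi s - w phi).
    by rewrite mulrBr -(mulconj_cabs (w phi)) [w phi * _]mulrC addrCA subrr addr0.
  rewrite ReD /=.
  have : `|complex.Re ((w phi)^*%C * (Phi s - w phi))| <= a * (a / 2).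
    rewrite (le_trans (Re_le_cabs _))// cabsM; apply: ler_pM; rewrite ?cabs_ge0//.
      by rewrite /cabs normcJ.
    exact: ltW (Phid _ sd).
  rewrite ler_norml => /andP[+ _]; nra.
have gE s : complex.Re (g s) =
    complex.Re (rho (const_mx (- s))) * complex.Re ((w phi)^*%C * Phi s).
  have [+ _] := rhoR (const_mx (- s)); rewrite /g mulrA.
  case: (rho _) => u v /= ->; move: (_ * Phi s) => [u' v'] /=.
  by rewrite mulr0 subr0 mulrC.
have g0 s : 0 <= complex.Re (g s).
  rewrite gE; have [rs|rs] := eqVneq (rho (const_mx (- s))) 0.
    by rewrite rs mul0r.
  rewrite mulr_ge0//; first by have [] := rhoR (const_mx (- s)).
  have sd : `|s| < d.
    by have := rhoK _ rs 0; rewrite mxE normrN => /le_lt_trans; apply.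
  by apply: le_trans (reg s sd); rewrite mulr_ge0// ltW.
have gc s : `|s| <= m%:R^-1 -> c * (a * (a / 2)) <= complex.Re (g s).
  move=> sm; have sd : `|s| < d.
    rewrite (le_lt_trans sm)// (le_lt_trans _ md)// ler_peMl ?invr_ge0//.
    by rewrite ler1n.
  rewrite gE; apply: ler_pM; [exact: ltW|by rewrite mulr_ge0 ?ltW| |exact: reg].
  by apply: rhoc => i; rewrite mxE normrN mulrAC divff// mul1r.
have wg Q : (w phi)^*%C * w (shift_sum Q phi rho) = riemann Q g.
  rewrite riemannZ; congr (_ * _); rewrite /shift_sum distrZ distr_sum.
  by congr (_ * _); apply: eq_bigr => j _; rewrite distrZ mulrC.
have wt Q : w (tensor_sum Q phi rho) = 0.
  by rewrite /tensor_sum distrZ distr_sum big1 ?mulr0// => j _; exact: w0.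
pose b := c * (a * (a / 2)) / m%:R.
have b0 : 0 < b by rewrite divr_gt0// !mulr_gt0.
have ba : 0 < b / a by rewrite divr_gt0.
have [N _ NP] := distr_cvg_cabs w (tensor_shift_cvg phi rho) ba.
have := NP N.+1 (leqnSn N); rewrite /= distr0 subr0 distrB wt sub0r cabsN.
have := @Re_riemann_ge R N.+1 g m (c * (a * (a / 2))) isT isT _ g0 gc.
rewrite -wg => H; have {}H := H (ltW (mulr_gt0 c0 (mulr_gt0 a0 a2))).
have := le_trans H (le_trans (ler_norm _) (Re_le_cabs _)).
have aJ : cabs (w phi)^*%C = a by rewrite /cabs normcJ.
rewrite cabsM aJ.
rewrite -/b ltr_pdivlMr// [_ * a]mulrC => H1 H2.
by have := le_lt_trans H1 H2; rewrite ltxx.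
Qed.

End TensorsTotal.

(** * Fourier parts of a periodic distribution *)

Section FourierPart.
Context {R : realType}.
Variable k : nat.
Implicit Types (phi psi : test R k) (w u : @distribution R k) (a y : 'rV[R]_k) (z : int).
Local Notation C := (R[i]^o).

Definition shift_periodic a w := forall phi, w (test_shift a phi) = w phi.

Definition orbit_fun a w phi (s : R) : R[i] := w (test_shift (s *: a) phi).

Lemma orbit_funD a w phi s r :
  orbit_fun a w phi (s + r) = orbit_fun a w (test_shift (r *: a) phi) s.
Proof. by rewrite /orbit_fun test_shiftD scalerDl. Qed.

Lemma periodic1_int (f : R -> R[i]) (n : int) s : periodic1 f -> f (s + n%:~R) = f s.
Proof.
move=> pf; case: n => n; first exact: periodic1_nat.
by rewrite NegzE mulrNz -[in RHS](subrK n.+1%:R s) periodic1_nat.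
Qed.

Lemma floor01 (s : R) : exists (n : int) (r : R), s = r + n%:~R /\ 0 <= r < 1.
Proof.
exists (Num.floor s), (s - (Num.floor s)%:~R); split; first by rewrite subrK.
have /andP[a b] := real_floor_itv (num_real s).
by rewrite subr_ge0 a /= ltrBlDl -[1 in X in _ + X]/(1%:~R) -intrD.
Qed.

Lemma orbit_bounded a w phi : bounded_fun01 (orbit_fun a w phi).
Proof.
have [B HB] := shift_bounded w phi a 1; exists B => s /andP[s0 s1].
by apply: HB; rewrite ger0_norm// ltW.
Qed.

Section Periodic.
Variables (a : 'rV[R]_k) (w : @distribution R k).
Hypothesis wa : shift_periodic a w.

Lemma orbit_periodic phi : periodic1 (orbit_fun a w phi).
Proof.
move=> s; rewrite /orbit_fun scalerDl scale1r addrC -test_shiftD; exact: wa.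
Qed.

Lemma orbit_bounded_all phi : exists2 B : R, 0 < B & forall s, cabs (orbit_fun a w phi s) <= B.
Proof.
have [B HB] := orbit_bounded a w phi; exists (`|B| + 1) => [|s].
  by rewrite ltr_wpDl.
have [n [r [-> r01]]] := floor01 s; rewrite periodic1_int; last exact: orbit_periodic.
rewrite (le_trans (HB r r01))// (le_trans (ler_norm B))//.
by rewrite lerDl.
Qed.

Lemma orbit_uniform_cont phi : uniform_cont (orbit_fun a w phi).
Proof.
move=> e e0.
have S1 (s : R) : [set s : R | 0 <= s < 1] s -> `|s| <= 1.
  by move=> /andP[s0 s1]; rewrite ger0_norm// ltW.
have [d d0 dP] := shift_uniform_continuous w phi a S1 e0.
exists d => // s h hd; have [n [r [-> r01]]] := floor01 s.
rewrite addrAC !periodic1_int; [|exact: orbit_periodic..].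
exact: ltW (dP r h r01 hd).
Qed.

Lemma modulated_uniform_cont phi z :
  uniform_cont (fun s => unit_exp (z%:~R * s) * orbit_fun a w phi s).
Proof.
move=> e e0; have e2 : 0 < e / 2 by rewrite divr_gt0.
have [B B0 wB] := orbit_bounded_all phi.
have [d d0 dP] := orbit_uniform_cont phi e2.
have eB : 0 < e / 2 / B by rewrite divr_gt0.
have [d' d'0 d'P] := unit_exp_near1 eB.
pose c : R := `|z%:~R| + 1; have c0 : 0 < c by rewrite ltr_wpDl.
exists (Num.min d (d' / c)) => [|s h]; first by rewrite lt_min d0 divr_gt0.
rewrite lt_min => /andP[hd hd'].
have -> : unit_exp (z%:~R * (s + h)) * orbit_fun a w phi (s + h)
    - unit_exp (z%:~R * s) * orbit_fun a w phi s =
  unit_exp (z%:~R * s) * ((unit_exp (z%:~R * h) - 1) * orbit_fun a w phi (s + h)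
    + (orbit_fun a w phi (s + h) - orbit_fun a w phi s)).
  by rewrite mulrDr unit_expD; ring.
rewrite cabsM cabs_unit_exp mul1r (le_trans (cabsD _ _))// [e]splitr lerD ?dP//.
rewrite cabsM -[leRHS](@divfK _ B) ?gt_eqF//.
apply: ler_pM; rewrite ?cabs_ge0// ltW// d'P// normrM.
rewrite ltr_pdivlMr// in hd'; apply: le_lt_trans hd'.
by rewrite mulrC ler_wpM2l// lerDl.
Qed.

End Periodic.

Definition fourier_fun a z w phi : C :=
  mean (fun s => unit_exp (z%:~R * s) * orbit_fun a w phi s).

Lemma fourier_fun_linear a z w : linear (fourier_fun a z w).
Proof.
move=> c phi psi; rewrite -[RHS]/(c * fourier_fun a z w phi + fourier_fun a z w psi).
have b chi := bounded_fun01M id z%:~R (orbit_bounded a w chi).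
rewrite /fourier_fun -meanZ// -meanD//; last first.
  by have [B HB] := b phi; exists (cabs c * B) => s s01; rewrite cabsM ler_wpM2l ?cabs_ge0 ?HB.
congr mean; apply/funext => s; rewrite /orbit_fun.
have -> : test_shift (s *: a) (c *: phi + psi) =
  c *: test_shift (s *: a) phi + test_shift (s *: a) psi by exact: test_ext.
by rewrite distrD distrZ mulrDr mulrCA.
Qed.

Lemma fourier_fun_cvg a z w (u : nat -> test R k) phi : test_cvg u phi ->
  (fun j => fourier_fun a z w (u j)) @ \oo --> fourier_fun a z w phi.
Proof.
move=> uphi; apply/cvgC_cabsP => e e0.
have u0 : test_cvg (fun j => u j - phi) 0.
  have [B B0 uB] := test_cvg_cube uphi; have [B' B'0 pB] := test_in_cube phi.
  apply: (@test_cvgI _ _ _ _ (Num.max B B')) => [j|s d d0].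
    by rewrite -[_ - _]scale1r; apply: in_cube_lin.
  apply: filterS (test_cvg_cabs uphi s d0) => j H x.
  by rewrite cpderivs_testB cpderivs_test0 subr0.
have Sa y : [set s *: a | s in [set s : R | 0 <= s < 1]] y -> l1norm y <= l1norm a.
  move=> [s /andP[s0 s1] <-]; rewrite l1normZ ger0_norm// ler_piMl ?l1norm_ge0//.
  exact: ltW.
have e3 : 0 < e / 3 by rewrite divr_gt0.
apply: filterS (uniform_shift w Sa u0 e3) => j H.
have lin := fourier_fun_linear a z w.
have -> : fourier_fun a z w (u j) - fourier_fun a z w phi = fourier_fun a z w (u j - phi).
  have E := lin (-1) phi (u j); rewrite !scaleN1r in E.
  by rewrite [u j - phi]addrC E addrC.
apply: (@le_lt_trans _ _ (2 * (e / 3))); last by lra.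
apply: cabs_mean_le => s s01; rewrite cabsM cabs_unit_exp mul1r ltW//.
by apply: H; exists s.
Qed.

(** The part of w on which translation by s a acts as the character
   exp(-2 i pi z s). *)
Definition fourier_part a z w : @distribution R k :=
  Distribution (mem_set (conj (fourier_fun_linear a z w) (@fourier_fun_cvg a z w))).

Lemma fourier_partE a z w phi : fourier_part a z w phi =
  mean (fun s => unit_exp (z%:~R * s) * orbit_fun a w phi s).
Proof. by []. Qed.

(** The integrand is periodic, and the mean is invariant under translation. *)
Lemma fourier_part_eigen a z w phi r : shift_periodic a w ->
  fourier_part a z w (test_shift (r *: a) phi) =
  unit_exp (- (z%:~R * r)) * fourier_part a z w phi.
Proof.
move=> wa; rewrite !fourier_partE.
pose G s := unit_exp (z%:~R * s) * orbit_fun a w phi s.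
have -> : (fun s => unit_exp (z%:~R * s) * orbit_fun a w (test_shift (r *: a) phi) s) =
   fun s => unit_exp (- (z%:~R * r)) * G (s + r).
  apply/funext => s; rewrite /G orbit_funD mulrA -unit_expD; congr (unit_exp _ * _).
  by ring.
have pG : periodic1 G.
  move=> s; rewrite /G orbit_periodic// mulrDr mulr1 unit_expD unit_exp_int.
  by rewrite mulr1.
have bG s : bounded_fun01 (fun t => G (t + s)).
  have [B B0 wB] := orbit_bounded_all wa phi; exists B => t _.
  by rewrite /G cabsM cabs_unit_exp mul1r.
have bG0 : bounded_fun01 G by have := bG 0; under eq_fun do rewrite addr0.
rewrite meanZ// mean_shift//; exact: modulated_uniform_cont.
Qed.

(** Translations commute, so splitting off one direction keeps the behaviour in
   the directions already treated. *)
Lemma fourier_part_equivariant a z w y (c : R[i]) :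
  (forall phi, w (test_shift y phi) = c * w phi) ->
  forall phi, fourier_part a z w (test_shift y phi) = c * fourier_part a z w phi.
Proof.
move=> wc phi; rewrite !fourier_partE -meanZ; last exact/bounded_fun01M/orbit_bounded.
congr mean; apply/funext => s; rewrite mulrCA; congr (_ * _).
by rewrite /orbit_fun -wc !test_shiftD addrC.
Qed.

Lemma fourier_part_linear a z : linear (fourier_part a z).
Proof.
move=> c u w; apply: distribution_ext => phi.
rewrite -[RHS]/(c * fourier_part a z u phi + fourier_part a z w phi) !fourier_partE.
have b v := bounded_fun01M id z%:~R (orbit_bounded a v phi).
rewrite -meanZ// -meanD//; last first.
  by have [B HB] := b u; exists (cabs c * B) => s s01; rewrite cabsM ler_wpM2l ?cabs_ge0 ?HB.
congr mean; apply/funext => s; rewrite mulrCA -mulrDr; congr (_ * _).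
Qed.

Lemma fourier_part_dderiv a z i w :
  fourier_part a z (dderiv i w) = dderiv i (fourier_part a z w).
Proof.
apply: distribution_ext => phi; rewrite dderivE !fourier_partE -mulN1r -meanZ; last first.
  exact/bounded_fun01M/orbit_bounded.
congr mean; apply/funext => s; rewrite mulrCA; congr (_ * _).
by rewrite /orbit_fun dderivE test_deriv_shift mulN1r.
Qed.

Lemma fourier_part_vanishes a z w (U : set 'rV[R]_k) :
  (forall s phi, supp phi `<=` U -> supp (test_shift (s *: a) phi) `<=` U) ->
  vanishes_on U w -> vanishes_on U (fourier_part a z w).
Proof.
move=> Ua w0 phi phiU; rewrite fourier_partE.
rewrite (_ : (fun s => _) = fun s => 0 * (0 : R[i])).
  by rewrite meanZ ?mul0r//; exists 0 => s _; rewrite cabs0.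
by apply/funext => s; rewrite /orbit_fun w0 ?mulr0 ?mul0r//; exact: Ua.
Qed.

(** The Fourier coefficients of s |-> w(phi(. + s a)) are the values at phi of the
   Fourier parts, so this function and in particular w(phi) vanish. *)
Lemma fourier_part_complete a w : shift_periodic a w ->
  (forall z, fourier_part a z w = 0) -> w = 0.
Proof.
move=> wa w0; apply: distribution_ext => phi.
have := @fourier_unique R (orbit_fun a w phi) (orbit_periodic wa phi)
  (orbit_bounded a w phi) (orbit_uniform_cont wa phi).
rewrite {2}/orbit_fun scale0r test_shift0; apply=> z.
by have := congr1 (fun v : distribution k => v phi) (w0 z).
Qed.

End FourierPart.

(** * Riemann sums in several variables *)

Section LatticeSums.
Context {R : realType}.
Implicit Types (Q K D : nat).

(** The sum over a cubic mesh is written as an iterated sum, so that bounds and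
   translation invariance follow from dimension one by induction. *)
Fixpoint lattice_sum Q k : ('rV[R]_k -> R[i]) -> R[i] :=
  match k return ('rV[R]_k -> R[i]) -> R[i] with
  | 0 => fun f => f 0
  | k'.+1 => fun f : 'rV[R]_(1 + k') -> R[i] =>
      riemann Q (fun s => lattice_sum Q (fun x => f (row_mx (const_mx s : 'rV[R]_1) x)))
  end.

Lemma lattice_sumB Q k (f g : 'rV[R]_k -> R[i]) :
  lattice_sum Q (fun x => f x - g x) = lattice_sum Q f - lattice_sum Q g.
Proof.
elim: k f g => [//|k IH] f g /=; rewrite -riemannB; congr riemann.
by apply/funext => s; exact: IH.
Qed.

Lemma lattice_sumD Q k (f g : 'rV[R]_k -> R[i]) :
  lattice_sum Q (fun x => f x + g x) = lattice_sum Q f + lattice_sum Q g.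
Proof.
elim: k f g => [//|k IH] f g /=; rewrite -riemannD; congr riemann.
by apply/funext => s; exact: IH.
Qed.

Lemma lattice_sumZ Q k (c : R[i]) (f : 'rV[R]_k -> R[i]) :
  lattice_sum Q (fun x => c * f x) = c * lattice_sum Q f.
Proof.
elim: k f => [//|k IH] f /=; rewrite -riemannZ; congr riemann.
by apply/funext => s; exact: IH.
Qed.

Lemma lattice_sum0 Q k : lattice_sum Q (fun _ : 'rV[R]_k => 0) = 0.
Proof.
by have := lattice_sumZ Q 0 (fun _ : 'rV[R]_k => 0); rewrite !mul0r.
Qed.

Lemma row_mx_split k (P : R -> Prop) (s : R) (x : 'rV[R]_k) :
  (forall i, P (row_mx (const_mx s : 'rV[R]_1) x 0 i)) <-> P s /\ forall i, P (x 0 i).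
Proof.
split=> [H|[Ps Px] i].
  split=> [|i]; first by have := H (lshift k 0); rewrite row_mxEl mxE.
  by have := H (rshift 1 i); rewrite row_mxEr.
case: (fintype.splitP i) => j ij.
  by have -> : i = lshift k j; [exact: val_inj|rewrite row_mxEl mxE].
by have -> : i = rshift 1 j; [exact: val_inj|rewrite row_mxEr].
Qed.

Lemma cabs_lattice_sum_le Q k K (B : R) (f : 'rV[R]_k -> R[i]) : 0 <= B ->
  in_cube K%:R f -> (forall x, cabs (f x) <= B) ->
  cabs (lattice_sum Q f) <= (2 * K%:R + 1) ^+ k * B.
Proof.
move=> B0; elim: k f => [|k IH] f fK fB; first by rewrite mul1r; exact: fB.
rewrite exprS -mulrA /=; apply: cabs_riemann_le.
- by rewrite mulr_ge0// exprn_ge0// addr_ge0// mulr_ge0.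
- move=> s; have [//|sK] := leP `|s| K%:R; rewrite (_ : (fun x => _) = fun=> 0).
    by rewrite lattice_sum0 eqxx.
  apply/funext => x; apply/eqP; apply: contraTT sK => /fK.
  by move=> /(row_mx_split (fun r => `|r| <= K%:R))[]; rewrite -leNgt.
- move=> s; apply: IH => // x /fK.
  by move=> /(row_mx_split (fun r => `|r| <= K%:R))[].
Qed.

(** One coordinate is translated at a time; each translation costs the modulus e
   times a bound for the number of nodes in the support times the cell volume. *)
Lemma lattice_sum_shift Q k K D (e : R) (f : 'rV[R]_k -> R[i]) (t : 'rV[R]_k) :
  0 <= e -> in_cube K%:R f ->
  (forall x i h, 0 <= h <= mesh Q -> cabs (f (x + h *: delta_mx 0 i) - f x) <= e) ->
  (forall i, `|t 0 i| <= D%:R) -> (K + 2 * D < Q.+1)%N ->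
  cabs (lattice_sum Q (fun x => f (x + t)) - lattice_sum Q f)
    <= k%:R * (2 * (K + 2 * D)%:R + 1) ^+ k * e.
Proof.
move=> e0 + + + KDQ; set c : R := 2 * (K + 2 * D)%:R + 1.
have c1 : 1 <= c by rewrite lerDr mulr_ge0.
have c0 : 0 <= c by rewrite (le_trans ler01).
elim: k f t => [|k IH] f t fK fe tD.
  by rewrite /= (_ : 0 + t = 0) ?subrr ?cabs0 ?mul0r//; apply/rowP => -[].
pose t0 := t 0 0; pose t' : 'rV[R]_k := rsubmx (t : 'rV[R]_(1 + k)).
have fsplit (s : R) (x : 'rV[R]_k) : f (row_mx (const_mx s : 'rV[R]_1) x + t) =
    f (row_mx (const_mx (s + t0) : 'rV[R]_1) (x + t')).
  congr (f _); apply/rowP => i; rewrite !mxE; case: (@fintype.splitP 1 k i) => l il; rewrite !mxE.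
    by rewrite /t0; congr (_ + t _ _); apply: val_inj; rewrite /= il (ord1 l).
  by congr (_ + t _ _); exact: val_inj.
pose F (s : R) (x : 'rV[R]_k) := f (row_mx (const_mx s : 'rV[R]_1) x).
have FK s : in_cube K%:R (F s).
  by move=> x /fK /(row_mx_split (fun r => `|r| <= K%:R))[].
have Fe s (x : 'rV[R]_k) i h : 0 <= h <= mesh Q ->
    cabs (F s (x + h *: delta_mx 0 i) - F s x) <= e.
  move=> hQ; have := fe (row_mx (const_mx s : 'rV[R]_1) x) (rshift 1 i) h hQ.
  congr (cabs (f _ - _) <= _); apply/rowP => j; rewrite !mxE.
  case: (@fintype.splitP 1 k j) => l jl.
    by rewrite !mxE eqxx /= -val_eqE /= jl (ord1 l) /= mulr0 addr0.
  by rewrite !mxE !eqxx /= -!val_eqE /= jl.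
have t'D i : `|t' 0 i| <= D%:R by rewrite mxE.
have t0D : `|t0| <= D%:R := tD 0.
pose G (s : R) := lattice_sum Q (F s).
have GK s : G s != 0 -> `|s| <= K%:R.
  have [//|sK] := leP `|s| K%:R; rewrite /G (_ : F s = fun=> 0).
    by rewrite lattice_sum0 eqxx.
  apply/funext => x; apply/eqP; apply: contraTT sK => /fK.
  by move=> /(row_mx_split (fun r => `|r| <= K%:R))[]; rewrite -leNgt.
have Ge s h : 0 <= h <= mesh Q -> cabs (G (s + h) - G s) <= c ^+ k * e.
  move=> hQ; rewrite /G -lattice_sumB.
  apply: (@le_trans _ _ ((2 * K%:R + 1) ^+ k * e)).
    apply: cabs_lattice_sum_le => // [x|x].
      have [FK1|/FK//] := eqVneq (F (s + h) x) 0.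
      by rewrite FK1 sub0r oppr_eq0 => /FK.
    have := fe (row_mx (const_mx s : 'rV[R]_1) x) 0 h hQ.
    congr (cabs (f _ - _) <= _); apply/rowP => j; rewrite !mxE.
    case: (@fintype.splitP 1 k j) => l jl; rewrite ?mxE eqxx /= -val_eqE /= jl.
      by rewrite (ord1 l) /= mulr1.
    by rewrite /= mulr0 addr0.
  rewrite ler_wpM2r// lerXn2r ?nnegrE ?addr_ge0 ?mulr_ge0//.
  by rewrite lerD2r ler_wpM2l// ler_nat leq_addr.
rewrite /= (_ : (fun s => _) = fun s => (lattice_sum Q (fun x => F (s + t0) (x + t'))
    - G (s + t0)) + G (s + t0)); last first.
  apply/funext => s; rewrite subrK; congr (lattice_sum Q _).
  by apply/funext => x; rewrite fsplit.
rewrite riemannD -addrA (le_trans (cabsD _ _))//.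
have -> : k.+1%:R * c ^+ k.+1 * e = c * (k%:R * c ^+ k * e) + c * (c ^+ k * e).
  by rewrite -natr1 exprS; ring.
apply: lerD; last first.
  by apply: riemann_shift => //; rewrite mulr_ge0// exprn_ge0.
apply: (@le_trans _ _ ((2 * (K + D)%:R + 1) * (k%:R * c ^+ k * e))).
  apply: cabs_riemann_le.
  - by rewrite !mulr_ge0// exprn_ge0.
  - move=> s; have [//|sK] := leP `|s| (K + D)%:R.
    have Fst x : F (s + t0) x = 0.
      apply/eqP; apply: contraTT sK => /fK.
      move=> /(row_mx_split (fun r => `|r| <= K%:R))[+ _]; rewrite -leNgt natrD.
      by move: t0D; rewrite !ler_norml => /andP[? ?] /andP[? ?]; apply/andP; split; lra.
    rewrite /G -lattice_sumB (_ : (fun x => _) = fun=> 0) ?lattice_sum0 ?eqxx//.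
    by apply/funext => x; rewrite !Fst subrr.
  - by move=> s; exact: (IH (F (s + t0)) t' (FK _) (Fe _) t'D).
rewrite ler_wpM2r ?mulr_ge0 ?exprn_ge0// lerD2r ler_wpM2l// ler_nat; lia.
Qed.

Lemma Re_lattice_sum_ge Q k m (c : R) (f : 'rV[R]_k -> R[i]) :
  (0 < Q)%N -> (0 < m)%N -> 0 <= c -> (forall x, 0 <= complex.Re (f x)) ->
  (forall x : 'rV[R]_k, (forall i, `|x 0 i| <= m%:R^-1) -> c <= complex.Re (f x)) ->
  c / m%:R ^+ k <= complex.Re (lattice_sum Q f).
Proof.
move=> Q0 m0 c0; have m1 : 0 <= m%:R :> R by rewrite ler0n.
have pos j (g : 'rV[R]_j -> R[i]) : (forall x, 0 <= complex.Re (g x)) ->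
    0 <= complex.Re (lattice_sum Q g).
  elim: j g => [|j IH] g g0 /=; first exact: g0.
  rewrite Re_riemann mulr_ge0 ?(ltW (mesh_gt0 _))//.
  by apply: sumr_ge0 => l _; exact: IH.
elim: k f => [|k IH] f f0 fc.
  by rewrite expr0 divr1; apply: fc => -[].
rewrite exprSr invfM mulrA /=; apply: Re_riemann_ge => //.
- by rewrite divr_ge0// exprn_ge0.
- by move=> s; exact: pos.
- move=> s sm; apply: IH => // x xm; apply: fc.
  exact/(row_mx_split (fun r => `|r| <= m%:R^-1)).
Qed.

End LatticeSums.

(** * Plane waves concentrated at time zero *)

Section PlaneWave.
Context {R : realType}.
Variable d : nat.
Variable v : 'cV[R]_d.
Implicit Types (phi psi : test R (d + 1)) (x y : 'rV[R]_d) (Q K : nat).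
Local Notation C := (R[i]^o).
Local Notation present x := (row_mx x (0 : 'rV[R]_1)).

Definition dot x : R := (x *m v) 0 0.

Lemma dotD x y : dot (x + y) = dot x + dot y.
Proof. by rewrite /dot mulmxDl mxE. Qed.

Lemma dotZ (c : R) x : dot (c *: x) = c * dot x.
Proof. by rewrite /dot -scalemxAl mxE. Qed.

Lemma dot_le x : `|dot x| <= \sum_i `|x 0 i| * `|v i 0|.
Proof.
rewrite /dot mxE (le_trans (ler_norm_sum _ _ _))//.
by apply: ler_sum => i _; rewrite normrM.
Qed.

Definition wave_fun psi x : R[i] := unit_exp (dot x) * psi (present x).

Lemma wave_fun_cube psi (B : R) : in_cube B psi -> in_cube B (wave_fun psi : _ -> C).
Proof.
move=> pB x; rewrite mulf_eq0 negb_or => /andP[_ /pB H] i.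
by have := H (lshift 1 i); rewrite row_mxEl.
Qed.

Lemma cabs_wave_fun psi x : cabs (wave_fun psi x) = cabs (psi (present x)).
Proof. by rewrite /wave_fun cabsM cabs_unit_exp mul1r. Qed.

Lemma wave_lattice_le psi K (B : R) Q : 0 <= B -> in_cube K%:R psi ->
  (forall z, cabs (psi z) <= B) ->
  cabs (lattice_sum Q (wave_fun psi)) <= (2 * K%:R + 1) ^+ d * B.
Proof.
move=> B0 pK pB; apply: cabs_lattice_sum_le => //; first exact: wave_fun_cube.
by move=> x; rewrite cabs_wave_fun.
Qed.

Lemma wave_bounded psi : bounded_seq (fun Q => lattice_sum Q (wave_fun psi)).
Proof.
have [K pK] := in_cube_nat psi; have [B B0 pB] := test_bounded [::] psi.
exists ((2 * K%:R + 1) ^+ d * B) => Q; apply: wave_lattice_le => //; first exact: ltW.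
by move=> z; have := pB z; rewrite cpderivs0.
Qed.

(** The integral of exp(2 i pi x.v) psi(x, 0) over x. *)
Definition wave_integral psi : C := ulim (fun Q => lattice_sum Q (wave_fun psi)).

Lemma wave_integral_linear : linear wave_integral.
Proof.
move=> c phi psi; rewrite -[RHS]/(c * wave_integral phi + wave_integral psi).
rewrite /wave_integral -ulimZ; last exact: wave_bounded.
rewrite -ulimD; [|exact/bounded_seqZ/wave_bounded|exact: wave_bounded].
congr ulim; apply/funext => Q; rewrite -lattice_sumZ -lattice_sumD.
congr (lattice_sum Q _); apply/funext => x; rewrite /wave_fun.
rewrite -[(c *: phi + psi) _]/(c * phi (present x) + psi (present x)); ring.
Qed.

Lemma wave_integral_cvg (u : nat -> test R (d + 1)) phi : test_cvg u phi ->
  (fun j => wave_integral (u j)) @ \oo --> wave_integral phi.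
Proof.
move=> uphi; apply/cvgC_cabsP => e e0.
have [B B0 uB] := test_cvg_cube uphi; have [B' B'0 pB] := test_in_cube phi.
pose K := (Num.truncn (Num.max B B')).+1.
have KB : Num.max B B' <= K%:R by exact: ltW (truncnS_gt _).
pose c : R := (2 * K%:R + 1) ^+ d.
have c0 : 0 < c by rewrite exprn_gt0// ltr_wpDl// mulr_ge0.
have ec : 0 < e / (4 * c) by rewrite divr_gt0// mulr_gt0.
apply: filterS (test_cvg_cabs uphi [::] ec) => j H.
have lin := wave_integral_linear.
have -> : wave_integral (u j) - wave_integral phi = wave_integral (u j - phi).
  have E := lin (-1) phi (u j); rewrite !scaleN1r in E.
  by rewrite [u j - phi]addrC E addrC.
apply: (@le_lt_trans _ _ (2 * (c * (e / (4 * c))))).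
  apply: cabs_ulim_le; first exact: wave_bounded.
  apply: filterE => Q; apply: wave_lattice_le; first exact: ltW.
    move=> z zu i; apply: le_trans KB; move: z zu i.
    by rewrite -[_ - _]scale1r; apply: in_cube_lin.
  by move=> z; have := H z; rewrite -cpderivs_testB cpderivs0 => /ltW.
have -> : 2 * (c * (e / (4 * c))) = e / 2 by field; rewrite gt_eqF.
by lra.
Qed.

Definition plane_wave : @distribution R (d + 1) :=
  Distribution (mem_set (conj wave_integral_linear wave_integral_cvg)).

(** The factor exp(2 i pi x.v) is multiplicative and the Riemann sums are
   translation invariant in the limit. *)
Lemma plane_wave_shift phi y :
  plane_wave (test_shift (present y) phi) = unit_exp (- dot y) * plane_wave phi.
Proof.
rewrite -[LHS]/(ulim _) -[plane_wave phi]/(ulim _) -ulimZ; last exact: wave_bounded.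
have E Q : lattice_sum Q (wave_fun (test_shift (present y) phi)) =
    unit_exp (- dot y) * lattice_sum Q (fun x => wave_fun phi (x + y)).
  rewrite -lattice_sumZ; congr (lattice_sum Q _); apply/funext => x.
  rewrite /wave_fun test_shiftE add_row_mx addr0 dotD unit_expD.
  by rewrite -[LHS]mul1r -(unit_expK (dot y)); ring.
apply: ulim_eq; [exact: wave_bounded|exact/bounded_seqZ/wave_bounded|].
move=> e e0.
have [K pK] := in_cube_nat phi; have [B B0 pB] := test_bounded [::] phi.
have [L L0 lip] := test_lipschitz [::] phi; rewrite !cpderivs0 in pB lip.
pose D := (Num.truncn (l1norm y)).+1.
have yD i : `|y 0 i| <= D%:R.
  by rewrite (le_trans (l1norm_coord y i))// ltW// truncnS_gt.
pose c : R := d%:R * (2 * (K + 2 * D)%:R + 1) ^+ d + 1.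
have c0 : 0 < c by rewrite ltr_wpDl// mulr_ge0// exprn_ge0// addr_ge0// mulr_ge0.
have ec : 0 < e / c by rewrite divr_gt0.
have ecB : 0 < e / c / 2 / B by rewrite !divr_gt0.
have [r r0 rP] := unit_exp_near1 ecB.
pose V : R := \sum_i `|v i 0| + 1.
have V0 : 0 < V by rewrite ltr_wpDl// sumr_ge0.
have Vi i : `|v i 0| <= V.
  by rewrite /V (bigD1 i)//= -addrA lerDl addr_ge0// sumr_ge0.
have rV : 0 < r / V by rewrite divr_gt0.
have L1 : 0 < L + 1 by rewrite ltr_wpDl.
have eL : 0 < e / c / 2 / (L + 1) by rewrite !divr_gt0.
near=> Q; rewrite E -mulrBr cabsM cabs_unit_exp mul1r.
apply: (@le_trans _ _ (d%:R * (2 * (K + 2 * D)%:R + 1) ^+ d * (e / c))); last first.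
  rewrite mulrA ler_pdivrMr// mulrC ler_wpM2l ?(ltW e0)//.
  by rewrite lerDl.
apply: lattice_sum_shift => //; [exact: ltW|exact: wave_fun_cube| |]; last first.
  by rewrite ltnS; near: Q; exact: nbhs_infty_ge.
move=> x i h /andP[h0 hQ].
have QrV : mesh Q < r / V by near: Q; exact: mesh_small.
have QeL : mesh Q < e / c / 2 / (L + 1) by near: Q; exact: mesh_small.
have -> : wave_fun phi (x + h *: delta_mx 0 i) - wave_fun phi x =
   unit_exp (dot x) * ((unit_exp (h * v i 0) - 1) * phi (present (x + h *: delta_mx 0 i))
     + (phi (present x + h *: delta_mx 0 (lshift 1 i)) - phi (present x))).
  have -> : present x + h *: delta_mx 0 (lshift 1 i) = present (x + h *: delta_mx 0 i).
    apply/rowP => j; rewrite !mxE; case: (fintype.splitP j) => l jl; rewrite ?mxE eqxx /=.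
      by rewrite -!val_eqE /= jl.
    have -> : (j == lshift 1 i) = false.
      by rewrite -val_eqE /= jl gtn_eqF// ltn_addr.
    by rewrite mulr0 addr0.
  rewrite /wave_fun dotD unit_expD dotZ.
  have -> : dot (delta_mx 0 i) = v i 0 by rewrite /dot -rowE mxE.
  ring.
rewrite cabsM cabs_unit_exp mul1r (le_trans (cabsD _ _))// [leRHS]splitr; apply: lerD.
  rewrite cabsM -[leRHS](@divfK _ B) ?gt_eqF//.
  apply: ler_pM; rewrite ?cabs_ge0 ?pB// ltW// rP// normrM (ger0_norm h0).
  apply: (@le_lt_trans _ _ (mesh Q * V)); last by rewrite -ltr_pdivlMr.
  by apply: ler_pM; rewrite ?Vi.
rewrite (le_trans (lip _ _))// l1normZ ger0_norm//.
have -> : l1norm (delta_mx 0 (lshift 1 i) : 'rV[R]_(d + 1)) = 1.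
  rewrite /l1norm (bigD1 (lshift 1 i))//= mxE !eqxx normr1 big1 ?addr0// => j ji.
  by rewrite mxE (negbTE ji) andbF normr0.
rewrite mulr1; apply: (@le_trans _ _ ((L + 1) * mesh Q)).
  by apply: ler_pM; rewrite ?lerDl.
by rewrite mulrC -ler_pdivlMr// ltW.
Unshelve. all: by end_near. Qed.

Lemma plane_wave_past : vanishes_on (@past R d) plane_wave.
Proof.
move=> phi phi0; apply: ulim_eq0; first exact: wave_bounded.
move=> e e0; apply: filterE => Q.
rewrite (_ : wave_fun phi = fun=> 0) ?lattice_sum0 ?cabs0 ?ltW//.
apply/funext => x; rewrite /wave_fun.
have [->|px] := eqVneq (phi (present x)) 0; first by rewrite mulr0.
have := phi0 _ (supp_sub px); rewrite /past /= => H.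
suff : (0 : R) < 0 by rewrite ltxx.
by move: H; rewrite row_mxKr mxE.
Qed.

(** On a bump concentrated near the origin the factor exp(2 i pi x.v) has real
   part at least 1/2. *)
Lemma plane_wave_neq0 : plane_wave <> 0.
Proof.
have h2 : 0 < 1 / 2 :> R by rewrite divr_gt0.
have [r r0 rP] := unit_exp_near1 h2.
pose V : R := \sum_i `|v i 0| + 1.
have V0 : 0 < V by rewrite ltr_wpDl// sumr_ge0.
(* On the cube of half-side 2 / m one has |x.v| < r. *)
pose m := (Num.truncn (2 * V / r)).+1.
have m0 : 0 < m%:R :> R by rewrite ltr0n.
have mr : 2 / m%:R * V < r.
  rewrite mulrAC ltr_pdivrMr// mulrC [r * _]mulrC -ltr_pdivrMr//.
  by rewrite [V * 2]mulrC; exact: truncnS_gt.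
have e0 : 0 < 2 / m%:R :> R by rewrite divr_gt0.
have [rho [rhoK rhoR [c c0 rhoc]]] := bump_exists (d + 1) e0.
have reg x : (forall i, `|x 0 i| <= 2 / m%:R) -> 1 / 2 <= complex.Re (unit_exp (dot x)).
  move=> xm; have xr : `|dot x| < r.
    apply: le_lt_trans mr; apply: (le_trans (dot_le x)).
    apply: (@le_trans _ _ (\sum_i 2 / m%:R * `|v i 0|)).
      by apply: ler_sum => i _; rewrite ler_wpM2r.
    by rewrite -mulr_sumr ler_wpM2l ?(ltW e0)// lerDl.
  have := le_lt_trans (Re_le_cabs _) (rP _ xr); rewrite ReB ltr_norml => /andP[+ _].
  by move: (complex.Re (unit_exp _)) => u /=; lra.
have waveE x : complex.Re (wave_fun rho x) =
    complex.Re (unit_exp (dot x)) * complex.Re (rho (present x)).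
  have [+ _] := rhoR (present x); rewrite /wave_fun.
  by case: (rho _) (unit_exp _) => u u' [t t'] /= ->; rewrite mulr0 subr0.
have wave0 x : 0 <= complex.Re (wave_fun rho x).
  rewrite waveE; have [rx|rx] := eqVneq (rho (present x)) 0; first by rewrite rx mulr0.
  apply: mulr_ge0; last by have [] := rhoR (present x).
  apply: le_trans (reg x _); first exact: ltW.
  by move=> i; have := rhoK _ rx (lshift 1 i); rewrite row_mxEl.
have wavec x : (forall i, `|x 0 i| <= m%:R^-1) -> 1 / 2 * c <= complex.Re (wave_fun rho x).
  move=> xm; rewrite waveE; apply: ler_pM; [exact: ltW|exact: ltW| |].
    by apply: reg => i; rewrite (le_trans (xm i))// ler_peMl ?invr_ge0// ler1n.
  apply: rhoc => i; rewrite mulrAC divff// mul1r.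
  rewrite mxE; case: (fintype.splitP i) => j _; first exact: xm.
  by rewrite mxE normr0 invr_ge0.
move=> /(congr1 (fun w : distribution (d + 1) => complex.Re (w rho))) H.
have : 1 / 2 * c / m%:R ^+ d <= complex.Re (plane_wave rho).
  apply: Re_ulim_ge; first exact: wave_bounded.
  exists 1%N => // Q Q0; apply: Re_lattice_sum_ge => //.
  by rewrite mulr_ge0// ltW.
rewrite H /= => /le_lt_trans.
have : 0 < 1 / 2 * c / m%:R ^+ d by rewrite divr_gt0 ?exprn_gt0// mulr_gt0.
move=> pos /(_ _ pos); rewrite ltxx.
by [].
Qed.

End PlaneWave.

(** * Distributions with a pure spatial frequency *)

Section Eigendistributions.
Context {R : realType}.
Variable d : nat.
Implicit Types (w u : @distribution R (d + 1)) (v : 'cV[R]_d) (y : 'rV[R]_d).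
Local Notation C := (R[i]^o).
Local Notation time := (rshift d (0 : 'I_1)).
Local Notation spatial y := (row_mx y (0 : 'rV[R]_1)).

Lemma past_coord : @past R d = [set z | z 0 time < 0].
Proof. by apply/seteqP; split=> z; rewrite /past /= mxE. Qed.

(** In the time direction [symbol_point] puts the indeterminate instead. *)
Definition frequency v (i : 'I_(d + 1)) : R[i] :=
  match fintype.split i with
  | inl l => (2 * pi)%:C * 'i%C * (v l 0)%:C
  | inr _ => 0
  end.

Definition symbol m n (M : 'M[mpoly (d + 1) R[i]]_(m, n)) v : 'M[{poly R[i]}]_(m, n) :=
  map_mx (mmap polyC (symbol_point time (frequency v))) M.

Lemma eval_symbol m n (M : 'M[mpoly (d + 1) R[i]]_(m, n)) v t :
  eval_mx (symbol M v) t = eval_at M v t.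
Proof.
apply/matrixP => i j; rewrite !mxE /horner_eval /meval /mmap horner_sum.
apply: eq_bigr => mu _; rewrite hornerM hornerC; congr (_ * _).
rewrite /mmap1 horner_prod; apply: eq_bigr => l _; rewrite horner_exp; congr (_ ^+ _).
rewrite /symbol_point /frequency; case: (fintype.splitP l) => e le.
  have -> : (l == time) = false by rewrite -val_eqE /= le ltn_eqF// ltn_addr.
  by rewrite hornerC.
by rewrite -val_eqE /= le (ord1 e) eqxx hornerX.
Qed.

(** w behaves in space like the exponential exp(2 i pi x.v). *)
Definition spatial_eigen v w := forall y phi,
  w (test_shift (spatial y) phi) = unit_exp (- dot v y) * w phi.

(** The derivative of y |-> w(phi(. + y)) is computed on phi and on the factor
   exp(- 2 i pi y.v). *)
Lemma spatial_eigen_derivs v w : spatial_eigen v w ->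
  eigen_derivs time (frequency v) w.
Proof.
move=> ew i it; apply: distribution_ext => phi.
rewrite -[RHS]/(frequency v i * w phi) dderivE.
have [l il] : exists l, i = lshift 1 l.
  by have [//|ie] := split_index i; rewrite ie eqxx in it.
rewrite /frequency il (unsplitK (inl l)); set c := (2 * pi)%:C * 'i%C.
apply/eqP; rewrite -subr_eq0 -opprD oppr_eq0 -cabs_eq0 eq_le cabs_ge0 andbT.
apply/ler_addgt0Pl => e e0; rewrite addr0.
pose h (j : nat) : R := mesh j.
have hn0 j : h j != 0 by rewrite gt_eqF ?mesh_gt0.
have h0 (a : R) : 0 < a -> \forall j \near \oo, `|h j| < a.
  by move=> /mesh_small; apply: filterS => j; rewrite gtr0_norm ?mesh_gt0.
have e2 : 0 < e / 2 by rewrite divr_gt0.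
have b0 : 0 < cabs (w phi) + 1 by rewrite ltr_wpDl ?cabs_ge0.
have eb : 0 < e / 2 / (cabs (w phi) + 1) by rewrite divr_gt0.
have [N1 _ H1] := dderiv_shift_quotient w (lshift 1 l) phi hn0 h0 e2.
have [N2 _ H2] := unit_exp_quotient (- v l 0) hn0 h0 eb.
pose j := maxn N1 N2.
have {}H1 := H1 j (leq_maxl _ _); have {}H2 := H2 j (leq_maxr _ _).
have dl (s : R) : s *: delta_mx 0 (lshift 1 l) = spatial (s *: delta_mx 0 l) :> 'rV[R]_(d + 1).
  apply/rowP => q; rewrite !mxE; case: (fintype.splitP q) => q' qq'; rewrite ?mxE eqxx /=.
    by rewrite -!val_eqE /= qq'.
  by rewrite -val_eqE /= qq' gtn_eqF ?mulr0// ltn_addr.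
rewrite /= dl ew dotZ in H1.
have dv : dot v (delta_mx 0 l) = v l 0 by rewrite /dot -rowE mxE.
rewrite dv in H1.
have hv : - v l 0 * h j = - (h j * v l 0) by rewrite mulNr mulrC.
rewrite /= hv -/c in H2; move: H1 H2.
set q := (h j)^-1%:C; set x := unit_exp _ => H1 H2.
have -> : w (test_deriv (lshift 1 l) phi) + c * (v l 0)%:C * w phi =
  - (q * (x * w phi - w phi) - w (test_deriv (lshift 1 l) phi))
  + (q * (x - 1) - c * (- v l 0)%:C) * w phi.
  by rewrite rmorphN; ring.
rewrite (le_trans (cabsD _ _))// cabsN [e]splitr lerD ?(ltW H1)// cabsM.
apply: (@le_trans _ _ (e / 2 / (cabs (w phi) + 1) * (cabs (w phi) + 1))).
  by apply: ler_pM; rewrite ?cabs_ge0 ?(ltW H2)// lerDl.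
by rewrite divfK// gt_eqF.
Qed.

Lemma spatial_eigen_poly_op v w i (p : {poly R[i]}) : spatial_eigen v w ->
  spatial_eigen v (poly_op (@dderiv R (d + 1) i) p w).
Proof.
move=> ew y phi.
have lin : linear (@dshift R (d + 1) (spatial y)).
  by move=> c u1 u2; exact: distribution_ext.
have comm u : dshift (spatial y) (dderiv i u) = dderiv i (dshift (spatial y) u).
  apply: distribution_ext => psi.
  rewrite dderivE -[LHS]/(dderiv i u (test_shift _ psi)) dderivE.
  by rewrite test_deriv_shift.
have dw : dshift (spatial y) w = unit_exp (- dot v y) *: w.
  by apply: distribution_ext => psi; exact: ew.
rewrite -[LHS]/(dshift (spatial y) (poly_op _ p w) phi).
by rewrite (poly_op_comm p w lin comm) dw poly_opZv//; exact: dderiv_linear.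
Qed.

Lemma matrix_deriv_eigen m n (M : 'M[mpoly (d + 1) R[i]]_(m, n)) v
    (w : 'I_n -> distribution (d + 1)) : (forall j, spatial_eigen v (w j)) ->
  forall i, matrix_deriv M w i =
    \sum_j poly_op (@dderiv R (d + 1) time) (symbol M v i j) (w j).
Proof.
move=> ew i; apply: eq_bigr => j _; rewrite (poly_deriv_eigen _ (spatial_eigen_derivs (ew j))).
by rewrite mxE.
Qed.

Lemma tensor_shift (psi : test R d) (rho : test R 1) y :
  test_tensor (test_shift y psi) rho = test_shift (spatial y) (test_tensor psi rho).
Proof.
apply: test_ext => z; rewrite test_shiftE.
rewrite -[LHS]/(psi (lsubmx z + y) * rho (rsubmx z)).
rewrite -[RHS]/(psi (lsubmx (z + spatial y)) * rho (rsubmx (z + spatial y))).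
congr (psi _ * rho _); apply/rowP => i; rewrite !mxE.
  by rewrite (unsplitK (inl i)).
by rewrite (unsplitK (inr i)) mxE addr0.
Qed.

(** Slices only test w on tensor products, which is enough by totality. *)
Lemma spatially_periodicP (a : 'I_d -> 'rV[R]_d) w :
  spatially_periodic a w <-> forall k, shift_periodic (spatial (a k)) w.
Proof.
split=> [pw k phi|pw rho k].
  suff : dshift (spatial (a k)) w - w = 0.
    by move/eqP; rewrite subr_eq0 => /eqP /(congr1 (fun u : distribution (d + 1) => u phi)).
  apply: tensors_total => psi rho.
  rewrite -[LHS]/(w (test_shift (spatial (a k)) (test_tensor psi rho)) - w (test_tensor psi rho)).
  have := congr1 (fun u : distribution d => u psi) (pw rho k).
  rewrite -[X in X = _ -> _]/(w (test_tensor (test_shift (a k) psi) rho)) tensor_shift => ->.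
  by rewrite -[(dslice w rho) psi]/(w (test_tensor psi rho)) subrr.
apply: distribution_ext => psi.
rewrite -[LHS]/(w (test_tensor (test_shift (a k) psi) rho)) tensor_shift.
exact: pw.
Qed.

End Eigendistributions.

Section Transport.
Context {R : realType}.
Variable k : nat.

Lemma poly_deriv_equivariant (T : @distribution R k -> @distribution R k)
    (P : mpoly k R[i]) w : linear T ->
  (forall i w, T (dderiv i w) = dderiv i (T w)) ->
  T (poly_deriv P w) = poly_deriv P (T w).
Proof.
move=> linT Td; have T0 := lin_op0 linT.
rewrite /poly_deriv; elim/big_rec2 : _ => [//|mu x y _ <-]; rewrite linT.
congr (_ *: _ + _); rewrite /monomial_deriv.
elim: (enum _) => //= i s <-; elim: (mu i) => //= n <-.
exact: Td.
Qed.

Lemma matrix_deriv_equivariant (T : @distribution R k -> @distribution R k) m n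
    (M : 'M[mpoly k R[i]]_(m, n)) (w : 'I_n -> distribution k) i : linear T ->
  (forall i w, T (dderiv i w) = dderiv i (T w)) ->
  T (matrix_deriv M w i) = matrix_deriv M (fun j => T (w j)) i.
Proof.
move=> linT Td; rewrite /matrix_deriv.
elim/big_rec2 : _ => [|j x y _ <-]; first exact: lin_op0.
by rewrite (lin_opD linT) poly_deriv_equivariant.
Qed.

End Transport.

(** * Uniqueness for full-rank symbols *)

Section Lattice.
Context {R : realType}.
Variable d : nat.
Variable a : 'I_d -> 'rV[R]_d.
Hypothesis a_free : free [tuple a k | k < d].
Local Notation A := (\matrix_(k < d) a k).
Local Notation C := (R[i]^o).
Local Notation spatial y := (row_mx y (0 : 'rV[R]_1)).

Lemma lattice_unitmx : A \in unitmx.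
Proof.
rewrite -row_free_unit -kermx_eq0; apply/rowV0P => u /sub_kermxP uA.
have /freeP : free [tuple a k | k < d] by [].
move=> /(_ (u 0)) H; apply/rowP => i; rewrite mxE; apply: H.
rewrite -[RHS]uA mulmx_sum_row; apply: eq_bigr => k _.
by rewrite rowK -tnth_nth tnth_mktuple.
Qed.

Lemma dot_lattice (z : 'cV[int]_d) (s : 'rV[R]_d) :
  dot (invmx A *m map_mx intr z) (s *m A) = \sum_k s 0 k * (z k 0)%:~R.
Proof.
rewrite /dot mulmxA -[s *m A *m _]mulmxA mulmxV ?lattice_unitmx// mulmx1 mxE.
by apply: eq_bigr => k _; rewrite mxE.
Qed.

(** A vector y is the combination of the a_k with coefficients y A^-1, and
   (y A^-1) z = y.(A^-1 z). *)
Lemma spatial_eigen_lattice (z : 'cV[int]_d) (w : @distribution R (d + 1)) :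
  (forall k (r : R) phi, w (test_shift (r *: spatial (a k)) phi) =
     unit_exp (- ((z k 0)%:~R * r)) * w phi) ->
  spatial_eigen (invmx A *m map_mx intr z) w.
Proof.
move=> ew y phi; pose s := y *m invmx A.
have yE : y = s *m A by rewrite /s mulmxKV// lattice_unitmx.
rewrite {2}yE dot_lattice.
have -> : spatial y = \sum_k s 0 k *: spatial (a k).
  rewrite {1}yE mulmx_sum_row; elim/big_rec2 : _ => [|k x x' _ <-]; first by rewrite row_mx0.
  by rewrite rowK scale_row_mx scaler0 add_row_mx addr0.
elim: (index_enum _) phi => [|k r IH] phi.
  by rewrite !big_nil oppr0 unit_exp0 mul1r test_shift0.
rewrite !big_cons -test_shiftD ew IH mulrA -unit_expD; congr (unit_exp _ * _).
by rewrite opprD mulrC.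
Qed.

(** The induction splits off one lattice direction at a time: by completeness a
   tuple vanishes once all its Fourier parts in that direction do, and these
   satisfy the same equations. *)
Lemma behaviour_past_eq0 m n (M : 'M[mpoly (d + 1) R[i]]_(m, n)) :
  (forall v, inverse_lattice A v -> exists t, \rank (eval_at M v t) = n) ->
  forall w : 'I_n -> distribution (d + 1), behaviour a M w ->
  (forall j, vanishes_on (@past R d) (w j)) -> forall j, w j = 0.
Proof.
move=> full w [/= per eqs] van.
have {}per j k : shift_periodic (spatial (a k)) (w j).
  by have /spatially_periodicP := per j.
suff main (r : seq 'I_d) (z : 'cV[int]_d) : forall w : 'I_n -> distribution (d + 1),
    (forall j k, shift_periodic (spatial (a k)) (w j)) ->
    (forall i, matrix_deriv M w i = 0) ->
    (forall j, vanishes_on (@past R d) (w j)) ->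
    (forall j k, k \notin r -> forall (s : R) phi,
       w j (test_shift (s *: spatial (a k)) phi) = unit_exp (- ((z k 0)%:~R * s)) * w j phi) ->
    forall j, w j = 0.
  by apply: (main (enum 'I_d) 0 w) => // j k; rewrite mem_enum.
elim: r z {w per eqs van} => [|k r IH] z w per eqs van eig j.
  pose v := invmx A *m map_mx intr z : 'cV[R]_d.
  have ew i : spatial_eigen v (w i).
    by apply: spatial_eigen_lattice => l s phi; exact: eig.
  have [|t rt] := full v; first by exists z.
  rewrite -eval_symbol in rt; have [U [p p0 UQ]] := poly_left_inverse rt.
  have lin := @dderiv_linear R (d + 1) (rshift d 0).
  apply: (poly_op_unique p0 (i := rshift d 0)); last by have := van j; rewrite past_coord.
  rewrite (_ : poly_op _ p (w j) = \sum_l poly_op (@dderiv R (d + 1) (rshift d 0))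
      ((U *m symbol M v) j l) (w l)); last first.
    rewrite UQ (bigD1 j)//= mxE eqxx mulr1n big1 ?addr0// => l lj.
    by rewrite mxE eq_sym (negbTE lj) mulr0n poly_op0.
  (* Row j of U applied to the equations gives p(d/dt) w_j. *)
  have H i : poly_op (@dderiv R (d + 1) (rshift d 0)) (U j i) (matrix_deriv M w i) =
      \sum_l poly_op (@dderiv R (d + 1) (rshift d 0)) (U j i * symbol M v i l) (w l).
    rewrite (matrix_deriv_eigen M ew).
    elim/big_rec2 : _ => [|l x y _ <-]; first exact: poly_opv0.
    by rewrite poly_opDv// poly_opM.
  under eq_bigr => l _ do rewrite mxE poly_op_sum.
  rewrite exchange_big big1// => i _.
  by rewrite -H eqs poly_opv0.
apply: (fourier_part_complete (per j k)) => y.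
pose z' : 'cV[int]_d := \col_i (if i == k then y else z i 0).
apply: (IH z' (fun j => fourier_part (spatial (a k)) y (w j))) => {j}.
- move=> j l phi; have := @fourier_part_equivariant R (d + 1) (spatial (a k)) y (w j)
    (spatial (a l)) 1 _ phi; rewrite mul1r; apply=> psi.
  by rewrite mul1r; exact: per.
- move=> i; rewrite -(@matrix_deriv_equivariant R _ (fourier_part (spatial (a k)) y)).
  + by rewrite eqs lin_op0//; exact: fourier_part_linear.
  + exact: fourier_part_linear.
  + exact: fourier_part_dderiv.
- move=> j; apply: fourier_part_vanishes => // s phi phiU.
  have past_closed_shift (psi : test R (d + 1)) : supp (test_shift (s *: spatial (a k)) psi) `<=`
      shift (- (s *: spatial (a k))) @` supp psi.
    apply: supp_subset; first exact: compact_shift (@compact_supp_test _ _ _).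
    by move=> x fx; exists (x + s *: spatial (a k)); [exact: supp_sub|exact: addrK].
  move=> x /past_closed_shift[x' /phiU x'U <-]; move: x'U; rewrite past_coord /= !mxE.
  by rewrite (unsplitK (inr 0)) mxE mulr0 subr0.
- move=> j l lr s phi; rewrite mxE; have [->|lk] := eqVneq l k.
    exact: fourier_part_eigen.
  apply: fourier_part_equivariant => psi; apply: eig.
  by rewrite inE negb_or lk.
Qed.

End Lattice.

(** * A nonzero trajectory for a rank-deficient symbol *)

Section NonAutonomous.
Context {R : realType}.
Variable d : nat.
Variable a : 'I_d -> 'rV[R]_d.
Hypothesis a_free : free [tuple a k | k < d].
Local Notation A := (\matrix_(k < d) a k).
Local Notation spatial y := (row_mx y (0 : 'rV[R]_1)).

Lemma dot_basis (z : 'cV[int]_d) k :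
  dot (invmx A *m map_mx intr z) (a k) = (z k 0)%:~R.
Proof.
have -> : a k = delta_mx 0 k *m A by rewrite -rowE rowK.
rewrite dot_lattice// (bigD1 k)//= mxE !eqxx mul1r big1 ?addr0// => l lk.
by rewrite mxE (negbTE lk) andbF mul0r.
Qed.

(** A polynomial kernel vector r of the symbol yields the trajectory
   r(d/dt) applied to a plane wave at time 0. It has no past, so autonomy makes
   it 0, and then [poly_op_unique] makes the plane wave itself 0. *)
Lemma autonomous_full_rank m n (M : 'M[mpoly (d + 1) R[i]]_(m, n)) :
  autonomous (behaviour a M) -> forall v, inverse_lattice A v ->
  exists t, \rank (eval_at M v t) = n.
Proof.
move=> aut v [z _ vz]; apply: contrapT => nfull.
have [t|r r0 Qr] := @poly_kernel _ m n (symbol M v).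
  by rewrite eval_symbol => rt; apply: nfull; exists t.
pose w (j : 'I_n) := poly_op (@dderiv R (d + 1) (rshift d 0)) (r j 0) (plane_wave v).
have lin := @dderiv_linear R (d + 1) (rshift d 0).
have ew j : spatial_eigen v (w j).
  by apply: spatial_eigen_poly_op => y phi; exact: plane_wave_shift.
have w0 : forall j, w j = 0.
  apply: aut => [|j]; last exact/vanishes_on_poly_op/plane_wave_past.
  split=> [j|i].
    apply/spatially_periodicP => k phi.
    by rewrite ew -vz dot_basis -mulrNz unit_exp_int mul1r.
  rewrite (matrix_deriv_eigen M ew).
  rewrite (_ : \sum_j _ = poly_op (@dderiv R (d + 1) (rshift d 0))
     ((symbol M v *m r) i 0) (plane_wave v)).
    by rewrite Qr mxE poly_op0.
  by rewrite mxE poly_op_sum; apply: eq_bigr => j _; rewrite /w poly_opM.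
have [j rj] : exists j, r j 0 != 0.
  apply: contrapT => H; case/eqP: r0; apply/colP => j; rewrite [RHS]mxE.
  by apply/eqP; apply: contrapT => /negP rj; apply: H; exists j.
apply: (@plane_wave_neq0 R d v).
apply: (poly_op_unique rj (w0 j)).
by have := @plane_wave_past R d v; rewrite past_coord.
Qed.

End NonAutonomous.

Theorem theorem1p3 (R : realType) (d m n : nat) (d_ge1 : (1 <= d)%N)
    (a : 'I_d -> 'rV[R]_d) (a_free : free [tuple a k | k < d])
    (M : 'M[mpoly (d + 1) R[i]]_(m, n)) :
  autonomous (behaviour a M) <->
  (forall v : 'cV[R]_d, inverse_lattice (\matrix_(k < d) a k) v ->
     is_max [set \rank (eval_at M v t) | t in [set: R[i]]] n).
Proof.
split=> [aut v vA|full w]; last first.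
  apply: (behaviour_past_eq0 a_free) => v /full[[t _ rt] _].
  by exists t.
have [t rt] := autonomous_full_rank a_free aut vA.
by split=> [|_ [s _ <-]]; [exists t|exact: rank_leq_col].
Qed.
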